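(* Let $\varepsilon>0$ and let $G$ be a $D$-quasirandom compact metrizable group. Let $E\subseteq G\times G$ be Borel and set $\delta:=m_{G\times G}(E)$. Then the set \[A:=\Big\{g\in G:\ m_{G\times G}\big\{(x,y)\in G\times G:\ \{(x,y),(gx,y),(x,gy)\}\subseteq E\big\}\geq\delta^3-\varepsilon\Big\}\] satisfies $m_G(A)\geq 1-2\sqrt{3}\,D^{-1/4}/\varepsilon$.
   Context: $m_G$ and $m_{G\times G}$ denote the Haar probability measures. A compact group $G$ is $D$-quasirandom if every non-trivial irreducible continuous unitary representation of $G$ has complex dimension at least $D$. *)

(* Defs.v *)
From HB Require Import structures.
From mathcomp Require Import all_boot all_order all_algebra.
From mathcomp Require Import sesquilinear spectral.
From mathcomp Require Import complex.
From mathcomp Require Import all_classical all_reals all_analysis.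

Set Implicit Arguments.
Unset Strict Implicit.
Unset Printing Implicit Defensive.

Import Order.TTheory GRing.Theory Num.Theory.
Import numFieldNormedType.Exports.

Local Open Scope classical_set_scope.
Local Open Scope ring_scope.

HB.mixin Record isTopologicalGroup G & PointedTopological G & Group G := {
  mulg_continuous : continuous (fun p : G * G => (p.1 * p.2)%g) ;
  invg_continuous : continuous (fun x : G => x^-1%g)
}.

(* The base point of [G] plays no mathematical role: it is there because
   [measurableType] is a structure on pointed types. *)
#[short(type="topologicalGroupType")]
HB.structure Definition TopologicalGroup :=
  {G of PointedTopological G & Group G & isTopologicalGroup G}.

Section prod_topologicalGroup.
Variables G H : topologicalGroupType.

Let continuous_pair (S T U : topologicalType) (f : S -> T) (h : S -> U) :
  continuous f -> continuous h -> continuous (fun s => (f s, h s)).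
Proof. by move=> cf ch s; apply: cvg_pair; [exact: cf|exact: ch]. Qed.

Let continuous_mulg (S : topologicalType) (K : topologicalGroupType)
    (f h : S -> K) :
  continuous f -> continuous h -> continuous (fun s => (f s * h s)%g).
Proof.
move=> cf ch s.
apply: (@continuous_comp _ _ _ (fun t => (f t, h t))
  (fun p : K * K => (p.1 * p.2)%g)); last exact: mulg_continuous.
exact: continuous_pair.
Qed.

Let prod_mulg_continuous :
  continuous (fun p : (G * H) * (G * H) => (p.1 * p.2)%g).
Proof.
apply: continuous_pair; apply: continuous_mulg => p.
- by apply: (@continuous_comp _ _ _ fst fst); exact: cvg_fst.
- by apply: (@continuous_comp _ _ _ snd fst); [exact: cvg_snd|exact: cvg_fst].
- by apply: (@continuous_comp _ _ _ fst snd); [exact: cvg_fst|exact: cvg_snd].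
- by apply: (@continuous_comp _ _ _ snd snd); exact: cvg_snd.
Qed.

Let prod_invg_continuous : continuous (fun p : G * H => p^-1%g).
Proof.
apply: continuous_pair => p.
- by apply: (@continuous_comp _ _ _ fst (fun x : G => x^-1%g));
    [exact: cvg_fst|exact: invg_continuous].
- by apply: (@continuous_comp _ _ _ snd (fun x : H => x^-1%g));
    [exact: cvg_snd|exact: invg_continuous].
Qed.

HB.instance Definition _ := isTopologicalGroup.Build (G * H)%type
  prod_mulg_continuous prod_invg_continuous.

End prod_topologicalGroup.

Definition metrizable (R : realType) (T : topologicalType) : Prop :=
  exists d : T -> T -> R,
    [/\ forall x y, d x y = 0 <-> x = y,
        forall x y, d x y = d y x,
        forall x y z, d x z <= d x y + d y z
      & forall x, nbhs x = nbhs_ball_ (fun a e => [set b | d a b < e]) x].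

Notation borel T := (g_sigma_algebraType (@open T)).

(* On a compact metrizable group every Borel probability measure is regular, so
   left invariance alone characterizes the Haar probability measure there. *)
Definition is_haar (R : realType) (G : topologicalGroupType)
    (mu : probability (borel G) R) : Prop :=
  forall (g : G) (A : set (borel G)), measurable A ->
    mu [set (g * x)%g | x in (A : set G)] = mu A.

(* A continuous unitary representation on the Hilbert space C^n. *)
Definition unitary_rep (R : realType) (G : topologicalGroupType) (n : nat)
    (rho : G -> 'M[R[i]]_n) : Prop :=
  [/\ rho 1%g = 1%:M,
      forall g h, rho (g * h)%g = rho g *m rho h,
      forall g, rho g \is unitarymx
    & continuous (rho : G -> 'M[R[i]^o]_n)].

(* As in [mxrepresentation], matrices act on row vectors and a subspace is
   the row space of a square matrix. *)
Definition irreducible_rep (R : realType) (G : topologicalGroupType) (n : nat)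
    (rho : G -> 'M[R[i]]_n) : Prop :=
  (0 < n)%N /\
  forall U : 'M[R[i]]_n, (forall g, stablemx U (rho g)) ->
    U = 0 \/ row_full U.

Definition nontrivial_rep (R : realType) (G : topologicalGroupType) (n : nat)
    (rho : G -> 'M[R[i]]_n) : Prop :=
  exists g, rho g != 1%:M.

(* Only finite-dimensional representations need to be inspected: one of infinite
   dimension has dimension at least [D] for every [D]. *)
Definition quasirandom (R : realType) (D : R) (G : topologicalGroupType) : Prop :=
  forall (n : nat) (rho : G -> 'M[R[i]]_n),
    unitary_rep rho -> irreducible_rep rho -> nontrivial_rep rho -> D <= n%:R.

(* Main.v *)
Require Import Defs.
From mathcomp Require Import all_boot all_order all_algebra.
From mathcomp Require Import sesquilinear spectral complex.
From mathcomp Require Import ring lra.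
From mathcomp Require Import all_classical all_reals all_analysis.
From mathcomp Require Import measurable_realfun.

Set Implicit Arguments.
Unset Strict Implicit.
Unset Printing Implicit Defensive.

Import Order.TTheory GRing.Theory Num.Theory.
Import numFieldNormedType.Exports.

Local Open Scope classical_set_scope.
Local Open Scope ring_scope.
Local Open Scope sesquilinear_scope.

(** Let f be a continuous function on G x G with values in [0,1], close in L1 to the indicator of E,
    and let a(y) and b(x) be its averages over the first and over the second variable. For most g
    the corner count, the mean of f(x,y) f(gx,y) f(x,gy), is close to the mean of f(x,y) a(y) b(x),
    which does not depend on g. The latter is at least t^3, where t is the mean of f
    ([corner_limit_ge]): integrate the AM-GM inequality a b >= 3 t^2 - t^3/a - t^3/b against f,
    since f/a and f/b have mean at most 1.

    Quasirandomness enters through [mixing]: averaged over g, the functions H(gx,y) and F(x,gy) are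
    uncorrelated up to (2D)^-1 times the sum of the squared norms of H and F. To see this, subtract
    from H its average in y. What remains is approximated in L2 by combinations, in y, of an
    orthonormal family of mean-zero functions whose span is finite-dimensional and invariant under
    left translation ([rep_approx]). On this span g acts by an orthogonal representation without
    fixed vectors, and the average becomes a correlation of matrix coefficients. After
    complexification the representation splits into nontrivial irreducible ones, of dimension at
    least D, and for each of them Schur orthogonality and Bessel's inequality give the bound
    ([coeff_irreducible], [coeff_bound]). The invariant spaces are eigenspaces of a convolution
    operator; the spectral theory of symmetric continuous kernels that provides them ends in
    [spectral_truncation].

    The passage from [mixing] to corners consists of Cauchy-Schwarz arguments. [corr_bound] bounds
    correlations of u(x,y) with v(gx,y), [autocorr_variance] shows that autocorrelations are nearly
    constant, and [twisted_corr] bounds the second moment of the mean of h(gx,y) f(x,gy). With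
    these, [error_term_bound] controls the cost of replacing f(gx,y) by a(y), and [corner_count_L2]
    gives the mean square deviation 7 / sqrt D. Markov's inequality concludes ([good_set_measure]).

    All of the analysis is done for continuous functions and an abstract positive normalized
    functional, a [mean]. Measures return only at the end: [haar_prodE] identifies the Haar integral
    on G x G with the iterated mean, and [indicator_approximation] passes from continuous functions
    to Borel sets. *)

(** * Continuity of composite maps *)

Section continuity.
Variable R : realType.
Implicit Types T U V W : topologicalType.

Lemma ct_id T : continuous (fun x : T => x).
Proof. by move=> x; exact: cvg_id. Qed.

Lemma ct_cst T U (c : U) : continuous (fun _ : T => c).
Proof. by move=> x; exact: cvg_cst. Qed.

Lemma ct_comp T U V (f : U -> V) (h : T -> U) :
  continuous f -> continuous h -> continuous (fun x => f (h x)).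
Proof. by move=> cf ch x; apply: (continuous_comp (ch x)); exact: cf. Qed.

Lemma ct_pair T U V (f : T -> U) (h : T -> V) :
  continuous f -> continuous h -> continuous (fun x => (f x, h x)).
Proof. by move=> cf ch x; apply: cvg_pair; [exact: cf|exact: ch]. Qed.

Lemma ct_comp2 T U V W (f : U -> V -> W) (a : T -> U) (b : T -> V) :
  continuous (fun p : U * V => f p.1 p.2) -> continuous a -> continuous b ->
  continuous (fun x => f (a x) (b x)).
Proof. by move=> cf ca cb; exact: (ct_comp cf (ct_pair ca cb)). Qed.

Lemma ct_fst U V : continuous (@fst U V).
Proof. by move=> x; exact: cvg_fst. Qed.

Lemma ct_snd U V : continuous (@snd U V).
Proof. by move=> x; exact: cvg_snd. Qed.

Lemma ct_mulg T (G : topologicalGroupType) (f h : T -> G) :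
  continuous f -> continuous h -> continuous (fun x => (f x * h x)%g).
Proof.
move=> cf ch; exact: (ct_comp (@mulg_continuous G) (ct_pair cf ch)).
Qed.

Lemma ct_invg (G : topologicalGroupType) : continuous (fun x : G => x^-1%g).
Proof. exact: invg_continuous. Qed.

Lemma ct_add T (f h : T -> R) :
  continuous f -> continuous h -> continuous (fun x => f x + h x).
Proof. by move=> cf ch x; apply: cvgD; [exact: cf|exact: ch]. Qed.

Lemma ct_mul T (f h : T -> R) :
  continuous f -> continuous h -> continuous (fun x => f x * h x).
Proof. by move=> cf ch x; apply: cvgM; [exact: cf|exact: ch]. Qed.

Lemma ct_opp T (f : T -> R) : continuous f -> continuous (fun x => - f x).
Proof. by move=> cf x; apply: cvgN; exact: cf. Qed.

Lemma ct_exp T (f : T -> R) n : continuous f -> continuous (fun x => f x ^+ n).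
Proof.
move=> cf; elim: n => [|n IH]; first exact: ct_cst.
by under eq_fun do rewrite exprS; exact: ct_mul.
Qed.

Lemma ct_norm T (f : T -> R) : continuous f -> continuous (fun x => `|f x|).
Proof. by move=> cf x; apply: cvg_norm; exact: cf. Qed.

Lemma ct_sum T (A : finType) (f : A -> T -> R) :
  (forall i, continuous (f i)) -> continuous (fun x => \sum_i f i x).
Proof.
move=> cf; elim: (index_enum A) => [|i s IH].
  by under eq_fun do rewrite big_nil; exact: ct_cst.
by under eq_fun do rewrite big_cons; exact: ct_add.
Qed.

Lemma ct_inv T (f : T -> R) :
  (forall x, f x != 0) -> continuous f -> continuous (fun x => (f x)^-1).
Proof. by move=> f0 cf x; apply: cvgV => //; exact: cf. Qed.

End continuity.

(** * Means: positive normalized functionals on continuous functions *)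

Section mean.
Variable R : realType.

(* A normalized positive linear functional on the continuous real functions of a
   compact space; it is irrelevant what [I] does on other functions. *)
Record mean (T : topologicalType) (I : (T -> R) -> R) : Prop := Mean {
  mean_compact : compact [set: T];
  meanD : forall f h : T -> R, continuous f -> continuous h ->
    I (fun x => f x + h x) = I f + I h;
  meanZ : forall (c : R) (f : T -> R), continuous f -> I (fun x => c * f x) = c * I f;
  mean_ge0 : forall f : T -> R, continuous f -> (forall x, 0 <= f x) -> 0 <= I f;
  mean1 : I (fun=> 1) = 1 }.

(** The quantitative tube lemma: compactness of [U] makes continuity at the points of the slice over
    [x0] uniform in the second variable. *)
Lemma tube (T U : topologicalType) (F : T * U -> R) (x0 : T) (e : R) :
  compact [set: U] -> continuous F -> 0 < e ->
  \forall x \near x0, forall y, `|F (x, y) - F (x0, y)| < e.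
Proof.
move=> cU cF e0.
have /compact_near_coveringP/(_ T (nbhs x0)
  (fun x y => `|F (x, y) - F (x0, y)| < e) _) H := cU.
have : forall y : U, [set: U] y ->
   \forall y' \near y & x \near x0, `|F (x, y') - F (x0, y')| < e.
  move=> y _.
  have e2 : 0 < e / 2 by rewrite divr_gt0.
  have := cF (x0, y) => /cvgrPdist_lt /(_ _ e2) [[A B] /= [Ax By] AB].
  exists (B, A) => //= -[y' x] /= [By' Ax'].
  have h1 : `|F (x0, y) - F (x, y')| < e / 2 by apply: (AB (x, y')).
  have h2 : `|F (x0, y) - F (x0, y')| < e / 2.
    by apply: (AB (x0, y')); split => //=; exact: nbhs_singleton.
  have -> : F (x, y') - F (x0, y') =
    (F (x0, y) - F (x0, y')) - (F (x0, y) - F (x, y')) by ring.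
  apply: le_lt_trans (ler_normB _ _) _.
  by rewrite (splitr e) ltrD.
by move=> /H; apply: filterS => x hx y; exact: hx.
Qed.

Section mean_theory.
Variables (T : topologicalType) (I : (T -> R) -> R).
Hypothesis mI : mean I.

Lemma mean_cst c : I (fun=> c) = c.
Proof.
have /= := @meanZ _ _ mI c (fun=> 1) (@ct_cst _ _ _).
by under eq_fun do rewrite mulr1; rewrite (mean1 mI) mulr1.
Qed.

Lemma meanN (f : T -> R) : continuous f -> I (fun x => - f x) = - I f.
Proof.
move=> cf; rewrite -mulN1r -(meanZ mI) //; congr I.
by apply/funext => x; rewrite mulN1r.
Qed.

Lemma meanB (f h : T -> R) : continuous f -> continuous h ->
  I (fun x => f x - h x) = I f - I h.
Proof. by move=> cf ch; rewrite (meanD mI cf (ct_opp ch)) meanN. Qed.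

Lemma meanZr (c : R) (f : T -> R) : continuous f -> I (fun x => f x * c) = I f * c.
Proof.
move=> cf; rewrite mulrC -(meanZ mI) //; congr I.
by apply/funext => x; rewrite mulrC.
Qed.

Lemma mean_sum (A : finType) (f : A -> T -> R) : (forall i, continuous (f i)) ->
  I (fun x => \sum_i f i x) = \sum_i I (f i).
Proof.
move=> cf; suff H s : continuous (fun x => \sum_(i <- s) f i x) /\
    I (fun x => \sum_(i <- s) f i x) = \sum_(i <- s) I (f i) by apply H.
elim: s => [|i s [ch IH]].
  rewrite big_nil; under eq_fun do rewrite big_nil.
  by split; [exact: ct_cst|exact: mean_cst].
rewrite big_cons; under eq_fun do rewrite big_cons.
by split; [exact: ct_add|rewrite (meanD mI) ?IH].
Qed.

Lemma le_mean (f h : T -> R) : continuous f -> continuous h -> (forall x, f x <= h x) ->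
  I f <= I h.
Proof.
move=> cf ch fh; rewrite -subr_ge0 -meanB //; apply: (mean_ge0 mI).
  exact: ct_add (ct_opp cf).
by move=> x; rewrite subr_ge0.
Qed.

Lemma ler_norm_mean (f : T -> R) : continuous f -> `|I f| <= I (fun x => `|f x|).
Proof.
move=> cf; rewrite ler_norml; apply/andP; split.
  rewrite lerNl -meanN //; apply: le_mean => [||x].
  - exact: ct_opp.
  - exact: ct_norm.
  - by rewrite -normrN ler_norm.
by apply: le_mean => // [|x]; [exact: ct_norm|exact: ler_norm].
Qed.

Lemma mean_le_cst (f : T -> R) (c : R) : continuous f -> (forall x, f x <= c) -> I f <= c.
Proof. by move=> cf fc; rewrite -(mean_cst c); apply: le_mean => //; exact: ct_cst. Qed.

Lemma mean_ge_cst (f : T -> R) (c : R) : continuous f -> (forall x, c <= f x) -> c <= I f.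
Proof. by move=> cf fc; rewrite -(mean_cst c); apply: le_mean => //; exact: ct_cst. Qed.

Lemma mean_norm_le (f : T -> R) (c : R) : continuous f -> (forall x, `|f x| <= c) -> `|I f| <= c.
Proof.
move=> cf fc; apply: le_trans (ler_norm_mean cf) _.
by apply: mean_le_cst => //; exact: ct_norm.
Qed.

(** By [tube] the functions [F u] and [F u0] are uniformly close for [u] near [u0], and a mean does
    not increase the sup norm. *)
Lemma ct_mean (U : topologicalType) (F : U -> T -> R) :
  continuous (fun p : U * T => F p.1 p.2) -> continuous (fun u => I (F u)).
Proof.
move=> cF u0.
have cFu u : continuous (F u) by
  apply: (ct_comp cF (ct_pair (@ct_cst _ _ u) (@ct_id _))).
apply/cvgrPdist_lt => e e0.
have e2 : 0 < e / 2 by rewrite divr_gt0.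
have := tube u0 (mean_compact mI) cF e2; apply: filterS => u /= hu.
rewrite -meanB //; apply: (@le_lt_trans _ _ (e / 2)); last first.
  by rewrite ltr_pdivrMr // mulrDr mulr1 ltrDl.
apply: mean_norm_le => [|x]; first exact: ct_add (ct_opp _).
by rewrite distrC; apply: ltW.
Qed.

End mean_theory.
End mean.

(** * Automation of continuity goals *)

Ltac cts_leaf := solve [eassumption | exact: ct_fst | exact: ct_snd
  | exact: ct_invg | match goal with H : forall _, continuous _ |- _ => exact: H end
  | match goal with H : forall _ _, continuous _ |- _ => exact: H end].

Ltac cts2 cts :=
  lazymatch goal with
  | |- continuous (fun x => ?f (@?a x) (@?b x)) =>
      refine (@ct_comp2 _ _ _ _ f a b _ _ _); [cts_leaf|cts|cts]
  end.

(** The head of the function selects the rule. A general application is tried as a known continuous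
    function, a composition, a mean with a parameter (through [ct_mean]), and a continuous function
    of two arguments. *)
Ltac cts :=
  cbv beta;
  lazymatch goal with
  | |- continuous (fun x => x) => exact: ct_id
  | |- continuous (fun _ => ?c) => exact: ct_cst
  | |- continuous (fun x => (@?a x, @?b x)) => refine (@ct_pair _ _ _ a b _ _); cts
  | |- continuous (fun x => (@?a x * @?b x)%g) => refine (@ct_mulg _ _ a b _ _); cts
  | |- continuous (fun x => @?a x + @?b x) => refine (@ct_add _ _ a b _ _); cts
  | |- continuous (fun x => @?a x * @?b x) => refine (@ct_mul _ _ a b _ _); cts
  | |- continuous (fun x => - @?a x) => refine (@ct_opp _ _ a _); cts
  | |- continuous (fun x => @?a x ^+ ?n) => refine (@ct_exp _ _ a n _); cts
  | |- continuous (fun x => `| @?a x |) => refine (@ct_norm _ _ a _); cts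
  | |- continuous (fun x => \sum_i (@?a x i)) =>
      refine (@ct_sum _ _ _ (fun i x => a x i) _); cts
  | |- continuous (fun x => ?f (@?h x)) =>
      first [ cts_leaf
        | refine (@ct_comp _ _ _ f h _ _); [cts_leaf|cts]
        | lazymatch goal with
          | H : @mean _ _ f |- _ => refine (@ct_mean _ _ _ H _ h _); cts
          end
        | cts2 cts
        | refine (@ct_comp _ _ _ f h _ _); [cts|cts] ]
  | |- continuous ?f => cts_leaf
  | |- forall _, _ => intro; cts
  end.

(** * Compact metrizable spaces: partitions of unity and exchange of two means *)

Definition metrized (R : realType) (T : topologicalType) := exists d : T -> T -> R,
  [/\ forall x, d x x = 0, forall x y, d x y = d y x,
    forall x y z, d x z <= d x y + d y z
    & forall x A, nbhs x A <-> exists2 e, 0 < e & forall y, d x y < e -> A y].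

Lemma metrizable_nbhs (R : realType) (T : topologicalType) :
  metrizable R T -> metrized R T.
Proof.
move=> [d [d0 dC dD dn]]; exists d; split => // [x|x A]; first exact/d0.
have -> : (nbhs x : set_system T) = nbhs_ball_ (fun a e => [set b | d a b < e]) x.
  exact: dn.
by split=> -[e /= e0 eA]; exists e => // y; exact: (eA y).
Qed.

Section compact.
Variable R : realType.
Variable T : topologicalType.
Hypothesis cT : compact [set: T].

(** Near-covering compactness is applied to the filter of finite sequences ordered by inclusion:
    each point has a neighbourhood that is covered once the sequence is large enough, hence one
    sequence serves all points. *)
Lemma finite_cover (P : T -> T -> Prop) :
  (forall x, \forall x' \near x, P x x') ->
  exists s : seq T, forall x', exists2 c, c \in s & P c x'.
Proof.
move=> HP.
pose F := filter_from [set: seq T] (fun s : seq T => [set s' : seq T | {subset s <= s'}]).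
have FF : Filter F.
  apply: filter_from_filter; first by exists [::].
  move=> s t _ _; exists (s ++ t) => // u su; split => x xs;
    by apply: su; rewrite mem_cat xs ?orbT.
have /compact_near_coveringP/(_ _ F (fun (s : seq T) x' => exists2 c, c \in s & P c x') FF)[] := cT.
  move=> x _; exists (P x, [set s' : seq T | {subset [:: x] <= s'}]) => /=.
    by split; [exact: HP|exists [:: x]].
  by move=> [x' s] /= [Px xs]; exists x => //; apply: xs; rewrite inE.
move=> s _ H; exists s => x'; have := H s; rewrite /=.
by move=> /(_ (fun _ => id) x' I).
Qed.

Lemma cts_bounded (f : T -> R) : continuous f ->
  exists2 C, 0 < C & forall x, `|f x| <= C.
Proof.
move=> cf.
have [s hs] : exists s : seq T, forall x, exists2 c, c \in s & `|f c - f x| < 1.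
  by apply: finite_cover => c; have := cf c => /cvgrPdist_lt; apply.
exists (1 + \sum_(c <- s) `|f c|) => [|x].
  by rewrite ltr_wpDr // sumr_ge0.
have [c cs fc] := hs x.
have h : `|f c| <= \sum_(c <- s) `|f c|.
  by rewrite (perm_big _ (perm_to_rem cs)) /= big_cons lerDl sumr_ge0.
apply: le_trans (_ : `|f c| + 1 <= _); last by rewrite addrC lerD2l.
have -> : f x = f c - (f c - f x) by ring.
by apply: le_trans (ler_normB _ _) _; rewrite lerD2l ltW.
Qed.

Hypothesis mT : metrizable R T.

Lemma metrizable_bump (x : T) (A : set T) : nbhs x A ->
  exists phi : T -> R, [/\ continuous phi, forall y, 0 <= phi y, 0 < phi x
    & forall y, 0 < phi y -> A y].
Proof.
have [d [d0 dC dD dn]] := metrizable_nbhs mT; move=> /dn[r r0 rA].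
have cd : continuous (d x).
  move=> y; apply/cvgrPdist_lt => e e0.
  apply/dn; exists e => //= z dyz; apply: le_lt_trans dyz.
  rewrite ler_norml; have := dD x y z; have := dD x z y; rewrite (dC z y).
  by move=> h1 h2; apply/andP; split; lra.
pose z y := r - d x y.
have zz y : z y <= `|z y| by exact: ler_norm.
have zN y : - z y <= `|z y| by rewrite -normrN ler_norm.
(* This is twice the positive part of [r - d x y]. *)
exists (fun y => z y + `|z y|); split => [||| y].
- by rewrite /z; cts.
- by move=> y; have := zN y; lra.
- by rewrite /z d0 subr0 gtr0_norm //; lra.
- have [h _|h] := ltP 0 (z y); first by apply: rA => /=; rewrite /z in h; lra.
  by rewrite ler0_norm // subrr ltxx.
Qed.

(** The [psi i] form a partition of unity subordinate to neighbourhoods of the [c i] on which [F x]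
    stays uniformly within [e] of [F (c i)]. The sum is then a convex combination of values within
    [e] of [F x y]. *)
Lemma partition_approx (U : topologicalType) (F : T -> U -> R) (e : R) :
  compact [set: U] -> continuous (fun p => F p.1 p.2) -> 0 < e ->
  exists n (c : 'I_n -> T) (psi : 'I_n -> T -> R),
    (forall i, continuous (psi i)) /\
    forall x y, `|F x y - \sum_i psi i x * F (c i) y| <= e.
Proof.
move=> cU cF e0.
have H x : exists phi : T -> R, [/\ continuous phi, forall y, 0 <= phi y, 0 < phi x
    & forall x', 0 < phi x' -> forall y, `|F x' y - F x y| < e].
  exact: metrizable_bump (tube x cU cF e0).
have {H} [phi H] := choice H.
have [s hs] : exists s : seq T, forall x', exists2 c, c \in s & 0 < phi c x'.
  apply: finite_cover => x; have [cp _ px _] := H x.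
  have := cp x => /cvgrPdist_lt /(_ _ px); apply: filterS => x' hx.
  by move: hx; rewrite ltr_norml; lra.
pose c (i : 'I_(size s)) := tnth (in_tuple s) i.
pose Phi x := \sum_i phi (c i) x.
have Phi0 x : 0 < Phi x.
  have [a as' pa] := hs x; have /(tnthP (in_tuple s))[i ia] : a \in s by [].
  rewrite /Phi (bigD1 i) //= {1}/c -ia ltr_wpDr // sumr_ge0 // => j _.
  by have [_ -> //] := H (c j).
have cphi i : continuous (phi (c i)) by have [] := H (c i).
exists (size s), c, (fun i x => phi (c i) x * (Phi x)^-1); split => [i|x y].
  apply: ct_mul => //; apply: ct_inv; first by move=> x; rewrite gt_eqF.
  by rewrite /Phi; cts.
have -> : F x y - \sum_i phi (c i) x * (Phi x)^-1 * F (c i) y =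
    \sum_i phi (c i) x * (Phi x)^-1 * (F x y - F (c i) y).
  under [RHS]eq_bigr do rewrite mulrBr.
  rewrite [RHS]big_split /= -mulr_suml -mulr_suml -/(Phi x) divff ?gt_eqF //.
  by rewrite mul1r sumrN.
apply: le_trans (ler_norm_sum _ _ _) _.
have -> : e = \sum_i phi (c i) x * (Phi x)^-1 * e.
  by rewrite -!mulr_suml -/(Phi x) divff ?gt_eqF // mul1r.
apply: ler_sum => i _; rewrite normrM.
have [_ p0 _ pe] := H (c i).
have k0 : 0 <= phi (c i) x * (Phi x)^-1 by rewrite mulr_ge0 ?invr_ge0 // ltW.
rewrite ger0_norm //; move: (p0 x); rewrite le_eqVlt => /orP[/eqP<-|px].
  by rewrite !mul0r.
by apply: ler_wpM2l => //; apply: ltW; exact: pe.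
Qed.

(** On a finite sum of products both iterated means agree, and by [partition_approx] such sums are
    uniformly dense. This plays the part of Fubini's theorem for two arbitrary means. *)
Lemma mean_exchange (U : topologicalType) (I : (T -> R) -> R) (J : (U -> R) -> R)
    (F : T -> U -> R) : mean I -> mean J -> continuous (fun p => F p.1 p.2) ->
  I (fun x => J (fun y => F x y)) = J (fun y => I (fun x => F x y)).
Proof.
move=> mI mJ cF; have cU := mean_compact mJ.
have cF1 x : continuous (F x) by apply: (@ct_comp _ _ _ _ (fun y => (x, y)) cF); cts.
have cF2 y : continuous (F^~ y) by apply: (@ct_comp _ _ _ _ (fun x => (x, y)) cF); cts.
have cF' : continuous (fun p : U * T => F p.2 p.1).
  by apply: (@ct_comp _ _ _ _ (fun p : U * T => (p.2, p.1)) cF); cts.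
apply/eqP; rewrite -subr_eq0 -normr_eq0 eq_le normr_ge0 andbT.
apply/ler_addgt0Pr => e e0; rewrite add0r.
have e2 : 0 < e / 2 by rewrite divr_gt0.
have [n [c [psi [cpsi h]]]] := partition_approx cU cF e2.
pose F' x y := \sum_i psi i x * F (c i) y.
have E : I (fun x => J (fun y => F' x y)) = J (fun y => I (fun x => F' x y)).
  rewrite /F'.
  under eq_fun => x.
    rewrite (mean_sum mJ); last by cts.
    under eq_bigr do rewrite (meanZ mJ) //.
    over.
  rewrite (mean_sum mI); last by cts.
  under eq_bigr do rewrite (meanZr mI) //.
  under [in RHS]eq_fun => y.
    rewrite (mean_sum mI); last by cts.
    under eq_bigr do rewrite (meanZr mI) //.
    over.
  rewrite (mean_sum mJ); last by cts.
  by under [RHS]eq_bigr do rewrite (meanZ mJ) //.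
have h1 : `|I (fun x => J (fun y => F x y)) - I (fun x => J (fun y => F' x y))| <= e / 2.
  rewrite -(meanB mI); [|by cts..|by rewrite /F'; cts].
  apply: (mean_norm_le mI); first by rewrite /F'; cts.
  move=> x; rewrite -(meanB mJ); [|by cts|by rewrite /F'; cts].
  by apply: (mean_norm_le mJ) => [|y]; [by rewrite /F'; cts|exact: h].
have h2 : `|J (fun y => I (fun x => F x y)) - J (fun y => I (fun x => F' x y))| <= e / 2.
  rewrite -(meanB mJ); [|by cts..|by rewrite /F'; cts].
  apply: (mean_norm_le mJ); first by rewrite /F'; cts.
  move=> y; rewrite -(meanB mI); [|by cts|by rewrite /F'; cts].
  by apply: (mean_norm_le mI) => [|x]; [by rewrite /F'; cts|exact: h].
move: h1 h2; rewrite E !ler_norml; lra.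
Qed.

End compact.

(** * The Cauchy-Schwarz inequality for means *)

Lemma sqr_le_of_quadratic (R : realType) (a b c : R) : 0 <= a ->
  (forall t, 0 <= a * t ^+ 2 - 2 * b * t + c) -> b ^+ 2 <= a * c.
Proof.
rewrite le_eqVlt => /orP[/eqP<- h|a0 h].
  have [->|b0] := eqVneq b 0; first by rewrite mul0r expr0n.
  (* For [a = 0] the expression is affine in [t]; this [t] gives it the value -1. *)
  have := h ((c + 1) / (2 * b)).
  have -> : 0 * ((c + 1) / (2 * b)) ^+ 2 - 2 * b * ((c + 1) / (2 * b)) + c = -1.
    by field.
  lra.
have := h (b / a).
have -> : a * (b / a) ^+ 2 - 2 * b * (b / a) + c = c - b ^+ 2 / a by field; lra.
by rewrite subr_ge0 ler_pdivrMr // mulrC.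
Qed.

Lemma mean_CS (R : realType) (T : topologicalType) (I : (T -> R) -> R)
    (f h : T -> R) : mean I -> continuous f -> continuous h ->
  I (fun x => f x * h x) ^+ 2 <= I (fun x => f x ^+ 2) * I (fun x => h x ^+ 2).
Proof.
move=> mI cf ch; apply: sqr_le_of_quadratic => [|t].
  by apply: (mean_ge0 mI) => [|x]; [cts|exact: sqr_ge0].
have -> : I (fun x => f x ^+ 2) * t ^+ 2 - 2 * I (fun x => f x * h x) * t +
    I (fun x => h x ^+ 2) = I (fun x => (t * f x - h x) ^+ 2).
  have -> : (fun x => (t * f x - h x) ^+ 2) =
      (fun x => t ^+ 2 * f x ^+ 2 + ((- 2 * t) * (f x * h x) + h x ^+ 2)).
    by apply/funext => x; ring.
  rewrite (meanD mI); [|by cts..]; rewrite (meanD mI); [|by cts..].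
  by rewrite (meanZ mI); [|by cts]; rewrite (meanZ mI); [ring|by cts].
by apply: (mean_ge0 mI) => [|x]; [cts|exact: sqr_ge0].
Qed.

(** * Left-invariant means on a compact group *)

Section haar_mean.
Variables (R : realType) (G : topologicalGroupType) (I : (G -> R) -> R).
Hypothesis mI : mean I.
Hypothesis mG : metrizable R G.
Hypothesis linv : forall g (f : G -> R), continuous f ->
  I (fun x => f (g * x)%g) = I f.

Let cG := mean_compact mI.

Lemma mean_swap (F : G -> G -> R) : continuous (fun p => F p.1 p.2) ->
  I (fun x => I (fun y => F x y)) = I (fun y => I (fun x => F x y)).
Proof. exact: (mean_exchange cG mG mI mI). Qed.

(** The double mean of f(x^-1 y) is [I f] when y is integrated first, and the mean of f(x^-1) when x
    is integrated first. Right invariance follows from this. *)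
Lemma mean_inv (f : G -> R) : continuous f -> I (fun x => f x^-1%g) = I f.
Proof.
move=> cf.
have E1 : I (fun x => I (fun y => f (x^-1 * y)%g)) = I f.
  by under eq_fun do rewrite linv //; rewrite (mean_cst mI).
rewrite -[RHS]E1 mean_swap; last by cts.
rewrite -[LHS](mean_cst mI); congr I; apply/funext => y.
rewrite -(linv y^-1%g (f := fun x => f x^-1%g)); last by cts.
by congr I; apply/funext => x; rewrite invgM invgK.
Qed.

Lemma rinv g (f : G -> R) : continuous f -> I (fun x => f (x * g)%g) = I f.
Proof.
move=> cf; rewrite -(mean_inv (f := fun x => f (x * g)%g)); last by cts.
rewrite -[RHS]mean_inv // -(linv g^-1%g (f := fun x => f x^-1%g)); last by cts.
by congr I; apply/funext => x; rewrite invgM invgK.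
Qed.

Definition mean2 (F : G * G -> R) : R := I (fun x => I (fun y => F (x, y))).

Local Notation J := mean2.

Lemma mean2_mean : mean J.
Proof.
split=> [|f h cf ch|c f cf|f cf f0|].
- have -> : [set: G * G] = [set: G] `*` [set: G] by apply/seteqP; split => x.
  exact: compact_setX.
- rewrite /J -(meanD mI); [|cts..]; congr I; apply/funext => x.
  by rewrite (meanD mI) //; cts.
- rewrite /J -(meanZ mI); [|cts..]; congr I; apply/funext => x.
  by rewrite (meanZ mI) //; cts.
- apply: (mean_ge0 mI) => [|x]; first by cts.
  by apply: (mean_ge0 mI) => [|y]; [cts|].
- by rewrite /J (mean1 mI) (mean1 mI).
Qed.

Let mJ := mean2_mean.

Lemma mean2_swap (F : G * G -> R) : continuous F ->
  J F = I (fun y => I (fun x => F (x, y))).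
Proof. by move=> cF; rewrite /J mean_swap //; cts. Qed.

Lemma mean2_linv a b (F : G * G -> R) : continuous F ->
  J (fun p => F (a * p.1, b * p.2)%g) = J F.
Proof.
move=> cF; rewrite /J /=.
transitivity (I (fun x => I (fun y => F (a * x, y)%g))).
  by congr I; apply/funext => x; apply: (linv b (f := fun y => F (a * x, y)%g)); cts.
by rewrite (linv a (f := fun x => I (fun y => F (x, y)))) //; cts.
Qed.

Lemma mean2_linv1 a (F : G * G -> R) : continuous F ->
  J (fun p => F (a * p.1, p.2)%g) = J F.
Proof.
move=> cF; rewrite -[RHS](mean2_linv a 1) //.
by congr J; apply/funext => p; rewrite mul1g.
Qed.

Lemma mean2_linv2 b (F : G * G -> R) : continuous F ->
  J (fun p => F (p.1, b * p.2)%g) = J F.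
Proof.
move=> cF; rewrite -[RHS](mean2_linv 1 b) //.
by congr J; apply/funext => p; rewrite mul1g.
Qed.

Lemma mean2_rinv a b (F : G * G -> R) : continuous F ->
  J (fun p => F (p.1 * a, p.2 * b)%g) = J F.
Proof.
move=> cF; rewrite /J /=.
transitivity (I (fun x => I (fun y => F (x * a, y)%g))).
  by congr I; apply/funext => x; apply: (rinv b (f := fun y => F (x * a, y)%g)); cts.
by rewrite (rinv a (f := fun x => I (fun y => F (x, y)))) //; cts.
Qed.

Lemma mean2_exchange (F : G -> G * G -> R) : continuous (fun q => F q.1 q.2) ->
  I (fun g => J (fun p => F g p)) = J (fun p => I (fun g => F g p)).
Proof. by move=> cF; exact: (mean_exchange cG mG mI mJ cF). Qed.

(** By compactness a finite sum of left translates of [f] is at least [f x0 / 2] everywhere, and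
    each translate has mean [I f]. *)
Lemma mean_gt0 (f : G -> R) x0 : continuous f -> (forall x, 0 <= f x) ->
  0 < f x0 -> 0 < I f.
Proof.
move=> cf f0 fx0.
have [s hs] : exists s : seq G, forall x, exists2 c, c \in s & f x0 / 2 < f (x0 * (c^-1 * x))%g.
  apply: (finite_cover cG (P := fun c x => f x0 / 2 < f (x0 * (c^-1 * x))%g)) => c.
  have ch : continuous (fun x => f (x0 * (c^-1 * x))%g) by cts.
  have e2 : 0 < f x0 / 2 by rewrite divr_gt0.
  have := ch c => /cvgrPdist_lt /(_ _ e2); apply: filterS => x.
  by rewrite mulVg mulg1 ltr_norml; lra.
have cf' (i : 'I_(size s)) : continuous (fun x => f (x0 * ((tnth (in_tuple s) i)^-1 * x))%g).
  by cts.
have : f x0 / 2 <= \sum_(i < size s) I f.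
  have -> : \sum_(i < size s) I f =
      I (fun x => \sum_(i < size s) f (x0 * ((tnth (in_tuple s) i)^-1 * x))%g).
    rewrite (mean_sum mI) //; apply: eq_bigr => i _.
    rewrite (linv (tnth (in_tuple s) i)^-1%g (f := fun x => f (x0 * x)%g)); last by cts.
    by rewrite linv.
  apply: (mean_ge_cst mI); first by cts.
  move=> x; have [c cs fc] := hs x.
  have /(tnthP (in_tuple s))[i ic] : c \in s by [].
  rewrite (bigD1 i) //= -ic; apply: ler_wpDr; last exact: ltW.
  by rewrite sumr_ge0.
rewrite sumr_const card_ord => h.
have If0 : 0 <= I f by exact: (mean_ge0 mI).
rewrite lt0r If0 andbT; apply: contraTneq h => ->.
by rewrite mul0rn -ltNge divr_gt0.
Qed.

(** [kappa] is a normalized nonnegative bump supported where the translation by [t] moves [F] by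
    less than [e]. *)
Lemma approx_unit (F : G * G -> R) e : continuous F -> 0 < e ->
  exists kappa : G -> R, [/\ continuous kappa, I kappa = 1,
    forall t, kappa t^-1%g = kappa t
    & forall p, `|F p - I (fun t => kappa t * F (p.1, p.2 * t)%g)| <= e].
Proof.
move=> cF e0.
have cH : continuous (fun q : G * (G * G) => F (q.2.1, q.2.2 * q.1)%g) by cts.
have := tube (1%g : G) (mean_compact mJ) cH e0 => /=.
move=> /(metrizable_bump mG)[phi [cphi phi0 phi1 hphi]].
(* The product makes the bump invariant under inversion, so that convolution with it has a symmetric
   kernel. *)
pose k0 t := phi t * phi t^-1%g.
have ck0 : continuous k0 by rewrite /k0; cts.
have k00 t : 0 <= k0 t by rewrite mulr_ge0.
have Ik0 : 0 < I k0 by apply: (mean_gt0 (x0 := 1%g)) => //; rewrite /k0 invg1 mulr_gt0.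
pose k t := (I k0)^-1 * k0 t.
have ck : continuous k by rewrite /k; cts.
have Ik : I k = 1 by rewrite /k (meanZ mI) // mulVf // gt_eqF.
exists k; split => // [t|p]; first by rewrite /k /k0 invgK mulrC [in RHS]mulrC [phi _ * _]mulrC.
have -> : F p = I (fun t => k t * F p) by rewrite (meanZr mI) // Ik mul1r.
rewrite -(meanB mI); [|by cts..].
rewrite -[leRHS](mul1r e) -Ik -(meanZr mI) //.
apply: le_trans (ler_norm_mean mI _) _; first by cts.
apply: (le_mean mI); [by cts..|move=> t].
have kt : 0 <= k t by rewrite mulr_ge0 // invr_ge0 ltW.
rewrite -mulrBr normrM (ger0_norm kt) //.
have [->|kt0] := eqVneq (k t) 0; first by rewrite !mul0r.
apply: ler_wpM2l => //.
have phit : 0 < phi t.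
  rewrite lt0r phi0 andbT; apply: contra_neq kt0 => pt.
  by rewrite /k /k0 pt mul0r mulr0.
have /= := hphi t phit p; rewrite mulg1 distrC -surjective_pairing; exact: ltW.
Qed.

End haar_mean.

(** * Elementary inequalities and limits along ultrafilters *)

Lemma sqr_le_norm (R : realDomainType) (z c : R) : `|z| <= c -> z ^+ 2 <= c ^+ 2.
Proof. by rewrite ler_norml => /andP[]; nra. Qed.

Lemma norm_le_sqr (R : realDomainType) (z c : R) : 0 <= c -> z ^+ 2 <= c ^+ 2 -> `|z| <= c.
Proof.
move=> c0; rewrite -[z ^+ 2]real_normK ?num_real // => h.
by rewrite -(@ler_pXn2r _ 2) ?nnegrE.
Qed.

Lemma le0_small (R : realFieldType) (a K : R) : 0 <= K ->
  (forall e, 0 < e -> e <= 1 -> a <= K * e) -> a <= 0.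
Proof.
move=> K0 h; rewrite leNgt; apply/negP => a0.
have p : 0 < a + K + 1 by lra.
have e0 : 0 < a / (a + K + 1) by rewrite divr_gt0.
have e1 : a / (a + K + 1) <= 1 by rewrite ler_pdivrMr // mul1r; lra.
have := h _ e0 e1; rewrite mulrA ler_pdivlMr //; nra.
Qed.

Lemma ultra_limit (R : realType) (A : Type) (F : set_system A) (f : A -> R) (C : R) :
  UltraFilter F -> (\forall u \near F, `|f u| <= C) ->
  exists w : R, forall e, 0 < e -> \forall u \near F, `|f u - w| < e.
Proof.
move=> FU FC.
have [|w [_ hw]] := @segment_compact R (- C) C (f @ F) _.
  by apply: filterS FC => u /=; rewrite ler_norml in_itv.
exists w => e e0.
have [//|Fn] := in_ultra_setVsetC [set u | `|f u - w| < e] FU.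
have Fn' : (f @ F) [set z | ~ `|z - w| < e] by [].
have [|z [/= h1 h2]] := hw _ (ball w e) Fn'.
  exact: nbhsx_ballx.
by exfalso; apply: h1; rewrite distrC.
Qed.

(** * Symmetric integral operators: existence of an eigenfunction *)

Section kernel.
Variables (R : realType) (T : topologicalType) (I : (T -> R) -> R).
Hypothesis mI : mean I.
Hypothesis mT : metrizable R T.

Let cT := mean_compact mI.

Lemma mean_sq_ge0 (f : T -> R) : continuous f -> 0 <= I (fun x => f x ^+ 2).
Proof. by move=> cf; apply: (mean_ge0 mI) => [|x]; [cts|exact: sqr_ge0]. Qed.

Lemma meanZ_sq a (f : T -> R) : continuous f ->
  I (fun x => (a * f x) ^+ 2) = a ^+ 2 * I (fun x => f x ^+ 2).
Proof.
move=> cf; rewrite -(meanZ mI); last by cts.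
by congr I; apply/funext => x; rewrite exprMn.
Qed.

Variable k : T -> T -> R.
Hypothesis ck : continuous (fun p => k p.1 p.2).
Hypothesis ksym : forall x y, k x y = k y x.

Definition kop (u : T -> R) x : R := I (fun y => k x y * u y).

Lemma ct_kernel x : continuous (k x).
Proof. exact: (ct_comp ck (ct_pair (@ct_cst _ _ x) (@ct_id _))). Qed.
Let ck1 := ct_kernel.

Lemma ct_kop (u : T -> R) : continuous u -> continuous (kop u).
Proof.
move=> cu; apply: (@ct_mean _ _ _ mI _ (fun x y => k x y * u y)).
by apply: ct_mul => //; cts.
Qed.

Lemma kopD (u v : T -> R) : continuous u -> continuous v ->
  kop (fun x => u x + v x) = (fun x => kop u x + kop v x).
Proof.
move=> cu cv; apply/funext => x; rewrite /kop -(meanD mI); [|cts..].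
by congr I; apply/funext => y; rewrite mulrDr.
Qed.

Lemma kopZ (a : R) (u : T -> R) : continuous u -> kop (fun x => a * u x) = (fun x => a * kop u x).
Proof.
move=> cu; apply/funext => x; rewrite /kop -(meanZ mI); [|cts].
by congr I; apply/funext => y; rewrite mulrCA.
Qed.

Lemma kop_sym (u v : T -> R) : continuous u -> continuous v ->
  I (fun x => kop u x * v x) = I (fun x => u x * kop v x).
Proof.
move=> cu cv.
transitivity (I (fun x => I (fun y => k x y * u y * v x))).
  by congr I; apply/funext => x; rewrite (meanZr mI) //; cts.
rewrite (mean_exchange cT mT mI mI); last by apply: ct_mul; [apply: ct_mul|]; cts.
congr I; apply/funext => y; rewrite -(meanZ mI); last by cts.
by congr I; apply/funext => x; rewrite ksym; ring.
Qed.

Lemma kop_CS (u : T -> R) x : continuous u ->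
  kop u x ^+ 2 <= I (fun y => k x y ^+ 2) * I (fun y => u y ^+ 2).
Proof. by move=> cu; apply: mean_CS. Qed.

Lemma kernel_bounded : exists2 C, 0 < C & forall x y, `|k x y| <= C.
Proof.
have cN : continuous (fun p : T * T => k p.1 p.2) by exact: ck.
have [s hs] : exists s : seq T, forall x, exists2 c, c \in s & forall y, `|k x y - k c y| < 1.
  by apply: (finite_cover cT) => c; exact: (tube c cT ck ltr01).
have bd c : exists2 C, 0 < C & forall x, `|k c x| <= C by exact: (cts_bounded cT).
have /choice[B hB] : forall c, exists C, 0 < C /\ forall x, `|k c x| <= C.
  by move=> c; have [C ? ?] := bd c; exists C.
exists (1 + \sum_(c <- s) B c) => [|x y].
  by rewrite ltr_wpDr // sumr_ge0 // => c _; have [/ltW] := hB c.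
have [c cs fc] := hs x.
have h : B c <= \sum_(c <- s) B c.
  rewrite (perm_big _ (perm_to_rem cs)) /= big_cons lerDl sumr_ge0 // => c' _.
  by have [/ltW] := hB c'.
have [_ /(_ y) h2] := hB c; have := fc y.
by move: h2; rewrite !ler_norml !ltr_norml; lra.
Qed.

Section bounded.
Variable C : R.
Hypothesis C0 : 0 < C.
Hypothesis kC : forall x y, `|k x y| <= C.

(** The operator is bounded from the L2 norm to the sup norm; this turns L2 estimates into pointwise
    ones below. *)
Lemma kop_bound (u : T -> R) x : continuous u -> kop u x ^+ 2 <= C ^+ 2 * I (fun y => u y ^+ 2).
Proof.
move=> cu; apply: le_trans (kop_CS x cu) _.
apply: ler_wpM2r; first exact: mean_sq_ge0.
apply: (mean_le_cst mI) => [|y]; first by cts.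
exact: sqr_le_norm.
Qed.


Let N (u : T -> R) := I (fun x => u x ^+ 2).
Let unit_ball := [set u : T -> R | continuous u /\ N u <= 1].
Let S := [set N (kop u) | u in unit_ball].
(** The square of the operator norm of [kop] for the L2 norm. *)
Let M := sup S.

Let ctk (u : T -> R) : continuous u -> continuous (kop u). Proof. exact: ct_kop. Qed.

Let S_sup : has_sup S.
Proof.
split.
  exists (N (kop (fun=> 0))), (fun=> 0) => //; split; first exact: ct_cst.
  by rewrite /N; under eq_fun do rewrite expr0n; rewrite (mean_cst mI).
exists (C ^+ 2) => _ [u [cu u1] <-].
apply: (mean_le_cst mI) => [|x]; first by have := ctk cu; cts.
apply: le_trans (kop_bound x cu) _; rewrite -[leRHS]mulr1.
by apply: ler_wpM2l => //; exact: sqr_ge0.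
Qed.

Let M_ge u : continuous u -> N u <= 1 -> N (kop u) <= M.
Proof. by move=> cu u1; apply: ub_le_sup; [have [] := S_sup|exists u]. Qed.

Let kop_null u : continuous u -> N u = 0 -> forall x, kop u x = 0.
Proof.
move=> cu u0 x; apply/eqP; rewrite -sqrf_eq0 eq_le sqr_ge0 andbT.
by apply: le_trans (kop_bound x cu) _; rewrite -/(N u) u0 mulr0.
Qed.

Let normalize (u : T -> R) : continuous u -> N u != 0 ->
  N (fun x => (Num.sqrt (N u))^-1 * u x) = 1.
Proof.
move=> cu u0; rewrite /N meanZ_sq // -/(N u) exprVn sqr_sqrtr ?mulVf //.
exact: mean_sq_ge0.
Qed.

Let M_homo u : continuous u -> N (kop u) <= M * N u.
Proof.
move=> cu; have [u0|u0] := eqVneq (N u) 0.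
  rewrite u0 mulr0 /N; under eq_fun do rewrite (kop_null cu u0) expr0n.
  by rewrite (mean_cst mI).
have Nu : 0 < N u by rewrite lt0r u0; exact: mean_sq_ge0.
have cv : continuous (fun x => (Num.sqrt (N u))^-1 * u x) by cts.
have := M_ge cv; rewrite normalize // => /(_ (lexx _)).
have := ctk cu => cku.
rewrite /N kopZ // meanZ_sq // exprVn sqr_sqrtr; last exact: ltW.
by rewrite -!/(N _) mulrC ler_pdivrMr.
Qed.

Let equicontinuous x0 e : 0 < e -> \forall x \near x0,
  forall u, unit_ball u -> `|kop u x - kop u x0| <= e.
Proof.
move=> e0; have := tube x0 cT ck e0; apply: filterS => x /= hx u [cu u1].
have -> : kop u x - kop u x0 = I (fun y => (k x y - k x0 y) * u y).
  rewrite /kop -(meanB mI); [|cts..].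
  by congr I; apply/funext => y; rewrite mulrBl.
apply: norm_le_sqr; first exact: ltW.
apply: le_trans (mean_CS mI (f := fun y => k x y - k x0 y) _ cu) _; first by cts.
rewrite -[leRHS]mulr1; apply: ler_pM => //; first by apply: mean_sq_ge0; cts.
  exact: mean_sq_ge0.
apply: (mean_le_cst mI) => [|y]; first by cts.
by apply: sqr_le_norm; exact: ltW.
Qed.

(** The Arzela-Ascoli argument with an ultrafilter. Along an ultrafilter of near-maximizers [u] the
    bounded images [kop u] converge pointwise; their equicontinuity and the compactness of [T] make
    the limit [w] continuous and the convergence uniform. The limit is taken of the images and not
    of the [u], so it stays among continuous functions. *)
Let maximizing : exists w : T -> R, continuous w /\ forall e, 0 < e ->
  exists u, [/\ unit_ball u, M - e < N (kop u) & forall x, `|kop u x - w x| <= e].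
Proof.
pose B e := [set u | unit_ball u /\ M - e < N (kop u)].
pose F0 := filter_from [set e : R | 0 < e] B.
have F0P : ProperFilter F0.
  apply: filter_from_proper.
    apply: filter_from_filter; first by exists 1 => /=.
    move=> e1 e2 /= h1 h2; exists (Num.min e1 e2); first by rewrite /= lt_min h1.
    move=> u [Bu h]; split; split => //; apply: le_lt_trans h;
    by rewrite lerD2l lerN2 ge_min lexx ?orbT.
  move=> e /= e0; have [_ [u Bu <-] h] := sup_adherent e0 S_sup.
  by exists u.
have [F [FU F0F]] := ultraFilterLemma F0P.
have FB e : 0 < e -> F (B e) by move=> e0; apply: F0F; exists e.
have Fub : \forall u \near F, unit_ball u by apply: filterS (FB 1 _) => // u [].
have H x : exists w : R, forall e, 0 < e -> \forall u \near F, `|kop u x - w| < e.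
  apply: (ultra_limit (C := C)) => //; apply: filterS Fub => u [cu u1].
  apply: norm_le_sqr; first exact: ltW.
  apply: le_trans (kop_bound x cu) _; rewrite -[leRHS]mulr1.
  by apply: ler_wpM2l => //; exact: sqr_ge0.
have {H} [w hw] := choice H.
have wc x0 e : 0 < e -> \forall x \near x0, `|w x - w x0| <= e.
  move=> e0; have e2 : 0 < e / 2 by rewrite divr_gt0.
  have e4 : 0 < e / 4 by rewrite divr_gt0.
  have := equicontinuous x0 e2; apply: filterS => x hx.
  have [u [Bu [h1 h2]]] := @filter_ex _ F _ _
    (filterI Fub (filterI (hw x _ e4) (hw x0 _ e4))).
  move: (hx u Bu) h1 h2; rewrite !ler_norml !ltr_norml; lra.
exists w; split.
  move=> x0; apply/cvgrPdist_lt => e e0.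
  have e2 : 0 < e / 2 by rewrite divr_gt0.
  have := wc x0 _ e2; apply: filterS => x; rewrite distrC => h.
  by apply: le_lt_trans h _; lra.
move=> e e0; have e4 : 0 < e / 4 by rewrite divr_gt0.
suff : \forall u \near F, forall x, `|kop u x - w x| <= e.
  move=> Fe; have [u [h1 [h2 h3]]] := @filter_ex _ F _ _ (filterI Fe (FB e e0)).
  by exists u.
have := cT => /compact_near_coveringP /(_ _ F (fun u x => `|kop u x - w x| <= e) _).
move=> H; have {H} : \near F, [set: T] `<=` (fun x => `|kop F x - w x| <= e).
  apply: H => x0 _.
  exists ([set x | (forall u, unit_ball u -> `|kop u x - kop u x0| <= e / 4) /\
      `|w x - w x0| <= e / 4], [set u | unit_ball u /\ `|kop u x0 - w x0| < e / 4]) => /=.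
    split; apply: filterI => //; [exact: equicontinuous|exact: wc|exact: hw].
  move=> [x u] /= [[h1 h2] [Bu h3]].
  move: (h1 u Bu) h2 h3; rewrite !ler_norml !ltr_norml; lra.
by apply: filterS => u h x; exact: h.
Qed.


Let unit_bound u x : unit_ball u -> `|kop u x| <= C.
Proof.
move=> [cu u1]; apply: norm_le_sqr; first exact: ltW.
apply: le_trans (kop_bound x cu) _; rewrite -[leRHS]mulr1.
by apply: ler_wpM2l => //; exact: sqr_ge0.
Qed.

Let small_kop (u : T -> R) e : continuous u -> 0 < e -> (forall x, `|u x| <= e) ->
  forall x, `|kop u x| <= C * e.
Proof.
move=> cu e0 ue x; apply: norm_le_sqr; first by rewrite mulr_ge0 // ltW.
apply: le_trans (kop_bound x cu) _; rewrite exprMn; apply: ler_wpM2l.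
  exact: sqr_ge0.
by apply: (mean_le_cst mI) => [|y]; [cts|exact: sqr_le_norm].
Qed.

(** Near-maximizers are near-eigenfunctions of the squared operator: for u in the unit ball, N(kop
    (kop u) - M u) <= N(kop (kop u)) - 2 M N(kop u) + M^2 <= M (M - N(kop u)), which is small. One
    more application of [kop] makes the estimate pointwise. *)
Let square_eigen : exists w, [/\ continuous w, N w = M & forall x, kop (kop w) x = M * w x].
Proof.
have [w [cw hw]] := maximizing; exists w.
have M0 : 0 <= M.
  have /= := M_homo (@ct_cst T R 1); rewrite {2}/N expr1n (mean1 mI) mulr1.
  by apply: le_trans; have := ctk (@ct_cst T R 1); exact: mean_sq_ge0.
have C0' := ltW C0.
split => //.
  apply/eqP; rewrite -subr_eq0 -normr_eq0 eq_le normr_ge0 andbT.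
  apply: (@le0_small _ _ (2 * C + 2)) => [|e e0 e1]; first lra.
  have [u [Bu hu uw]] := hw e e0; have [cu u1] := Bu.
  have cku := ctk cu.
  have h2 := M_ge cu u1.
  have : `|N w - N (kop u)| <= (2 * C + 1) * e.
    rewrite /N -(meanB mI); [|cts..].
    apply: (mean_norm_le mI) => [|x]; first by cts.
    have -> : w x ^+ 2 - kop u x ^+ 2 = (kop u x - w x) * ((kop u x - w x) - 2 * kop u x).
      by ring.
    rewrite normrM mulrC; apply: ler_pM => //.
    apply: le_trans (ler_normB _ _) _; rewrite normrM ger0_norm //.
    by have := unit_bound x Bu; have := uw x; lra.
  rewrite !ler_norml; lra.
move=> x; apply/eqP; rewrite -subr_eq0 -normr_eq0 eq_le normr_ge0 andbT.
apply: (@le0_small _ _ (C ^+ 2 + (C ^+ 2 * M + 1) + M)) => [|e e0 e1].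
  by rewrite !addr_ge0 // ?mulr_ge0 ?sqr_ge0.
have ee : e ^+ 2 <= e by rewrite expr2 -[leRHS]mulr1 ler_pM2l.
(* The tolerance is [e ^+ 2] since it controls the squared norm [N z], whose root appears in
   [h2]. *)
have [u [Bu hu uw]] := hw (e ^+ 2) (exprn_gt0 2 e0); have [cu u1] := Bu.
have cku := ctk cu; have ckku := ctk cku; have ckkku := ctk ckku.
have uw' y : `|w y - kop u y| <= e by rewrite distrC; exact: le_trans (uw y) ee.
pose v y := w y + - 1 * kop u y.
have cv : continuous v by rewrite /v; cts.
pose z y := kop (kop u) y + - M * u y.
have cz : continuous z by rewrite /z; cts.
have kv : kop v = fun y => kop w y + -1 * kop (kop u) y.
  by rewrite /v kopD ?kopZ //; cts.
have kz : kop z = fun y => kop (kop (kop u)) y + - M * kop u y.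
  by rewrite /z kopD ?kopZ //; cts.
have ckw := ctk cw.
have kkv : kop (kop v) = fun y => kop (kop w) y + -1 * kop (kop (kop u)) y.
  by rewrite kv kopD ?kopZ //; cts.
have h1 : `|kop (kop v) x| <= C ^+ 2 * e.
  rewrite expr2 -mulrA; apply: small_kop; [exact: ctk|by rewrite mulr_gt0|].
  by apply: small_kop => // y; rewrite /v mulN1r.
have Nz : N z <= M * e ^+ 2.
  have -> : N z = N (kop (kop u)) - 2 * M * N (kop u) + M ^+ 2 * N u.
    rewrite {1}/N /z.
    have -> : (fun x => (kop (kop u) x + - M * u x) ^+ 2) = (fun x =>
        kop (kop u) x ^+ 2 + (- 2 * M * (kop (kop u) x * u x) + M ^+ 2 * u x ^+ 2)).
      by apply/funext => y; ring.
    rewrite (meanD mI); [|cts..]; rewrite (meanD mI); [|cts..].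
    rewrite (meanZ mI); [|cts..]; rewrite (meanZ mI); [|cts..].
    rewrite (kop_sym cku cu).
    have -> : I (fun y => kop u y * kop u y) = N (kop u).
      by congr I; apply/funext => y; rewrite expr2.
    by rewrite /N; ring.
  have := M_homo cku; have := ler_wpM2l (sqr_ge0 M) u1.
  have := ler_wpM2l M0 (ltW hu); rewrite mulrBr; lra.
have h2 : `|kop z x| <= (C ^+ 2 * M + 1) * e.
  have CM : 0 <= C ^+ 2 * M by rewrite mulr_ge0 ?sqr_ge0.
  apply: norm_le_sqr; first by rewrite mulr_ge0 //; [lra|exact: ltW].
  apply: le_trans (kop_bound x cz) _; rewrite -/(N z).
  apply: le_trans (ler_wpM2l (sqr_ge0 C) Nz) _.
  by rewrite mulrA exprMn; apply: ler_wpM2r; [exact: sqr_ge0|nra].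
have h3 : `|M * (kop u x - w x)| <= M * e.
  by rewrite normrM ger0_norm //; apply: ler_wpM2l => //; rewrite distrC.
(* Telescoping through [kop (kop (kop u))] and [M * kop u], with [w] close to [kop u]. *)
have -> : kop (kop w) x - M * w x = kop (kop v) x + kop z x + M * (kop u x - w x).
  by rewrite kkv kz; ring.
apply: le_trans (ler_normD _ _) _; rewrite mulrDl; apply: lerD => //.
by apply: le_trans (ler_normD _ _) _; rewrite mulrDl; apply: lerD.
Qed.

(** The hypothesis on [u] gives M > e^2. With m the root of M, the product (kop - m)(kop + m)
    annihilates [w]; so [kop w + m w] is an eigenfunction for m, unless it vanishes and [w] is one
    for -m. *)
Lemma kop_eigen_bounded (e : R) : 0 < e ->
  (exists u : T -> R, continuous u /\ e ^+ 2 * I (fun x => u x ^+ 2) < I (fun x => kop u x ^+ 2)) ->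
  exists (w : T -> R) mu, [/\ continuous w, I (fun x => w x ^+ 2) = 1, e <= `|mu|
    & forall x, kop w x = mu * w x].
Proof.
move=> e0 [u [cu hu]].
have [w [cw Nw hw]] := square_eigen.
have eM : e ^+ 2 < M.
  have Nu : 0 <= N u by exact: mean_sq_ge0.
  have := lt_le_trans hu (M_homo cu); rewrite -/(N u) => h.
  by rewrite ltNge; apply/negP => h'; have := ler_wpM2r Nu h'; rewrite leNgt h.
have M0 : 0 < M by apply: le_lt_trans eM; exact: sqr_ge0.
have ckw := ctk cw.
pose m := Num.sqrt M.
have mM : m ^+ 2 = M by rewrite sqr_sqrtr // ltW.
have m0 : 0 <= m by exact: sqrtr_ge0.
have em : e <= m by rewrite -(@ler_pXn2r _ 2) ?nnegrE ?mM // ltW.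
have unit_eigen (v : T -> R) mu : continuous v -> N v != 0 -> e <= `|mu| ->
    (forall x, kop v x = mu * v x) ->
  exists (w : T -> R) mu, [/\ continuous w, I (fun x => w x ^+ 2) = 1, e <= `|mu|
    & forall x, kop w x = mu * w x].
  move=> cv Nv emu hv; exists (fun x => (Num.sqrt (N v))^-1 * v x), mu; split => //.
  - by cts.
  - exact: normalize.
  - by move=> x; rewrite kopZ // hv mulrCA.
pose v x := kop w x + m * w x.
have cv : continuous v by rewrite /v; cts.
have kv : kop v = fun x => kop (kop w) x + m * kop w x.
  by rewrite /v kopD ?kopZ //; cts.
have [v0|v0] := eqVneq (N v) 0.
  apply: (unit_eigen w (- m)) => //; rewrite ?normrN ?ger0_norm ?Nw ?gt_eqF //.
  (* [N v = 0] yields [kop v = 0] pointwise; as [kop v = m v] and m is nonzero, [v] itself vanishes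
     pointwise. *)
  move=> x; have := kop_null cv v0 x; rewrite kv hw -mM => h.
  have : m * (m * w x + kop w x) = 0 by rewrite -[RHS]h; ring.
  move/eqP; rewrite mulf_eq0 => /orP[/eqP m0'|/eqP]; last by lra.
  by move: mM; rewrite m0' expr0n => M0'; rewrite -M0' ltxx in M0.
apply: (unit_eigen v m) => //; first by rewrite ger0_norm.
by move=> x; rewrite kv /v hw -mM; ring.
Qed.

End bounded.

Lemma kop_eigen (e : R) : 0 < e ->
  (exists u : T -> R, continuous u /\ e ^+ 2 * I (fun x => u x ^+ 2) < I (fun x => kop u x ^+ 2)) ->
  exists (w : T -> R) mu, [/\ continuous w, I (fun x => w x ^+ 2) = 1, e <= `|mu|
    & forall x, kop w x = mu * w x].
Proof.
have [C C0 kC] := kernel_bounded.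
by apply: (kop_eigen_bounded C0).
Qed.

End kernel.

(** * Orthonormal families and Bessel's inequality *)

Section orthonormal.
Variables (R : realType) (T : topologicalType) (I : (T -> R) -> R).
Hypothesis mI : mean I.

Definition orthonormal n (f : 'I_n -> T -> R) :=
  (forall i, continuous (f i)) /\ forall i j, I (fun x => f i x * f j x) = (i == j)%:R.

Lemma mean_orth_sum n (f : 'I_n -> T -> R) (c : 'I_n -> R) j : orthonormal f ->
  I (fun x => (\sum_i c i * f i x) * f j x) = c j.
Proof.
move=> [cf of_].
transitivity (I (fun x => \sum_i c i * (f i x * f j x))).
  by congr I; apply/funext => x; rewrite mulr_suml; apply: eq_bigr => i _; rewrite mulrA.
rewrite (mean_sum mI); last by cts.
rewrite (bigD1 j) //= big1 ?addr0 => [|i ij]; rewrite (meanZ mI) ?of_; try by cts.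
- by rewrite eqxx mulr1.
- by rewrite (negbTE ij) mulr0.
Qed.

(** Pythagoras for the orthogonal projection. Besides Bessel's inequality it yields, in
    [rep_approx], that the projection is the best approximation. *)
Lemma bessel_eq n (f : 'I_n -> T -> R) (u : T -> R) : orthonormal f -> continuous u ->
  I (fun x => (u x - \sum_i I (fun y => u y * f i y) * f i x) ^+ 2) =
  I (fun x => u x ^+ 2) - \sum_i I (fun y => u y * f i y) ^+ 2.
Proof.
move=> of_ cu; have [cf _] := of_.
pose c i := I (fun y => u y * f i y).
pose p x := \sum_i c i * f i x.
have cp : continuous p by rewrite /p; cts.
have ppE (h : T -> R) (ch : continuous h) :
    I (fun x => h x * p x) = \sum_i c i * I (fun x => h x * f i x).
  transitivity (I (fun x => \sum_i c i * (h x * f i x))).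
    by congr I; apply/funext => x; rewrite mulr_sumr; apply: eq_bigr => i _; ring.
  by rewrite (mean_sum mI); [apply: eq_bigr => i _; rewrite (meanZ mI) //|]; cts.
have -> : (fun x => (u x - p x) ^+ 2) =
    (fun x => u x ^+ 2 + (- 2 * (u x * p x) + p x * p x)).
  by apply/funext => x; ring.
rewrite (meanD mI); [|cts..]; rewrite (meanD mI); [|cts..].
rewrite (meanZ mI); last by cts.
rewrite !ppE //.
have -> : \sum_i c i * I (fun x => p x * f i x) = \sum_i c i * I (fun x => u x * f i x).
  by apply: eq_bigr => i _; rewrite mean_orth_sum.
rewrite -/c; have -> : \sum_i c i * I (fun x => u x * f i x) = \sum_i c i ^+ 2.
  by apply: eq_bigr => i _; rewrite expr2.
by ring.
Qed.

Lemma bessel n (f : 'I_n -> T -> R) (u : T -> R) : orthonormal f -> continuous u ->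
  \sum_i I (fun y => u y * f i y) ^+ 2 <= I (fun x => u x ^+ 2).
Proof.
move=> of_ cu; rewrite -subr_ge0 -bessel_eq //; have [cf _] := of_.
by apply: (mean_sq_ge0 mI); cts.
Qed.

Definition fcons n (A : Type) (a : A) (f : 'I_n -> A) (i : 'I_n.+1) : A :=
  if unlift ord0 i is Some j then f j else a.

Lemma orthonormal_fcons n (f : 'I_n -> T -> R) (w : T -> R) : orthonormal f ->
  continuous w -> I (fun x => w x ^+ 2) = 1 -> (forall i, I (fun x => w x * f i x) = 0) ->
  orthonormal (fcons w f).
Proof.
move=> [cf of_] cw w1 wf; split=> [i|i j]; rewrite /fcons.
  by case: unliftP.
case: unliftP => [i' ->|->]; case: unliftP => [j' ->|->] //.
by rewrite -[RHS](wf i'); congr I; apply/funext => x; rewrite mulrC.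
Qed.

End orthonormal.

(** * Finite-rank truncation of a symmetric operator *)

Section spectral.
Variables (R : realType) (T : topologicalType) (I : (T -> R) -> R).
Hypothesis mI : mean I.
Hypothesis mT : metrizable R T.
Variable k : T -> T -> R.
Hypothesis ck : continuous (fun p => k p.1 p.2).
Hypothesis ksym : forall x y, k x y = k y x.

Let ctk (u : T -> R) : continuous u -> continuous (kop I k u) := @ct_kop _ _ _ mI _ ck u.
Let ck1 := ct_kernel ck.

Let kop_null (u : T -> R) : continuous u -> I (fun x => u x ^+ 2) = 0 -> forall x, kop I k u x = 0.
Proof.
move=> cu u0 x; apply/eqP; rewrite -sqrf_eq0 eq_le sqr_ge0 andbT.
by apply: le_trans (kop_CS mI ck x cu) _; rewrite u0 mulr0.
Qed.

Lemma kop_sum n (c : 'I_n -> R) (f : 'I_n -> T -> R) : (forall i, continuous (f i)) ->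
  kop I k (fun x => \sum_i c i * f i x) = (fun x => \sum_i c i * kop I k (f i) x).
Proof.
move=> cf; apply/funext => x; rewrite /kop.
transitivity (I (fun y => \sum_i c i * (k x y * f i y))).
  by congr I; apply/funext => y; rewrite mulr_sumr; apply: eq_bigr => i _; ring.
by rewrite (mean_sum mI); [apply: eq_bigr => i _; rewrite (meanZ mI) //|]; cts.
Qed.

Variable e : R.
Hypothesis e0 : 0 < e.

Definition eigenfamily n (f : 'I_n -> T -> R) (lam : 'I_n -> R) :=
  [/\ orthonormal I f, forall i, e <= `|lam i| & forall i x, kop I k (f i) x = lam i * f i x].

(** Bessel's inequality for the function [k x] bounds the sum of (lam_i f_i(x))^2 by C^2. Taking the
    mean over x, the sum of the lam_i^2 is at most C^2, while each term is at least e^2. *)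
Lemma eigenfamily_size : exists m, forall n (f : 'I_n -> T -> R) lam,
  eigenfamily f lam -> (n <= m)%N.
Proof.
have [C C0 kC] := kernel_bounded mI ck.
have [m hm] : exists m, C ^+ 2 / e ^+ 2 <= m%:R.
  by exists (Num.truncn (C ^+ 2 / e ^+ 2)).+1; exact/ltW/truncnS_gt.
exists m => n f lam [of_ lame fE]; have [cf ff] := of_.
have h : \sum_i lam i ^+ 2 <= C ^+ 2.
  have -> : \sum_i lam i ^+ 2 = I (fun x => \sum_i kop I k (f i) x ^+ 2).
    rewrite (mean_sum mI); last by move=> i; have := ctk (cf i); cts.
    apply: eq_bigr => i _; rewrite -[LHS]mulr1.
    have <- : I (fun x => f i x ^+ 2) = 1.
      transitivity (I (fun x => f i x * f i x)); last by rewrite ff eqxx.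
      by congr I; apply/funext => x; rewrite expr2.
    rewrite -(meanZ mI); last by cts.
    by congr I; apply/funext => x; rewrite fE exprMn.
  apply: (mean_le_cst mI) => [|x].
    by apply: ct_sum => i; have := ctk (cf i); cts.
  have hb : \sum_i kop I k (f i) x ^+ 2 <= I (fun y => k x y ^+ 2).
    exact: (bessel mI of_ (@ck1 x)).
  apply: le_trans hb _.
  by apply: (mean_le_cst mI) => [|y]; [have := @ck1 x; cts|exact: sqr_le_norm].
rewrite -(ler_nat R); apply: le_trans hm.
rewrite ler_pdivlMr ?exprn_gt0 //; apply: le_trans h.
rewrite mulr_natl -[n in _ *+ n]card_ord -sumr_const; apply: ler_sum => i _.
by rewrite -[lam i ^+ 2]real_normK ?num_real // lerXn2r ?nnegrE // ltW.
Qed.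

(** A family of maximal size works. If the norm bound failed, the kernel with the finite-rank part
    removed would have an eigenfunction by [kop_eigen], and the family could be enlarged. The last
    clause makes the span invariant under every symmetry of the kernel. *)
Lemma spectral_truncation : exists n (f : 'I_n -> T -> R) (lam : 'I_n -> R),
  [/\ eigenfamily f lam,
      forall u : T -> R, continuous u ->
        I (fun x => (kop I k u x - \sum_i lam i * I (fun y => u y * f i y) * f i x) ^+ 2)
        <= e ^+ 2 * I (fun x => u x ^+ 2)
    & forall (w : T -> R) mu, continuous w -> e <= `|mu| ->
        (forall x, kop I k w x = mu * w x) ->
        forall x, w x = \sum_i I (fun y => w y * f i y) * f i x].
Proof.
pose P n := `[< exists (f : 'I_n -> T -> R) lam, eigenfamily f lam >].
have exP : exists n, P n.
  exists 0%N; apply/asboolP; exists (fun _ _ => 0), (fun=> 0).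
  by split; [split|..]; case.
have [m hm] := eigenfamily_size.
have Pm n : P n -> (n <= m)%N by move=> /asboolP[f [lam /hm]].
case: (ex_maxnP exP Pm) => n /asboolP[f [lam fam]] nmax.
have [of_ lame fE] := fam; have [cf ff] := of_.
have maxf (w : T -> R) mu : continuous w -> e <= `|mu| ->
    (forall x, kop I k w x = mu * w x) -> (forall i, I (fun x => w x * f i x) = 0) ->
    I (fun x => w x ^+ 2) = 0.
  move=> cw emu kw wf; apply: contrapT => /eqP N0.
  have Np : 0 < I (fun x => w x ^+ 2) by rewrite lt0r N0 (mean_sq_ge0 mI).
  pose a := (Num.sqrt (I (fun x => w x ^+ 2)))^-1.
  have := nmax n.+1; rewrite ltnn; case/(_ _)/negP => //; apply/asboolP.
  exists (fcons (fun x => a * w x) f), (fcons mu lam).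
  split; [|by move=> i; rewrite /fcons; case: unliftP..|].
  - apply: orthonormal_fcons => // [||i]; first by cts.
      by rewrite (meanZ_sq mI) // exprVn sqr_sqrtr ?mulVf // ltW.
    rewrite -[RHS](mulr0 a) -(wf i) -(meanZ mI); last by cts.
    by congr I; apply/funext => x; rewrite mulrA.
  - move=> i x; rewrite /fcons; case: unliftP => // _.
    by rewrite kopZ // kw mulrCA.
exists n, f, lam; split => //.
  move=> u cu; rewrite leNgt; apply/negP => hu.
  pose k' x y := k x y - \sum_i lam i * f i x * f i y.
  have ck' : continuous (fun p => k' p.1 p.2) by rewrite /k'; cts.
  have k'sym x y : k' x y = k' y x.
    by rewrite /k' ksym; congr (_ - _); apply: eq_bigr => i _; ring.
  have k'E v x : continuous v ->
      kop I k' v x = kop I k v x - \sum_i lam i * I (fun y => v y * f i y) * f i x.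
    move=> cv; rewrite /kop.
    transitivity (I (fun y => k x y * v y - \sum_i lam i * f i x * (v y * f i y))).
      congr I; apply/funext => y; rewrite /k' mulrBl mulr_suml; congr (_ - _).
      by apply: eq_bigr => i _; ring.
    rewrite (meanB mI); [|cts..]; rewrite (mean_sum mI); last by cts.
    congr (_ - _); apply: eq_bigr => i _.
    by rewrite (meanZ mI); [ring|cts].
  have [|w [mu [cw w1 emu kw]]] := kop_eigen mI mT ck' k'sym e0.
    exists u; split => //; apply: lt_le_trans hu _; rewrite le_eqVlt; apply/orP; left.
    by apply/eqP; congr I; apply/funext => x; rewrite -k'E.
  (* The reduced operator annihilates each [f i] and is symmetric, so its eigenfunctions for nonzero
     eigenvalues are orthogonal to the family; on them it agrees with [kop I k]. *)
  have wf i : I (fun x => w x * f i x) = 0.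
    have : mu * I (fun x => w x * f i x) = 0.
      rewrite -(meanZ mI); last by cts.
      transitivity (I (fun x => kop I k' w x * f i x)).
        by congr I; apply/funext => x; rewrite kw mulrA.
      rewrite (kop_sym mI mT ck' k'sym) //.
      transitivity (I (fun _ => 0)); last exact: mean_cst.
      congr I; apply/funext => x; rewrite k'E // fE.
      rewrite (bigD1 i) //= big1 => [|j ji]; rewrite ff.
        by rewrite eqxx mulr1 addr0 subrr mulr0.
      by rewrite eq_sym (negbTE ji) mulr0 mul0r.
    move/eqP; rewrite mulf_eq0 => /orP[/eqP mu0|/eqP //].
    by move: emu; rewrite mu0 normr0 leNgt e0.
  have := maxf w mu cw emu _ wf; rewrite w1 => h.
  have /eqP : (1 : R) = 0; last by rewrite oner_eq0.
  apply: h => x; rewrite -kw k'E // big1 ?subr0 // => i _.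
  by rewrite wf mulr0 mul0r.
move=> w mu cw emu kw.
pose c i := I (fun y => w y * f i y).
(* By symmetry eigenfunctions for distinct eigenvalues are orthogonal. Hence the projection of [w],
   and with it the remainder [v], is again an eigenfunction for [mu]. *)
have lamc i : c i * lam i = c i * mu.
  rewrite /c -!(meanZr mI); [|cts..].
  transitivity (I (fun x => w x * kop I k (f i) x)).
    by congr I; apply/funext => x; rewrite fE; ring.
  rewrite -(kop_sym mI mT ck ksym) //.
  by congr I; apply/funext => x; rewrite kw; ring.
pose v x := w x + -1 * \sum_i c i * f i x.
have cv : continuous v by rewrite /v; cts.
have kv x : kop I k v x = mu * v x.
  rewrite /v kopD //; [|cts..]; rewrite kopZ //; last by cts.
  rewrite kop_sum // kw mulrDr; congr (_ + _).
  rewrite mulrCA; congr (_ * _); rewrite mulr_sumr; apply: eq_bigr => i _.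
  by rewrite fE mulrA lamc; ring.
have v0 : I (fun x => v x ^+ 2) = 0.
  apply: (maxf v mu) => // i.
  transitivity (I (fun x => w x * f i x + -1 * ((\sum_j c j * f j x) * f i x))).
    by congr I; apply/funext => x; rewrite /v; ring.
  rewrite (meanD mI); [|cts..]; rewrite (meanZ mI); last by cts.
  by rewrite (mean_orth_sum mI) // /c mulN1r subrr.
move=> x; have := kop_null cv v0 x; rewrite kv => /eqP.
rewrite mulf_eq0 => /orP[/eqP mu0|].
  by move: emu; rewrite mu0 normr0 leNgt e0.
by rewrite /v mulN1r subr_eq0 => /eqP.
Qed.

End spectral.

(** * Finite-dimensional orthogonal representations by left translation *)

Section translation_rep.
Variables (R : realType) (G : topologicalGroupType) (I : (G -> R) -> R).
Hypothesis mI : mean I.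
Hypothesis mG : metrizable R G.
Hypothesis linv : forall g (f : G -> R), continuous f ->
  I (fun x => f (g * x)%g) = I f.

Local Notation J := (mean2 I).

Definition orthogonal_rep n (r : G -> 'M[R]_n) :=
  [/\ r 1%g = 1%:M, forall g h, r (g * h)%g = r g *m r h,
      forall g, r g *m (r g)^T = 1%:M & forall i j, continuous (fun g => r g i j)].

(** For a unitary representation this says that no irreducible constituent is trivial. *)
Definition fixed_free (C : fieldType) n (r : G -> 'M[C]_n) :=
  forall c : 'rV_n, (forall g, c *m r g = c) -> c = 0.

(** A fixed row vector [c] would make the combination of the [f i] with coefficients [c] translation
    invariant, hence constant, hence zero because the [f i] have mean zero. *)
Lemma translation_rep n (f : 'I_n -> G -> R) : orthonormal I f ->
  (forall i, I (f i) = 0) ->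
  (forall g i x, f i (g * x)%g = \sum_j I (fun y => f i (g * y)%g * f j y) * f j x) ->
  exists r : G -> 'M[R]_n, [/\ orthogonal_rep r, fixed_free r
    & forall g i x, f i (g * x)%g = \sum_j r g i j * f j x].
Proof.
move=> of_ f0 fE; have [cf ff] := of_.
pose r g : 'M[R]_n := \matrix_(i, j) I (fun y => f i (g * y)%g * f j y).
have rE g i x : f i (g * x)%g = \sum_j r g i j * f j x.
  by rewrite fE; apply: eq_bigr => j _; rewrite mxE.
exists r; split => //.
- split.
  + apply/matrixP => i j; rewrite !mxE -ff; congr I.
    by apply/funext => y; rewrite mul1g.
  + move=> g h; apply/matrixP => i j; rewrite !mxE.
    transitivity (I (fun y => (\sum_k (r g *m r h) i k * f k y) * f j y)).
      congr I; apply/funext => y; congr (_ * _).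
      rewrite -mulgA rE; under eq_bigr do rewrite rE.
      under eq_bigr do rewrite mulr_sumr.
      rewrite exchange_big /=; apply: eq_bigr => k _; rewrite mxE mulr_suml.
      by apply: eq_bigr => l _; rewrite mulrA.
    by rewrite (mean_orth_sum mI) // mxE.
  + move=> g; apply/matrixP => i j; rewrite !mxE.
    transitivity (I (fun x => f i (g * x)%g * f j (g * x)%g)); last first.
      by rewrite (linv g (f := fun x => f i x * f j x)) ?ff //; cts.
    transitivity (I (fun x => \sum_k r g j k * (f i (g * x)%g * f k x))).
      rewrite (mean_sum mI); last by cts.
      apply: eq_bigr => k _; rewrite (meanZ mI); last by cts.
      by rewrite !mxE mulrC.
    congr I; apply/funext => x; rewrite [f j _]rE mulr_sumr.
    by apply: eq_bigr => k _; ring.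
  + move=> i j; have -> : (fun g => r g i j) = (fun g => I (fun y => f i (g * y)%g * f j y)).
      by apply/funext => g; rewrite mxE.
    by cts.
- move=> c hc; pose u x := \sum_i c 0 i * f i x.
  have cu : continuous u by rewrite /u; cts.
  have ug g x : u (g * x)%g = u x.
    rewrite /u; under eq_bigr do rewrite rE mulr_sumr.
    rewrite exchange_big /=; apply: eq_bigr => j _.
    rewrite -[in RHS](hc g) mxE mulr_suml; apply: eq_bigr => i _; ring.
  have u1 x : u x = u 1%g by rewrite -[x]mulg1 ug.
  have Iu : I u = 0.
    rewrite (mean_sum mI); last by cts.
    by apply: big1 => i _; rewrite (meanZ mI) // f0 mulr0.
  have u0 x : u x = 0.
    by rewrite u1 -Iu -[LHS](mean_cst mI); congr I; apply/funext => y; rewrite u1.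
  apply/rowP => j; rewrite mxE -[LHS](mean_orth_sum mI (c 0) j of_) -[RHS](mean_cst mI).
  by congr I; apply/funext => x; rewrite -/(u x) u0 mul0r.
Qed.

(** Convolution in y with an approximate identity nearly fixes [H], and its kernel is invariant
    under left translation. The eigenfunctions with large eigenvalue therefore span an invariant
    space of finite dimension, and the truncated operator applied to H(x,.) lies in it. *)
Lemma rep_approx (H : G * G -> R) e : continuous H -> 0 < e ->
  (forall x, I (fun y => H (x, y)) = 0) ->
  exists n (f : 'I_n -> G -> R) (r : G -> 'M[R]_n),
    [/\ orthonormal I f, orthogonal_rep r, fixed_free r,
        forall g i x, f i (g * x)%g = \sum_j r g i j * f j x
      & J (fun p => (H p - \sum_i I (fun y => H (p.1, y) * f i y) * f i p.2) ^+ 2) <= e].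
Proof.
move=> cH e0 H0.
have mJ := mean2_mean mI.
(* The final error is 2 eta^2 (1 + J(H^2)), which equals [e] for the [eta] chosen below. *)
pose B := 2 * (1 + J (fun p => H p ^+ 2)).
have B0 : 0 < B.
  by have := mean_sq_ge0 mJ cH; rewrite /B; lra.
pose eta := Num.sqrt (e / B).
have eta0 : 0 < eta by rewrite sqrtr_gt0 divr_gt0.
have etaE : eta ^+ 2 * B = e by rewrite sqr_sqrtr ?divfK ?gt_eqF // ltW // divr_gt0.
have [kappa [ckap Ikap kapV hkap]] := approx_unit mI mG linv cH eta0.
(* Subtracting 1 makes the operator annihilate constants, so that its eigenfunctions with nonzero
   eigenvalue have mean zero. The image of H(x,.) does not change, since it has mean zero. *)
pose k x y := kappa (x^-1 * y)%g - 1.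
have ck : continuous (fun p => k p.1 p.2) by rewrite /k; cts.
have ksym x y : k x y = k y x by rewrite /k -kapV invgM invgK.
have [n [f [lam [[of_ lame fE] trunc span]]]] := spectral_truncation mI mG ck ksym eta0.
have [cf ff] := of_.
have lam0 i : lam i != 0.
  by apply: contraTneq (lame i) => ->; rewrite normr0 -ltNge.
have f0 i : I (f i) = 0.
  have : lam i * I (f i) = 0; last first.
    by move/eqP; rewrite mulf_eq0 (negbTE (lam0 i)) => /eqP.
  rewrite -(meanZ mI) //.
  transitivity (I (fun x => I (fun y => k x y * f i y))).
    by congr I; apply/funext => x; rewrite -fE.
  rewrite (mean_swap mI mG); last by cts.
  rewrite -[RHS](mean_cst mI); congr I; apply/funext => y.
  rewrite (meanZr mI); last by cts.
  rewrite /k (meanB mI); [|cts..].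
  rewrite (mean_inv mI mG linv (f := fun x => kappa (x * y)%g)); last by cts.
  by rewrite (rinv mI mG linv) // Ikap (mean_cst mI) subrr mul0r.
(* A left translate of [f i] is an eigenfunction for the same eigenvalue, hence in the span by the
   last clause of [spectral_truncation]. *)
have transl g i x : f i (g * x)%g = \sum_j I (fun y => f i (g * y)%g * f j y) * f j x.
  apply: (span (fun x => f i (g * x)%g) (lam i)) => //; first by cts.
  move=> z; rewrite -fE /kop -(linv g (f := fun y => k (g * z)%g y * f i y)); last by cts.
  by congr I; apply/funext => y; rewrite /k invgM -mulgA mulKg.
have [r [rr rf rE]] := translation_rep of_ f0 transl.
exists n, f, r; split => //.
pose h i x := I (fun y => H (x, y) * f i y).
have ch i : continuous (h i) by rewrite /h; cts.
rewrite -etaE /B mulrCA [J _]/mean2 -/(h _ _).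
have cHx x : continuous (fun y => H (x, y)) by cts.
have step x : I (fun y => (H (x, y) - \sum_i h i x * f i y) ^+ 2) <=
    2 * eta ^+ 2 + 2 * eta ^+ 2 * I (fun y => H (x, y) ^+ 2).
  pose L y := \sum_i lam i * h i x * f i y.
  have cL : continuous L by rewrite /L; cts.
  have ckH := ct_kop mI ck (cHx x).
  have LE i : I (fun y => L y * f i y) = lam i * h i x.
    by rewrite (mean_orth_sum mI (fun i => lam i * h i x)).
  have kH y : `|H (x, y) - kop I k (fun y => H (x, y)) y| <= eta.
    have := hkap (x, y) => /=; congr (`|_ - _| <= _).
    rewrite -(linv y^-1%g (f := fun t => kappa t * H (x, y * t)%g)); last by cts.
    transitivity (I (fun t => kappa (y^-1 * t)%g * H (x, t) - H (x, t))).
      rewrite (meanB mI); [|cts..].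
      by rewrite H0 subr0; congr I; apply/funext => t; rewrite mulVKg.
    by congr I; apply/funext => t; rewrite /k; ring.
  (* [L] lies in the span, so the projection of H(x,.) is at least as close to it as [L] is. *)
  apply: (@le_trans _ _ (I (fun y => (H (x, y) - L y) ^+ 2))).
    have cHL : continuous (fun y => H (x, y) - L y) by cts.
    have -> : I (fun y => (H (x, y) - \sum_i h i x * f i y) ^+ 2) =
        I (fun y => (H (x, y) - L y - \sum_i I (fun y => (H (x, y) - L y) * f i y) * f i y) ^+ 2).
      congr I; apply/funext => y; congr (_ ^+ 2); rewrite -addrA; congr (_ + _).
      rewrite -opprD; congr (- _); rewrite /L -big_split /=; apply: eq_bigr => i _.
      have -> : I (fun y => (H (x, y) - L y) * f i y) = h i x - lam i * h i x.
        rewrite -LE -(meanB mI); [|cts..].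
        by congr I; apply/funext => z; rewrite mulrBl.
      by ring.
    rewrite (bessel_eq mI) // lerBlDr lerDl sumr_ge0 // => i _; exact: sqr_ge0.
  apply: (@le_trans _ _ (I (fun y => 2 * eta ^+ 2 +
      2 * (kop I k (fun y => H (x, y)) y - L y) ^+ 2))).
    apply: (le_mean mI); [by cts|by cts|move=> y].
    have := sqr_le_norm (kH y).
    set a := kop _ _ _ y; move=> h1.
    have := sqr_ge0 ((H (x, y) - a) - (a - L y)); rewrite !expr2 in h1 *; nra.
  rewrite (meanD mI); [|by cts..]; rewrite (mean_cst mI) lerD2l.
  rewrite (meanZ mI); last by cts.
  rewrite -mulrA ler_wpM2l //.
  exact: (trunc (fun y => H (x, y)) (cHx x)).
apply: le_trans (le_mean mI _ _ step) _; [by cts|by cts|].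
rewrite (meanD mI); [|by cts..]; rewrite (mean_cst mI) (meanZ mI); last by cts.
by rewrite /mean2; lra.
Qed.

End translation_rep.

(** * Complex-valued continuous functions and their means *)

Section complex_mean.
Variable R : realType.
Local Notation C := R[i].
Local Notation Re := (@complex.Re R).
Local Notation Im := (@complex.Im R).

Definition nsq (z : C) : R := Re z ^+ 2 + Im z ^+ 2.

Lemma ReM (a b : C) : Re (a * b) = Re a * Re b - Im a * Im b.
Proof. by case: a b => [? ?] [? ?]. Qed.
Lemma ImM (a b : C) : Im (a * b) = Re a * Im b + Im a * Re b.
Proof. by case: a b => [? ?] [? ?]. Qed.
Lemma ReD (a b : C) : Re (a + b) = Re a + Re b.
Proof. by case: a b => [? ?] [? ?]. Qed.
Lemma ImD (a b : C) : Im (a + b) = Im a + Im b.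
Proof. by case: a b => [? ?] [? ?]. Qed.
Lemma ReN (a : C) : Re (- a) = - Re a. Proof. by case: a. Qed.
Lemma ImN (a : C) : Im (- a) = - Im a. Proof. by case: a. Qed.
Lemma ReJ (a : C) : Re a^* = Re a. Proof. by case: a. Qed.
Lemma ImJ (a : C) : Im a^* = - Im a. Proof. by case: a. Qed.

Lemma complex_eq (a b : C) : Re a = Re b -> Im a = Im b -> a = b.
Proof. by case: a b => [? ?] [? ?] /= -> ->. Qed.

Lemma nsq_ge0 z : 0 <= nsq z.
Proof. by rewrite /nsq addr_ge0 ?sqr_ge0. Qed.

Lemma nsqE z : nsq z = Re (z * z^*).
Proof. by rewrite ReM ReJ ImJ /nsq; ring. Qed.

Lemma Re_sum (A : finType) (F : A -> C) : Re (\sum_i F i) = \sum_i Re (F i).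
Proof. by elim/big_rec2 : _ => // i y1 y2 _ <-; rewrite ReD. Qed.

Lemma Im_sum (A : finType) (F : A -> C) : Im (\sum_i F i) = \sum_i Im (F i).
Proof. by elim/big_rec2 : _ => // i y1 y2 _ <-; rewrite ImD. Qed.

Lemma ReM_le (a b : C) : Re (a * b) <= 2^-1 * (nsq a + nsq b).
Proof.
rewrite ReM /nsq.
have := sqr_ge0 (Re a - Re b); have := sqr_ge0 (Im a + Im b); rewrite !expr2; lra.
Qed.

Section continuity.
Implicit Types T U : topologicalType.

(** Working with real and imaginary parts reduces complex means to real ones; [ccont_mx_continuous]
    recovers the topological continuity required by [unitary_rep]. *)
Definition ccont T (f : T -> C) :=
  continuous (fun x => Re (f x)) /\ continuous (fun x => Im (f x)).

Lemma ccont_cst T c : ccont (fun _ : T => c).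
Proof. by split; cts. Qed.

Lemma ccontD T (f h : T -> C) : ccont f -> ccont h -> ccont (fun x => f x + h x).
Proof.
move=> [f1 f2] [h1 h2]; split.
  rewrite (_ : (fun x => Re (f x + h x)) = (fun x => Re (f x) + Re (h x))); first by cts.
  by apply/funext => x; rewrite ReD.
rewrite (_ : (fun x => Im (f x + h x)) = (fun x => Im (f x) + Im (h x))); first by cts.
by apply/funext => x; rewrite ImD.
Qed.

Lemma ccontN T (f : T -> C) : ccont f -> ccont (fun x => - f x).
Proof.
move=> [f1 f2]; split.
  rewrite (_ : (fun x => Re (- f x)) = (fun x => - Re (f x))); first by cts.
  by apply/funext => x; rewrite ReN.
rewrite (_ : (fun x => Im (- f x)) = (fun x => - Im (f x))); first by cts.
by apply/funext => x; rewrite ImN.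
Qed.

Lemma ccontM T (f h : T -> C) : ccont f -> ccont h -> ccont (fun x => f x * h x).
Proof.
move=> [f1 f2] [h1 h2]; split.
  rewrite (_ : (fun x => Re (f x * h x)) = (fun x => Re (f x) * Re (h x) - Im (f x) * Im (h x))); first by cts.
  by apply/funext => x; rewrite ReM.
rewrite (_ : (fun x => Im (f x * h x)) = (fun x => Re (f x) * Im (h x) + Im (f x) * Re (h x))); first by cts.
by apply/funext => x; rewrite ImM.
Qed.

Lemma ccontJ T (f : T -> C) : ccont f -> ccont (fun x => (f x)^*).
Proof.
move=> [f1 f2]; split.
  rewrite (_ : (fun x => Re (f x)^*) = (fun x => Re (f x))); first by cts.
  by apply/funext => x; rewrite ReJ.
rewrite (_ : (fun x => Im (f x)^*) = (fun x => - Im (f x))); first by cts.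
by apply/funext => x; rewrite ImJ.
Qed.

Lemma ccont_sum T (A : finType) (f : A -> T -> C) : (forall i, ccont (f i)) ->
  ccont (fun x => \sum_i f i x).
Proof.
move=> cf; have f1 i : continuous (fun x => Re (f i x)) by have [] := cf i.
have f2 i : continuous (fun x => Im (f i x)) by have [] := cf i.
split.
  rewrite (_ : (fun x => Re (\sum_i f i x)) = (fun x => \sum_i Re (f i x))).
    exact: (ct_sum f1).
  by apply/funext => x; rewrite Re_sum.
rewrite (_ : (fun x => Im (\sum_i f i x)) = (fun x => \sum_i Im (f i x))).
  exact: (ct_sum f2).
by apply/funext => x; rewrite Im_sum.
Qed.

Lemma ccont_comp T U (f : U -> C) (h : T -> U) : ccont f -> continuous h ->
  ccont (fun x => f (h x)).
Proof.
move=> [f1 f2] ch; split.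
  exact: (ct_comp (f := fun x => Re (f x)) f1 ch).
exact: (ct_comp (f := fun x => Im (f x)) f2 ch).
Qed.

Lemma ct_nsq T (f : T -> C) : ccont f -> continuous (fun x => nsq (f x)).
Proof. by move=> [f1 f2]; rewrite /nsq; cts. Qed.

End continuity.

Section cmean.
Variables (T : topologicalType) (I : (T -> R) -> R).
Hypothesis mI : mean I.

Definition cmean (f : T -> C) : C :=
  Complex (I (fun x => Re (f x))) (I (fun x => Im (f x))).

Lemma cmeanD (f h : T -> C) : ccont f -> ccont h ->
  cmean (fun x => f x + h x) = cmean f + cmean h.
Proof.
move=> [f1 f2] [h1 h2]; apply: complex_eq; rewrite ?ReD ?ImD /=.
  by rewrite -(meanD mI) //; congr I; apply/funext => x; rewrite ReD.
by rewrite -(meanD mI) //; congr I; apply/funext => x; rewrite ImD.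
Qed.

Lemma cmeanZ c (f : T -> C) : ccont f -> cmean (fun x => c * f x) = c * cmean f.
Proof.
move=> [f1 f2]; apply: complex_eq; rewrite ?ReM ?ImM /=.
  rewrite -!(meanZ mI) // -(meanB mI); [|cts..].
  by congr I; apply/funext => x; rewrite ReM.
rewrite -!(meanZ mI) // -(meanD mI); [|cts..].
by congr I; apply/funext => x; rewrite ImM.
Qed.

Lemma cmeanN (f : T -> C) : ccont f -> cmean (fun x => - f x) = - cmean f.
Proof.
move=> cf; rewrite -mulN1r -cmeanZ //.
by congr cmean; apply/funext => x; rewrite mulN1r.
Qed.

Lemma cmeanJ (f : T -> C) : ccont f -> cmean (fun x => (f x)^*) = (cmean f)^*.
Proof.
move=> [f1 f2]; apply: complex_eq; rewrite ?ReJ ?ImJ /=.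
  by congr I; apply/funext => x; rewrite ReJ.
by rewrite -(meanN mI) //; congr I; apply/funext => x; rewrite ImJ.
Qed.

Lemma cmean_cst c : cmean (fun=> c) = c.
Proof. by apply: complex_eq => /=; rewrite (mean_cst mI). Qed.

Lemma cmean_sum (A : finType) (f : A -> T -> C) : (forall i, ccont (f i)) ->
  cmean (fun x => \sum_i f i x) = \sum_i cmean (f i).
Proof.
move=> cf; apply: complex_eq; rewrite ?Re_sum ?Im_sum /=.
  rewrite -(mean_sum mI); last by move=> i; have [] := cf i.
  by congr I; apply/funext => x; rewrite Re_sum.
rewrite -(mean_sum mI); last by move=> i; have [] := cf i.
by congr I; apply/funext => x; rewrite Im_sum.
Qed.

Lemma ccont_cmean (U : topologicalType) (F : U -> T -> C) :
  ccont (fun p : U * T => F p.1 p.2) -> ccont (fun u => cmean (F u)).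
Proof.
move=> [F1 F2]; split => /=.
  exact: (ct_mean mI (F := fun u x => Re (F u x))).
exact: (ct_mean mI (F := fun u x => Im (F u x))).
Qed.

End cmean.
End complex_mean.

Ltac ccts_leaf := solve [eassumption
  | match goal with H : forall _, ccont _ |- _ => exact: H end
  | match goal with H : forall _ _, ccont _ |- _ => exact: H end].

Ltac ccts :=
  cbv beta;
  lazymatch goal with
  | |- ccont (fun _ => ?c) => exact: ccont_cst
  | |- ccont (fun x => @?a x + @?b x) => refine (@ccontD _ _ a b _ _); ccts
  | |- ccont (fun x => @?a x * @?b x) => refine (@ccontM _ _ a b _ _); ccts
  | |- ccont (fun x => - @?a x) => refine (@ccontN _ _ a _); ccts
  | |- ccont (fun x => (@?a x)^*) => refine (@ccontJ _ _ a _); ccts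
  | |- ccont (fun x => \sum_i (@?a x i)) =>
      refine (@ccont_sum _ _ _ (fun i x => a x i) _); ccts
  | |- ccont (fun x => @cmean _ _ ?I (@?h x)) =>
      refine (@ccont_cmean _ _ I _ _ h _); [eassumption|ccts]
  | |- ccont _ => ccts_leaf
  | |- forall _, _ => intro; ccts
  end.

(** * Unitary representations in coordinates *)

Section complex_rep.
Variables (R : realType) (G : topologicalGroupType).
Local Notation C := R[i].

Definition complex_rep n (rho : G -> 'M[C]_n) :=
  [/\ rho 1%g = 1%:M, forall g h, rho (g * h)%g = rho g *m rho h,
      forall g, rho g \is unitarymx & forall i j, ccont (fun g => rho g i j)].

Lemma norm_complex_lt (z : C) (e : R) : 0 < e -> `|complex.Re z| < e / 2 ->
  `|complex.Im z| < e / 2 -> `|z| < e%:C%C.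
Proof.
move=> e0 h1 h2; rewrite normc_def ltcR.
have e22 : 0 <= e / 2 by rewrite divr_ge0 ?ltW.
have := sqr_le_norm (ltW h1); have := sqr_le_norm (ltW h2) => s1 s2.
have e2 : 0 < e ^+ 2 by rewrite exprn_gt0.
have e4 : (e / 2) ^+ 2 = e ^+ 2 / 4 by field.
rewrite -[ltRHS](ger0_norm (ltW e0)) -sqrtr_sqr ltr_sqrt // e4 in s1 s2 *.
lra.
Qed.

Lemma ccont_mx_continuous n (rho : G -> 'M[C]_n) :
  (forall i j, ccont (fun g => rho g i j)) -> continuous (rho : G -> 'M[R[i]^o]_n).
Proof.
move=> crho g; apply/cvg_ballP => e e0.
have [r r0 re] : exists2 r : R, 0 < r & e = r%:C%C.
  move: e0; rewrite ltcE => /andP[/eqP h1 h2]; exists (complex.Re e) => //.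
  by apply: complex_eq.
rewrite {}re in e0 *.
have H i j : \forall x \near g, `|rho g i j - rho x i j| < r%:C%C.
  have r2 : 0 < r / 2 by rewrite divr_gt0.
  have [c1 c2] := crho i j.
  have := c1 g => /cvgrPdist_lt /(_ _ r2) n1.
  have := c2 g => /cvgrPdist_lt /(_ _ r2) n2.
  apply: filterS (filterI n1 n2) => x [h1 h2]; apply: norm_complex_lt => //.
    by rewrite ReD ReN.
  by rewrite ImD ImN.
have H2 : \forall x \near g, forall i j, `|rho g i j - rho x i j| < r%:C%C.
  by apply: filter_forall => i; apply: filter_forall => j; exact: H.
by apply: filterS H2 => x hx; split.
Qed.

Lemma complex_rep_unitary n (rho : G -> 'M[C]_n) : complex_rep rho -> unitary_rep rho.
Proof. by move=> [r1 rM rU rc]; split => //; exact: ccont_mx_continuous. Qed.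

Lemma trmxCE m n (A : 'M[C]_(m, n)) i j : (A^t*) i j = (A j i)^*.
Proof. by rewrite !mxE. Qed.

Lemma unitarymxK n (A : 'M[C]_n) : A \is unitarymx -> A^t* *m A = 1%:M.
Proof. by move=> /unitarymxP /mulmx1C. Qed.

End complex_rep.

(** * Bessel's inequality over the complex numbers *)

Section complex_bessel.
Variables (R : realType) (T : topologicalType) (I : (T -> R) -> R).
Hypothesis mI : mean I.
Local Notation C := R[i].
Local Notation Ic := (cmean I).

(** The common squared norm [c] is kept instead of normalizing, as Schur orthogonality will give c =
    1/n. The proof expands the squared distance from [h] to its projection [p]. *)
Lemma complex_bessel (A : finType) (e : A -> T -> C) (c : R) (h : T -> C) :
  0 < c -> (forall a, ccont (e a)) ->
  (forall a b, Ic (fun x => e a x * (e b x)^*) = (a == b)%:R * c%:C%C) ->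
  ccont h ->
  \sum_a nsq (Ic (fun x => h x * (e a x)^*)) <= c * I (fun x => nsq (h x)).
Proof.
move=> c0 ce ee ch.
pose w a := Ic (fun x => h x * (e a x)^*).
pose d : C := (c^-1)%:C%C.
have dJ : d^* = d by apply: complex_eq => //=; rewrite oppr0.
have dc : d * c%:C%C = 1.
  by rewrite /d -rmorphM /= mulVf // gt_eqF.
pose p x := \sum_a d * w a * e a x.
have cp : ccont p by rewrite /p; ccts.
have fpE (f : T -> C) : ccont f ->
    Ic (fun x => f x * (p x)^*) = \sum_a d * (w a)^* * Ic (fun x => f x * (e a x)^*).
  move=> cf.
  rewrite (_ : (fun x => f x * (p x)^*) =
      fun x => \sum_a d * (w a)^* * (f x * (e a x)^*)).
    rewrite (cmean_sum mI); last by ccts.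
    by apply: eq_bigr => a _; rewrite (cmeanZ mI) //; ccts.
  apply/funext => x; rewrite /p rmorph_sum mulr_sumr; apply: eq_bigr => a _.
  by rewrite !rmorphM /= dJ; ring.
have ep a : Ic (fun x => e a x * (p x)^*) = (w a)^*.
  rewrite fpE // (bigD1 a) //= big1 => [|b ba].
    by rewrite ee eqxx addr0 mul1r mulrAC dc mul1r.
  by rewrite ee eq_sym (negbTE ba) mul0r mulr0.
have hp : Ic (fun x => h x * (p x)^*) = d * \sum_a w a * (w a)^*.
  by rewrite fpE // mulr_sumr; apply: eq_bigr => a _; rewrite -/(w a); ring.
have pp : Ic (fun x => p x * (p x)^*) = d * \sum_a w a * (w a)^*.
  rewrite (_ : (fun x => p x * (p x)^*) = fun x => \sum_a d * w a * (e a x * (p x)^*)).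
    rewrite (cmean_sum mI); last by ccts.
    rewrite mulr_sumr; apply: eq_bigr => a _.
    by rewrite (cmeanZ mI) ?ep; [ring|ccts].
  by apply/funext => x; rewrite mulr_suml; apply: eq_bigr => a _; ring.
have ph : Ic (fun x => p x * (h x)^*) = d * \sum_a w a * (w a)^*.
  rewrite (_ : (fun x => p x * (h x)^*) = fun x => (h x * (p x)^*)^*).
    rewrite (cmeanJ mI); last by ccts.
    rewrite hp rmorphM /= dJ rmorph_sum; congr (_ * _); apply: eq_bigr => a _.
    by rewrite rmorphM /= conjCK mulrC.
  by apply/funext => x; rewrite rmorphM /= conjCK mulrC.
have chp : ccont (fun x => h x - p x) by ccts.
have E : I (fun x => nsq (h x - p x)) = I (fun x => nsq (h x)) - c^-1 * \sum_a nsq (w a).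
  have -> : I (fun x => nsq (h x - p x)) =
      complex.Re (Ic (fun x => (h x - p x) * (h x - p x)^*)).
    by congr I; apply/funext => x; rewrite nsqE.
  rewrite (_ : (fun x => _) = (fun x => (h x * (h x)^* + - (h x * (p x)^*)) +
      (- (p x * (h x)^*) + p x * (p x)^*))); last first.
    by apply/funext => x; rewrite rmorphB /=; ring.
  rewrite (cmeanD mI); [|ccts..]; rewrite (cmeanD mI); [|ccts..].
  rewrite (cmeanD mI); [|ccts..]; rewrite !(cmeanN mI); [|ccts..].
  rewrite hp ph pp addNr addr0 ReD ReN; congr (_ - _).
    by congr I; apply/funext => x; rewrite nsqE.
  rewrite ReM /= mul0r subr0 Re_sum; congr (_ * _).
  by apply: eq_bigr => a _; rewrite nsqE.
have : 0 <= I (fun x => nsq (h x - p x)).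
  by apply: (mean_ge0 mI) => [|x]; [exact: ct_nsq|exact: nsq_ge0].
by rewrite E subr_ge0 mulrC ler_pdivrMr // mulrC.
Qed.

End complex_bessel.

(** * Schur orthogonality and the irreducible case of the coefficient bound *)

Section schur.
Variables (R : realType) (G : topologicalGroupType) (I : (G -> R) -> R).
Hypothesis mI : mean I.
Hypothesis mG : metrizable R G.
Hypothesis linv : forall g (f : G -> R), continuous f ->
  I (fun x => f (g * x)%g) = I f.
Local Notation C := R[i].
Local Notation Ic := (cmean I).

Lemma cmean_linv g (f : G -> C) : ccont f -> Ic (fun x => f (g * x)%g) = Ic f.
Proof.
move=> [f1 f2]; apply: complex_eq => /=.
  exact: (linv g (f := fun x => complex.Re (f x))).
exact: (linv g (f := fun x => complex.Im (f x))).
Qed.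

Lemma cmean_rinv g (f : G -> C) : ccont f -> Ic (fun x => f (x * g)%g) = Ic f.
Proof.
move=> [f1 f2]; apply: complex_eq => /=.
  exact: (rinv mI mG linv g (f := fun x => complex.Re (f x))).
exact: (rinv mI mG linv g (f := fun x => complex.Im (f x))).
Qed.

Lemma cmean_swap (F : G -> G -> C) : ccont (fun p => F p.1 p.2) ->
  Ic (fun x => Ic (fun y => F x y)) = Ic (fun y => Ic (fun x => F x y)).
Proof.
move=> [F1 F2]; apply: complex_eq => /=.
  exact: (mean_swap mI mG (F := fun x y => complex.Re (F x y))).
exact: (mean_swap mI mG (F := fun x y => complex.Im (F x y))).
Qed.

Lemma complex_repV n (rho : G -> 'M[C]_n) g : complex_rep rho ->
  rho g^-1%g = (rho g)^t*.
Proof.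
move=> [r1 rM rU rc]; have h : rho g *m rho g^-1%g = 1%:M by rewrite -rM mulgV.
by rewrite -[LHS]mul1mx -(unitarymxK (rU g)) -mulmxA h mulmx1.
Qed.

(** For fixed [k] and [l] the averages form a matrix [Y] that commutes with [rho] by left
    invariance. An eigenspace of [Y] is invariant, hence everything, so [Y] is scalar; unitarity of
    [rho] gives its trace. *)
Lemma schur_orthogonality n (rho : G -> 'M[C]_n) i k j l :
  complex_rep rho -> irreducible_rep rho ->
  Ic (fun g => rho g i k * (rho g j l)^*) = (i == j)%:R * (k == l)%:R / n%:R.
Proof.
move=> rr [n0 irr]; have [r1 rM rU rc] := rr.
pose p i j := Ic (fun g => rho g i k * (rho g j l)^*).
pose Y : 'M[C]_n := \matrix_(i, j) p i j.
have Yinv h : Y = rho h *m Y *m (rho h)^t*.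
  apply/matrixP => a b; rewrite mxE /p -(cmean_linv h); last by ccts.
  transitivity (Ic (fun g => \sum_d \sum_c (rho h a c * (rho h b d)^*) *
      (rho g c k * (rho g d l)^*))).
    congr cmean; apply/funext => g; rewrite !rM !mxE rmorph_sum mulr_sumr.
    apply: eq_bigr => d _; rewrite mulr_suml; apply: eq_bigr => c _.
    by rewrite rmorphM /=; ring.
  rewrite (cmean_sum mI); last by ccts.
  rewrite mxE; apply: eq_bigr => d _; rewrite (cmean_sum mI); last by ccts.
  rewrite mxE mulr_suml; apply: eq_bigr => c _; rewrite (cmeanZ mI); last by ccts.
  by rewrite trmxCE /Y mxE /p; ring.
have Ycomm h : Y *m rho h = rho h *m Y.
  by rewrite {1}(Yinv h) -!mulmxA unitarymxK // mulmx1.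
have [a ha] := eigenvalue_closed Y n0.
have Ya : Y = a%:M.
  have st g : stablemx (eigenspace Y a) (rho g).
    apply/eigenspaceP; rewrite -mulmxA -Ycomm mulmxA.
    have /eigenspaceP -> := submx_refl (eigenspace Y a).
    by rewrite scalemxAl.
  case: (irr (eigenspace Y a) st) => h; first by move: ha; rewrite /eigenvalue h eqxx.
  move: h; rewrite -sub1mx => /eigenspaceP; rewrite mul1mx => ->.
  by rewrite scalemx1.
have tr : a *+ n = (k == l)%:R.
  rewrite -mxtrace_scalar -Ya /mxtrace.
  transitivity (Ic (fun g => \sum_i rho g i k * (rho g i l)^*)).
    by rewrite (cmean_sum mI); [apply: eq_bigr => c _; rewrite mxE|ccts].
  rewrite -[RHS](cmean_cst mI); congr cmean; apply/funext => g.
  have := congr1 (fun A : 'M[C]_n => A l k) (unitarymxK (rU g)).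
  rewrite !mxE eq_sym => <-; apply: eq_bigr => c _.
  by rewrite trmxCE mulrC.
have -> : Ic (fun g => rho g i k * (rho g j l)^*) = Y i j by rewrite mxE.
rewrite Ya mxE.
have n1 : (n%:R : C) != 0 by rewrite pnatr_eq0 -lt0n.
rewrite -tr -(mulr_natr a n); case: (i == j) => /=; last by rewrite mulr0n !mul0r.
by rewrite mulr1n mul1r mulfK.
Qed.

Definition nrm n (v : 'cV[C]_n) : R := \sum_i nsq (v i 0).

Definition cvcont (T : topologicalType) n (h : T -> 'cV[C]_n) := forall i, ccont (fun x => h x i 0).

Lemma ct_nrm (T : topologicalType) n (h : T -> 'cV[C]_n) : cvcont h ->
  continuous (fun x => nrm (h x)).
Proof. by move=> ch; apply: ct_sum => i; apply: ct_nsq. Qed.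

Lemma nrm_ge0 n (v : 'cV[C]_n) : 0 <= nrm v.
Proof. by apply: sumr_ge0 => i _; exact: nsq_ge0. Qed.

Lemma nrmE n (v : 'cV[C]_n) : nrm v = complex.Re ((v^t* *m v) 0 0).
Proof.
rewrite mxE Re_sum; apply: eq_bigr => i _.
by rewrite trmxCE nsqE mulrC.
Qed.

(** The correlation to which [mixing] reduces. The pairing is bilinear: [F] is transposed without
    conjugation. *)
Definition coeff n (rho : G -> 'M[C]_n) (h F : G -> 'cV[C]_n) : C :=
  Ic (fun g => Ic (fun x => ((F x)^T *m rho g *m h (g * x)%g) 0 0)).

Lemma formE n (u v : 'cV[C]_n) (A : 'M[C]_n) :
  (u^T *m A *m v) 0 0 = \sum_i \sum_j u j 0 * A j i * v i 0.
Proof.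
rewrite mxE; apply: eq_bigr => i _; rewrite mxE mulr_suml; apply: eq_bigr => j _.
by rewrite mxE.
Qed.

Lemma ccont_form n (rho : G -> 'M[C]_n) (h F : G -> 'cV[C]_n) :
  (forall i j, ccont (fun g => rho g i j)) -> cvcont h -> cvcont F ->
  ccont (fun p : G * G => ((F p.2)^T *m rho p.1 *m h (p.1 * p.2)%g) 0 0).
Proof.
move=> cr ch cF.
rewrite (_ : (fun p => _) = (fun p : G * G =>
    \sum_i \sum_j F p.2 j 0 * rho p.1 j i * h (p.1 * p.2)%g i 0)).
  apply: ccont_sum => i; apply: ccont_sum => j; apply: ccontM; first apply: ccontM.
  - by apply: (ccont_comp (cF j)); cts.
  - by apply: (ccont_comp (cr j i)); cts.
  - by apply: (ccont_comp (ch i)); cts.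
by apply/funext => p; rewrite formE.
Qed.

(** Substituting g x^-1 for g separates the variables, since rho(g x^-1) is rho(g) times the adjoint
    of rho(x). The result is a sum of products of Fourier coefficients [al] of [h] and [be] of [F].
    The entries of [rho] are orthogonal with squared norm 1/n, so Bessel's inequality gains a factor
    1/n for each family. *)
Lemma coeff_irreducible n (rho : G -> 'M[C]_n) (h F : G -> 'cV[C]_n) :
  complex_rep rho -> irreducible_rep rho -> cvcont h -> cvcont F ->
  complex.Re (coeff rho h F) <=
    (2 * n%:R)^-1 * (I (fun x => nrm (h x)) + I (fun x => nrm (F x))).
Proof.
rewrite /cvcont => rr irr ch cF; have [r1 rM rU rc] := rr.
have n0 : 0 < n%:R :> R by rewrite ltr0n; have [] := irr.
pose al i j l := Ic (fun x => h x i 0 * rho x j l).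
pose be i j l := Ic (fun x => F x j 0 * (rho x i l)^*).
have E : coeff rho h F = \sum_i \sum_j \sum_l al i j l * be i j l.
  rewrite /coeff cmean_swap; last exact: ccont_form.
  transitivity (Ic (fun x => \sum_i \sum_j \sum_l al i j l * (F x j 0 * (rho x i l)^*))).
    congr cmean; apply/funext => x.
    rewrite -(cmean_rinv x^-1%g); last first.
      apply: (ccont_comp (ccont_form rc ch cF) (h := fun g => (g, x))); cts.
    rewrite (_ : (fun g => _) = (fun g => \sum_i \sum_j \sum_l
        (F x j 0 * (rho x i l)^*) * (h g i 0 * rho g j l))); last first.
      apply/funext => g; rewrite formE; apply: eq_bigr => i _; apply: eq_bigr => j _.
      rewrite -mulgA mulVg mulg1 rM complex_repV // mxE mulr_sumr mulr_suml.
      by apply: eq_bigr => l _; rewrite trmxCE; ring.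
    rewrite (cmean_sum mI); last by ccts.
    apply: eq_bigr => i _; rewrite (cmean_sum mI); last by ccts.
    apply: eq_bigr => j _; rewrite (cmean_sum mI); last by ccts.
    by apply: eq_bigr => l _; rewrite (cmeanZ mI); [rewrite mulrC|ccts].
  rewrite (cmean_sum mI); last by ccts.
  apply: eq_bigr => i _; rewrite (cmean_sum mI); last by ccts.
  apply: eq_bigr => j _; rewrite (cmean_sum mI); last by ccts.
  by apply: eq_bigr => l _; rewrite (cmeanZ mI) //; ccts.
have nV : ((n%:R)^-1 : R)%:C%C = (n%:R : C)^-1 by rewrite fmorphV rmorph_nat.
have Bal i : \sum_j \sum_l nsq (al i j l) <= n%:R^-1 * I (fun x => nsq (h x i 0)).
  rewrite pair_bigA /=.
  have := complex_bessel mI (e := fun (q : 'I_n * 'I_n) x => (rho x q.1 q.2)^*)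
    (c := n%:R^-1) (h := fun x => h x i 0) _ _ _ (ch i).
  rewrite invr_gt0 => /(_ n0) H; apply: le_trans (H _ _).
  - by apply: ler_sum => q _; rewrite le_eqVlt; apply/orP; left; apply/eqP;
      congr nsq; congr cmean; apply/funext => x; rewrite conjCK.
  - by move=> q; ccts.
  - move=> [a b] [a' b'] /=; rewrite nV.
    transitivity (Ic (fun x => rho x a' b' * (rho x a b)^*)).
      by congr cmean; apply/funext => x; rewrite conjCK mulrC.
    rewrite schur_orthogonality // -natrM mulnb; congr (_%:R / _).
    by rewrite xpair_eqE eq_sym [b' == b]eq_sym.
have Bbe j : \sum_i \sum_l nsq (be i j l) <= n%:R^-1 * I (fun x => nsq (F x j 0)).
  rewrite pair_bigA /=.
  have := complex_bessel mI (e := fun (q : 'I_n * 'I_n) x => rho x q.1 q.2)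
    (c := n%:R^-1) (h := fun x => F x j 0) _ _ _ (cF j).
  rewrite invr_gt0 => /(_ n0); apply => [q|[a b] [a' b'] /=]; first by ccts.
  by rewrite nV schur_orthogonality // -natrM mulnb.
have cnh i : continuous (fun x => nsq (h x i 0)) by apply: ct_nsq.
have cnF i : continuous (fun x => nsq (F x i 0)) by apply: ct_nsq.
rewrite E Re_sum invfM /nrm (mean_sum mI) // (mean_sum mI) // -mulrA mulrDr.
rewrite !mulr_sumr.
apply: (@le_trans _ _ (\sum_i \sum_j \sum_l 2^-1 * (nsq (al i j l) + nsq (be i j l)))).
  apply: ler_sum => i _; rewrite Re_sum; apply: ler_sum => j _; rewrite Re_sum.
  by apply: ler_sum => l _; exact: ReM_le.
rewrite (_ : \sum_i _ = 2^-1 * (\sum_i \sum_j \sum_l nsq (al i j l)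
    + \sum_j \sum_i \sum_l nsq (be i j l))).
  by rewrite ler_wpM2l ?invr_ge0 // lerD //; apply: ler_sum.
rewrite [X in _ + X]exchange_big -big_split mulr_sumr /=; apply: eq_bigr => i _.
rewrite -big_split mulr_sumr /=; apply: eq_bigr => j _.
by rewrite -big_split mulr_sumr.
Qed.

End schur.

(** * The coefficient bound for all representations without fixed vectors *)

Section rep_bound.
Variables (R : realType) (G : topologicalGroupType) (I : (G -> R) -> R).
Hypothesis mI : mean I.
Hypothesis mG : metrizable R G.
Hypothesis linv : forall g (f : G -> R), continuous f ->
  I (fun x => f (g * x)%g) = I f.
Local Notation C := R[i].
Local Notation Ic := (cmean I).

Lemma trmxC_mul m n p (A : 'M[C]_(m, n)) (B : 'M[C]_(n, p)) :
  (A *m B)^t* = B^t* *m A^t*.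
Proof. by rewrite trmx_mul map_mxM. Qed.

Lemma mxE_add m n (A B : 'M[C]_(m, n)) i j : (A + B) i j = A i j + B i j.
Proof. by rewrite mxE. Qed.

(** When the rows of [B] are an orthonormal basis of an invariant subspace, this is the restriction
    of [rho] to it, written in that basis. *)
Definition compress k n (B : 'M[C]_(k, n)) (rho : G -> 'M[C]_n) (g : G) : 'M[C]_k :=
  B *m rho g *m B^t*.

Lemma compress_rep k n (B : 'M[C]_(k, n)) (rho : G -> 'M[C]_n) :
  complex_rep rho -> fixed_free rho -> B *m B^t* = 1%:M ->
  (forall g, (B *m rho g <= B)%MS) ->
  [/\ complex_rep (compress B rho), fixed_free (compress B rho)
    & forall g, B *m rho g = compress B rho g *m B].
Proof.
move=> [r1 rM rU rc] ff BB st.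
have BE g : B *m rho g = compress B rho g *m B.
  have /submxP[X hX] := st g.
  by rewrite /compress hX -(mulmxA X B) BB mulmx1.
split => //.
  split.
  - by rewrite /compress r1 mulmx1.
  - move=> g h; rewrite {1}/compress rM mulmxA BE -(mulmxA (compress B rho g)).
    by rewrite mulmxA -(mulmxA _ B) -mulmxA.
  - move=> g; apply/unitarymxP; rewrite [X in _ *m X^t*]/compress 2!trmxC_mul trmxCK.
    rewrite (mulmxA (compress B rho g)) -BE mulmxA -(mulmxA B).
    by rewrite (unitarymxP (rU g)) mulmx1.
  - move=> i j; rewrite /compress.
    rewrite (_ : (fun g => _) =
        (fun g => \sum_b (\sum_a B i a * rho g a b) * (B^t*) b j)); first by ccts.
    by apply/funext => g; rewrite mxE; apply: eq_bigr => b _; rewrite mxE.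
move=> c hc; have : c *m B = 0.
  by apply: ff => g; rewrite -mulmxA BE mulmxA hc.
by move=> h; rewrite -[c]mulmx1 -BB mulmxA h mul0mx.
Qed.

(** [B1] and [B2] come from Gram-Schmidt on [U] and on its orthogonal complement. *)
Lemma isometry_complement n (U : 'M[C]_n) : U != 0 -> ~~ row_full U ->
  exists k1 k2 (B1 : 'M[C]_(k1, n)) (B2 : 'M[C]_(k2, n)),
  [/\ (k1 < n)%N /\ (k2 < n)%N, B1 *m B1^t* = 1%:M /\ B2 *m B2^t* = 1%:M,
      (B1 :=: U)%MS, (B2 :=: kermx (B1^t*))%MS
    & B1^t* *m B1 + B2^t* *m B2 = 1%:M].
Proof.
move=> U0 Uf.
pose B1 := schmidt (row_base U).
have B11 : B1 *m B1^t* = 1%:M.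
  by apply/unitarymxP; rewrite schmidt_unitarymx ?rank_leq_col.
have B1U : (B1 :=: U)%MS.
  by apply: (eqmx_trans (eqmx_schmidt_free (row_base_free U))); exact: eq_row_base.
pose W := kermx (B1^t*).
pose B2 := schmidt (row_base W).
have B22 : B2 *m B2^t* = 1%:M.
  by apply/unitarymxP; rewrite schmidt_unitarymx ?rank_leq_col.
have B2W : (B2 :=: W)%MS.
  by apply: (eqmx_trans (eqmx_schmidt_free (row_base_free W))); exact: eq_row_base.
have B21 : B2 *m B1^t* = 0 by apply/sub_kermxP; rewrite B2W.
have B12 : B1 *m B2^t* = 0.
  by rewrite -[LHS]trmxCK trmxC_mul trmxCK B21 trmx0 map_mx0.
exists (\rank U), (\rank W), B1, B2; split => //.
  split.
    by rewrite ltn_neqAle rank_leq_col andbT.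
  rewrite ltn_neqAle rank_leq_col andbT; apply: contra U0 => Wf.
  have : (1%:M <= W)%MS by rewrite sub1mx.
  move/sub_kermxP; rewrite mul1mx => B10.
  have B1z : B1 = 0 by rewrite -[B1]trmxCK B10 trmx0 map_mx0.
  by rewrite -submx0 -B1U B1z submx0.
(* The rows of [1 - P] lie in the span of [B2] and are orthogonal to it, so [1 - P] vanishes. *)
pose P := B1^t* *m B1 + B2^t* *m B2.
have : (1%:M - P <= B2)%MS.
  rewrite B2W; apply/sub_kermxP; rewrite mulmxBl mul1mx /P mulmxDl -!mulmxA B11 B21.
  by rewrite mulmx1 mulmx0 addr0 subrr.
move=> /submxP[X hX].
have : X = 0.
  rewrite -[X]mulmx1 -B22 mulmxA -hX mulmxBl mul1mx /P mulmxDl -!mulmxA B12 B22.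
  by rewrite mulmx1 mulmx0 add0r subrr.
by move=> X0; move/eqP: hX; rewrite X0 mul0mx subr_eq0 => /eqP.
Qed.

Variable D : R.
Hypothesis D0 : 0 < D.
Hypothesis qG : quasirandom D G.

(** Conjugating [B] compensates for the bilinear pairing in [coeff]: transposing the result
    multiplies the transpose of [v] by the adjoint of [B]. *)
Definition cjmul k n (B : 'M[C]_(k, n)) (v : 'cV[C]_n) : 'cV[C]_k := map_mx Num.conj B *m v.

Lemma cvcont_mul (T : topologicalType) k n (B : 'M[C]_(k, n)) (h : T -> 'cV[C]_n) :
  cvcont h -> cvcont (fun x => B *m h x).
Proof.
move=> ch i; rewrite (_ : (fun x => _) = (fun x => \sum_j B i j * h x j 0)).
  by apply: ccont_sum => j; apply: ccontM; [exact: ccont_cst|exact: ch].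
by apply/funext => x; rewrite mxE.
Qed.

(** Induction on the dimension. An irreducible [rho] without fixed vectors is nontrivial, hence of
    dimension at least [D]. Otherwise an invariant subspace and its orthogonal complement split
    [rho], and both sides of the inequality are additive over the splitting. *)
Lemma coeff_bound n (rho : G -> 'M[C]_n) (h F : G -> 'cV[C]_n) :
  complex_rep rho -> fixed_free rho -> cvcont h -> cvcont F ->
  complex.Re (coeff I rho h F) <=
    (2 * D)^-1 * (I (fun x => nrm (h x)) + I (fun x => nrm (F x))).
Proof.
elim/ltn_ind: n rho h F => n IH rho h F rr ff ch cF.
have [r1 rM rU rc] := rr.
have cnh := ct_nrm ch; have cnF := ct_nrm cF.
have B0 : 0 <= I (fun x => nrm (h x)) + I (fun x => nrm (F x)).
  by apply: addr_ge0; apply: (mean_ge0 mI) => // x; exact: nrm_ge0.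
have D20 : 0 <= (2 * D)^-1 by rewrite invr_ge0 mulr_ge0 // ltW.
have [n0|n0] := posnP n.
  apply: le_trans (mulr_ge0 D20 B0); rewrite le_eqVlt; apply/orP; left; apply/eqP.
  transitivity (complex.Re (0 : C)) => //; congr complex.Re.
  rewrite -[RHS](cmean_cst mI); congr cmean; apply/funext => g.
  rewrite -[RHS](cmean_cst mI); congr cmean; apply/funext => x.
  by rewrite formE big1 // => i; have := ltn_ord i; rewrite {2}n0.
have [irr|nirr] := pselect (irreducible_rep rho).
  have nt : nontrivial_rep rho.
    apply: contrapT => /forallNP tr.
    (* Any nonzero row is fixed by a trivial representation; the all-ones row is a convenient
       one. *)
    have /ff/rowP/(_ (Ordinal n0)) : forall g, const_mx (1 : C) *m rho g = const_mx 1 :> 'rV_n.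
      by move=> g; have /negP := tr g; rewrite negbK => /eqP ->; rewrite mulmx1.
    by rewrite !mxE => /eqP; rewrite oner_eq0.
  have Dn := qG (complex_rep_unitary rr) irr nt.
  apply: le_trans (coeff_irreducible mI mG linv rr irr ch cF) _.
  by rewrite ler_wpM2r // lef_pV2 ?posrE ?mulr_gt0 ?ltr0n // ler_wpM2l.
have [U [Ust U0 Uf]] : exists U : 'M[C]_n,
    [/\ forall g, stablemx U (rho g), U != 0 & ~~ row_full U].
  apply: contrapT => H; apply: nirr; split => // U Ust.
  have [->|U0] := eqVneq U 0; first by left.
  right; apply: contrapT => /negP Uf; apply: H; by exists U.
have [k1 [k2 [B1 [B2 [[k1n k2n] [B11 B22] B1U B2W BB]]]]] := isometry_complement U0 Uf.
have st1 g : (B1 *m rho g <= B1)%MS.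
  by rewrite B1U; apply: submx_trans (Ust g); rewrite submxMr // B1U.
have [c1 ff1 E1] := compress_rep rr ff B11 st1.
(* The complement is invariant because the adjoint of [rho g] is [rho g^-1], which preserves the
   span of [B1]. *)
have st2 g : (B2 *m rho g <= B2)%MS.
  rewrite B2W; apply/sub_kermxP; rewrite -mulmxA.
  have -> : rho g *m B1^t* = B1^t* *m (compress B1 rho g^-1%g)^t*.
    by rewrite -[rho g]trmxCK -!trmxC_mul -(complex_repV _ rr) E1.
  have /sub_kermxP B2B1 : (B2 <= kermx (B1^t*))%MS by rewrite B2W.
  by rewrite mulmxA B2B1 mul0mx.
have [c2 ff2 E2] := compress_rep rr ff B22 st2.
have rhoE g : rho g = B1^t* *m compress B1 rho g *m B1 + B2^t* *m compress B2 rho g *m B2.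
  rewrite -[LHS]mul1mx -BB mulmxDl -(mulmxA _ B1) -(mulmxA _ B2) E1 E2.
  by rewrite (mulmxA _ (compress B1 _ _)) (mulmxA _ (compress B2 _ _)).
have cjE k (B : 'M[C]_(k, n)) v : (cjmul B v)^T = v^T *m B^t*.
  by rewrite /cjmul trmx_mul map_trmx.
have ch1 := cvcont_mul B1 ch; have ch2 := cvcont_mul B2 ch.
have cF1 := cvcont_mul (map_mx Num.conj B1) cF.
have cF2 := cvcont_mul (map_mx Num.conj B2) cF.
have [c11 c1M c1U c1c] := c1; have [c21 c2M c2U c2c] := c2.
have coeffE : coeff I rho h F =
    coeff I (compress B1 rho) (fun x => B1 *m h x) (fun x => cjmul B1 (F x)) +
    coeff I (compress B2 rho) (fun x => B2 *m h x) (fun x => cjmul B2 (F x)).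
  have f1 := ccont_form c1c ch1 cF1; have f2 := ccont_form c2c ch2 cF2.
  rewrite /coeff -(cmeanD mI); last 2 first.
  - apply: (ccont_cmean mI (F := fun g x => _) f1).
  - apply: (ccont_cmean mI (F := fun g x => _) f2).
  congr cmean; apply/funext => g; rewrite -(cmeanD mI); last 2 first.
  - by apply: (ccont_comp f1 (h := fun x => (g, x))); cts.
  - by apply: (ccont_comp f2 (h := fun x => (g, x))); cts.
  congr cmean; apply/funext => x.
  rewrite !cjE rhoE; move: (compress B1 rho g) (compress B2 rho g) => s1 s2.
  by rewrite mulmxDr mulmxDl [LHS]mxE !mulmxA.
have nrmh x : nrm (B1 *m h x) + nrm (B2 *m h x) = nrm (h x).
  rewrite !nrmE -ReD !trmxC_mul; congr complex.Re.
  rewrite -!mulmxA (mulmxA (B1^t*)) (mulmxA (B2^t*)).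
  by rewrite -[LHS](mxE_add) -mulmxDr -mulmxDl BB mul1mx.
have BB' : B1^T *m map_mx Num.conj B1 + B2^T *m map_mx Num.conj B2 = 1%:M.
  transitivity (map_mx Num.conj (B1^t* *m B1 + B2^t* *m B2)); last by rewrite BB map_mx1.
  rewrite map_mxD !map_mxM; congr (_ + _); congr (_ *m _);
    by apply/matrixP => i j; rewrite !mxE; exact/esym/conjCK.
have cjtr k (B : 'M[C]_(k, n)) : (map_mx Num.conj B)^t* = B^T.
  by apply/matrixP => i j; rewrite !mxE conjCK.
have nrmF x : nrm (cjmul B1 (F x)) + nrm (cjmul B2 (F x)) = nrm (F x).
  rewrite !nrmE -ReD /cjmul !trmxC_mul !cjtr; congr complex.Re.
  rewrite -!mulmxA (mulmxA (B1^T)) (mulmxA (B2^T)).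
  by rewrite -[LHS](mxE_add) -mulmxDr -mulmxDl BB' mul1mx.
have := IH _ k1n _ _ _ c1 ff1 ch1 cF1.
have := IH _ k2n _ _ _ c2 ff2 ch2 cF2.
rewrite coeffE ReD.
have <- : I (fun x => nrm (B1 *m h x)) + I (fun x => nrm (B2 *m h x)) = I (fun x => nrm (h x)).
  rewrite -(meanD mI); [|exact: ct_nrm..].
  by congr I; apply/funext => x; rewrite nrmh.
have <- : I (fun x => nrm (cjmul B1 (F x))) + I (fun x => nrm (cjmul B2 (F x))) = I (fun x => nrm (F x)).
  rewrite -(meanD mI); [|exact: ct_nrm..].
  by congr I; apply/funext => x; rewrite nrmF.
rewrite !mulrDr; lra.
Qed.

End rep_bound.

(** * The mixing inequality *)

Section mixing.
Variables (R : realType) (G : topologicalGroupType) (I : (G -> R) -> R).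
Hypothesis mI : mean I.
Hypothesis mG : metrizable R G.
Hypothesis linv : forall g (f : G -> R), continuous f ->
  I (fun x => f (g * x)%g) = I f.
Variable D : R.
Hypothesis D0 : 0 < D.
Hypothesis qG : quasirandom D G.
Local Notation J := (mean2 I).
Local Notation C := R[i].
Let mJ := mean2_mean mI.

Definition complexify m n (A : 'M[R]_(m, n)) : 'M[C]_(m, n) := map_mx (real_complex R) A.

Lemma orthogonal_complex_rep n (r : G -> 'M[R]_n) : orthogonal_rep r ->
  complex_rep (fun g => complexify (r g)).
Proof.
move=> [r1 rM rU rc]; split.
- by rewrite /complexify r1 map_mx1.
- by move=> g h; rewrite /complexify rM map_mxM.
- move=> g; apply/unitarymxP; have <- : complexify (r g *m (r g)^T) = 1%:M.
    by rewrite rU /complexify map_mx1.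
  rewrite /complexify map_mxM; congr (_ *m _).
  by apply/matrixP => i j; rewrite !mxE; exact: conjc_real.
- move=> i j; split.
    by rewrite (_ : (fun g => _) = (fun g => r g i j)) //; apply/funext => g; rewrite mxE.
  by rewrite (_ : (fun g => _) = (fun=> 0)); [cts|apply/funext => g; rewrite mxE].
Qed.

Lemma complexify_fixed_free n (r : G -> 'M[R]_n) : fixed_free r ->
  fixed_free (fun g => complexify (r g)).
Proof.
move=> ff c hc.
have c1 : map_mx (@complex.Re R) c = 0.
  apply: ff => g; rewrite -[in RHS](hc g); apply/rowP => j; rewrite !mxE Re_sum.
  by apply: eq_bigr => i _; rewrite !mxE ReM /= mulr0 subr0.
have c2 : map_mx (@complex.Im R) c = 0.
  apply: ff => g; rewrite -[in RHS](hc g); apply/rowP => j; rewrite !mxE Im_sum.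
  by apply: eq_bigr => i _; rewrite !mxE ImM /= mulr0 add0r.
apply/rowP => j; rewrite mxE; apply: complex_eq.
  by have := congr1 (fun v : 'rV[R]_n => v 0 j) c1; rewrite !mxE.
by have := congr1 (fun v : 'rV[R]_n => v 0 j) c2; rewrite !mxE.
Qed.

Lemma orthogonal_coeff_bound n (r : G -> 'M[R]_n) (h F : 'I_n -> G -> R) :
  orthogonal_rep r -> fixed_free r -> (forall i, continuous (h i)) ->
  (forall i, continuous (F i)) ->
  I (fun g => I (fun x => \sum_i \sum_j F j x * r g j i * h i (g * x)%g)) <=
    (2 * D)^-1 * (I (fun x => \sum_i h i x ^+ 2) + I (fun x => \sum_i F i x ^+ 2)).
Proof.
move=> rr ff ch cF.
pose cv (h : 'I_n -> G -> R) x : 'cV[C]_n := complexify (\col_i h i x).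
have ccv h' : (forall i, continuous (h' i)) -> cvcont (cv h').
  move=> ch' i; split.
    by rewrite (_ : (fun x => _) = h' i) //; apply/funext => x; rewrite !mxE.
  by rewrite (_ : (fun x => _) = (fun=> 0)); [cts|apply/funext => x; rewrite !mxE].
have ncv h' x : nrm (cv h' x) = \sum_i h' i x ^+ 2.
  by apply: eq_bigr => i _; rewrite !mxE /nsq /= expr0n addr0.
have := coeff_bound mI mG linv D0 qG (orthogonal_complex_rep rr)
  (complexify_fixed_free ff) (ccv h ch) (ccv F cF).
congr (_ <= _ * (_ + _)) => /=; last first.
- by congr I; apply/funext => x; rewrite ncv.
- by congr I; apply/funext => x; rewrite ncv.
congr I; apply/funext => g; congr I; apply/funext => x.
have -> : (cv F x)^T *m complexify (r g) *m cv h (g * x)%g =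
    complexify ((\col_i F i x)^T *m r g *m \col_i h i (g * x)%g).
  by rewrite /cv /complexify map_trmx !map_mxM.
rewrite mxE /= mxE; apply: eq_bigr => i _; rewrite mxE mulr_suml mxE.
by apply: eq_bigr => j _; rewrite !mxE.
Qed.

(** Replace [H] by its approximation [P] from [rep_approx]. Substituting g^-1 y for y moves g onto
    the [f i], where it acts by the transpose of [r g], and the mean over y leaves the coefficients
    of [F]. This is the quantity in [orthogonal_coeff_bound], and Bessel's inequality bounds the
    norms of the coefficients. *)
Lemma mixing_centered (H F : G * G -> R) : continuous H -> continuous F ->
  (forall x, I (fun y => H (x, y)) = 0) ->
  I (fun g => J (fun p => H (g * p.1, p.2)%g * F (p.1, g * p.2)%g)) <=
    (2 * D)^-1 * (J (fun p => H p ^+ 2) + J (fun p => F p ^+ 2)).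
Proof.
move=> cH cF H0; rewrite -subr_le0.
have JF0 := mean_sq_ge0 mJ cF.
apply: (@le0_small _ _ (2^-1 * (1 + J (fun p => F p ^+ 2)))) => [|t t0 _].
  by rewrite mulr_ge0 ?invr_ge0 // addr_ge0.
have [n [f [r [of_ rr ff rE hP]]]] := rep_approx mI mG linv cH (exprn_gt0 2 t0) H0.
have [cf _] := of_.
pose h i x := I (fun y => H (x, y) * f i y).
pose Fc j x := I (fun y => F (x, y) * f j y).
have ch i : continuous (h i) by rewrite /h; cts.
have cFc i : continuous (Fc i) by rewrite /Fc; cts.
pose P (p : G * G) := \sum_i h i p.1 * f i p.2.
have cP : continuous P by rewrite /P; cts.
have bh : I (fun x => \sum_i h i x ^+ 2) <= J (fun p => H p ^+ 2).
  apply: (le_mean mI); [by cts|by cts|move=> x].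
  by apply: (bessel mI of_ (u := fun y => H (x, y))); cts.
have bF : I (fun x => \sum_i Fc i x ^+ 2) <= J (fun p => F p ^+ 2).
  apply: (le_mean mI); [by cts|by cts|move=> x].
  by apply: (bessel mI of_ (u := fun y => F (x, y))); cts.
have rV g i j : r g^-1%g i j = r g j i.
  have [r1 rM rU _] := rr.
  have rgg : (r g)^T *m r g = 1%:M by apply: mulmx1C.
  have : r g^-1%g = (r g)^T.
    by rewrite -[LHS]mul1mx -rgg -mulmxA -rM mulgV r1 mulmx1.
  by move=> ->; rewrite mxE.
have E1 : I (fun g => J (fun p => P (g * p.1, p.2)%g * F (p.1, g * p.2)%g)) =
    I (fun g => I (fun x => \sum_i \sum_j Fc j x * r g j i * h i (g * x)%g)).
  congr I; apply/funext => g; congr I; apply/funext => x.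
  rewrite -(linv g^-1%g (f := fun y => P (g * x, y)%g * F (x, g * y)%g)); last by cts.
  transitivity (I (fun y => \sum_i \sum_j (r g j i * h i (g * x)%g) * (F (x, y) * f j y))).
    congr I; apply/funext => y; rewrite /P /= mulVKg mulr_suml.
    apply: eq_bigr => i _; rewrite rE mulr_sumr mulr_suml.
    by apply: eq_bigr => j _; rewrite rV; ring.
  rewrite (mean_sum mI); last by cts.
  apply: eq_bigr => i _; rewrite (mean_sum mI); last by cts.
  apply: eq_bigr => j _; rewrite (meanZ mI); last by cts.
  by rewrite -/(Fc j x); ring.
have := orthogonal_coeff_bound rr ff ch cFc; rewrite -E1 => bP.
have rc i j : continuous (fun g => r g i j) by have [_ _ _] := rr; apply.
(* The weighted inequality 2 a b <= a^2/t + t b^2 suits the squared approximation error, which is at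
   most t^2. *)
have bHP : I (fun g => J (fun p => (H (g * p.1, p.2)%g - P (g * p.1, p.2)%g) * F (p.1, g * p.2)%g)) <=
    2^-1 * (t + t * J (fun p => F p ^+ 2)).
  apply: (mean_le_cst mI); first by cts.
  move=> g.
  apply: (@le_trans _ _ (J (fun p => 2^-1 * (t^-1 * (H (g * p.1, p.2)%g - P (g * p.1, p.2)%g) ^+ 2
     + t * F (p.1, g * p.2)%g ^+ 2)))).
    apply: (le_mean mJ); [by cts|by cts|move=> p].
    set a := _ - _; set b := F _.
    have -> : 2^-1 * (t^-1 * a ^+ 2 + t * b ^+ 2) = a * b + (2 * t)^-1 * (a - t * b) ^+ 2.
      by field; rewrite gt_eqF.
    by rewrite lerDl mulr_ge0 ?sqr_ge0 // invr_ge0 mulr_ge0 // ltW.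
  rewrite (meanZ mJ); last by cts.
  rewrite ler_wpM2l ?invr_ge0 // (meanD mJ); [|by cts..].
  rewrite (meanZ mJ); last by cts.
  rewrite (meanZ mJ); last by cts.
  rewrite (mean2_linv1 mI linv g (F := fun p => (H p - P p) ^+ 2)); last by cts.
  rewrite (mean2_linv2 mI linv g (F := fun p => F p ^+ 2)); last by cts.
  by rewrite lerD2r ler_pdivrMl // -expr2.
have -> : I (fun g => J (fun p => H (g * p.1, p.2)%g * F (p.1, g * p.2)%g)) =
  I (fun g => J (fun p => P (g * p.1, p.2)%g * F (p.1, g * p.2)%g)) +
  I (fun g => J (fun p => (H (g * p.1, p.2)%g - P (g * p.1, p.2)%g) * F (p.1, g * p.2)%g)).
  rewrite -(meanD mI); [|by cts..].
  congr I; apply/funext => g; rewrite -(meanD mJ); [|by cts..].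
  by congr J; apply/funext => p; ring.
have D20 : 0 <= (2 * D)^-1 by rewrite invr_ge0 mulr_ge0 // ltW.
have := ler_wpM2l D20 (lerD bh bF).
lra.
Qed.

(** The part [H0] of [H] that depends on x alone contributes exactly [J H * J F] by invariance, and
    the rest is centered. The lower bound is the centered case for [- H1]. *)
Lemma mixing (H F : G * G -> R) : continuous H -> continuous F ->
  `|I (fun g => J (fun p => H (g * p.1, p.2)%g * F (p.1, g * p.2)%g)) - J H * J F| <=
    (2 * D)^-1 * (J (fun p => H p ^+ 2) + J (fun p => F p ^+ 2)).
Proof.
move=> cH cF.
pose H0 x := I (fun y => H (x, y)).
have cH0 : continuous H0 by rewrite /H0; cts.
pose H1 p := H p - H0 p.1.
have cH1 : continuous H1 by rewrite /H1; cts.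
have H10 x : I (fun y => H1 (x, y)) = 0.
  by rewrite /H1 /= (meanB mI); [rewrite (mean_cst mI) subrr|cts..].
have D20 : 0 <= (2 * D)^-1 by rewrite invr_ge0 mulr_ge0 // ltW.
have E0 : I (fun g => J (fun p => H0 (g * p.1)%g * F (p.1, g * p.2)%g)) = J H * J F.
  transitivity (I (fun g => I (fun x => H0 (g * x)%g * I (fun y => F (x, y))))).
    congr I; apply/funext => g; congr I; apply/funext => x /=.
    rewrite (meanZ mI); last by cts.
    by rewrite (linv g (f := fun y => F (x, y))) //; cts.
  rewrite (mean_swap mI mG); last by cts.
  rewrite /mean2 -(meanZ mI); last by cts.
  congr I; apply/funext => x; rewrite (meanZr mI); last by cts.
  by rewrite (rinv mI mG linv).
have N1 : J (fun p => H1 p ^+ 2) <= J (fun p => H p ^+ 2).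
  apply: (le_mean mI); [by cts|by cts|move=> x].
  rewrite (_ : (fun y => _) = (fun y => H (x, y) ^+ 2 + (- 2 * H0 x * H (x, y) + H0 x ^+ 2))).
    rewrite (meanD mI); [|by cts..]; rewrite (meanD mI); [|by cts..].
    rewrite (meanZ mI); [|by cts]; rewrite (mean_cst mI) -/(H0 x).
    by have := sqr_ge0 (H0 x); lra.
  by apply/funext => y; rewrite /H1 /=; ring.
have -> : I (fun g => J (fun p => H (g * p.1, p.2)%g * F (p.1, g * p.2)%g)) =
    J H * J F + I (fun g => J (fun p => H1 (g * p.1, p.2)%g * F (p.1, g * p.2)%g)).
  rewrite -E0 -(meanD mI); [|by cts..].
  congr I; apply/funext => g; rewrite -(meanD mJ); [|by cts..].
  by congr J; apply/funext => p; rewrite /H1 /=; ring.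
rewrite [J H * J F + _]addrC addrK.
have up := mixing_centered cH1 cF H10.
have := @mixing_centered (fun p => - H1 p) F _ cF _.
have -> : I (fun g => J (fun p => - H1 (g * p.1, p.2)%g * F (p.1, g * p.2)%g)) =
    - I (fun g => J (fun p => H1 (g * p.1, p.2)%g * F (p.1, g * p.2)%g)).
  rewrite -(meanN mI); last by cts.
  congr I; apply/funext => g; rewrite -(meanN mJ); last by cts.
  by congr J; apply/funext => p; ring.
rewrite (_ : (fun p => (- H1 p) ^+ 2) = (fun p => H1 p ^+ 2)); last first.
  by apply/funext => p; rewrite sqrrN.
move=> dn; rewrite ler_norml.
have {}dn := dn (ct_opp cH1) _.
have := ler_wpM2l D20 (lerD N1 (lexx (J (fun p => F p ^+ 2)))).
have : forall x, I (fun y => - H1 (x, y)) = 0.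
  by move=> x; rewrite (meanN mI) ?H10 ?oppr0 //; cts.
by move=> /dn; lra.
Qed.

End mixing.

(** * Correlation bounds derived from mixing *)

Section corners.
Variables (R : realType) (G : topologicalGroupType) (I : (G -> R) -> R).
Hypothesis mI : mean I.
Hypothesis mG : metrizable R G.
Hypothesis linv : forall g (f : G -> R), continuous f ->
  I (fun x => f (g * x)%g) = I f.
Variable D : R.
Hypothesis D0 : 0 < D.
Hypothesis qG : quasirandom D G.
Local Notation J := (mean2 I).
Let mJ := mean2_mean mI.

Lemma mean2_mean2_exchange (F : G * G -> G * G -> R) : continuous (fun q => F q.1 q.2) ->
  J (fun p => J (fun q => F p q)) = J (fun q => J (fun p => F p q)).
Proof.
move=> cF; rewrite {1}/mean2.
transitivity (I (fun x => J (fun q => I (fun y => F (x, y) q)))).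
  congr I; apply/funext => x.
  by rewrite (mean2_exchange mI mG (F := fun y q => F (x, y) q)) //; cts.
by rewrite (mean2_exchange mI mG (F := fun x q => I (fun y => F (x, y) q))) //; cts.
Qed.

(** Squaring duplicates y into t and s. For fixed t and s the mean over g is the one in [mixing] for
    H(x,y) = v(x,t) u(y,s) and F(x,y) = u(x,t) v(y,s), and [J H = 0] because [v] is centered. *)
Lemma corr_bound (u v : G * G -> R) : continuous u -> continuous v ->
  (forall y, I (fun x => v (x, y)) = 0) ->
  I (fun g => J (fun p => u p * v (g * p.1, p.2)%g) ^+ 2) <=
    D^-1 * (J (fun p => u p ^+ 2) * J (fun p => v p ^+ 2)).
Proof.
move=> cu cv v0.
pose A g t := I (fun x => u (x, t) * v (g * x, t)%g).
have cA : continuous (fun p => A p.1 p.2) by rewrite /A; cts.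
have cAg g : continuous (A g) by rewrite /A; cts.
have AE g : J (fun p => u p * v (g * p.1, p.2)%g) ^+ 2 = J (fun q => A g q.1 * A g q.2).
  rewrite (mean2_swap mI mG) /=; last by cts.
  rewrite -/(A g) expr2 /mean2 -(meanZr mI); last by cts.
  by congr I; apply/funext => t; rewrite -(meanZ mI) //; cts.
under eq_fun do rewrite AE.
rewrite (mean2_exchange mI mG); last by cts.
pose U t := I (fun x => u (x, t) ^+ 2).
pose V t := I (fun x => v (x, t) ^+ 2).
have cU : continuous U by rewrite /U; cts.
have cV : continuous V by rewrite /V; cts.
have tensor (a b : G -> R) : continuous a -> continuous b ->
    J (fun p => a p.1 * b p.2) = I a * I b.
  move=> ca cb; rewrite /mean2 /= -(meanZr mI) //.
  by congr I; apply/funext => x; rewrite (meanZ mI) //; cts.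
apply: (@le_trans _ _ (J (fun q => (2 * D)^-1 * (V q.1 * U q.2 + U q.1 * V q.2)))).
  apply: (le_mean mJ); [by cts|by cts|move=> [t s] /=].
  pose H (p : G * G) := v (p.1, t) * u (p.2, s).
  pose F (p : G * G) := u (p.1, t) * v (p.2, s).
  have cH : continuous H by rewrite /H; cts.
  have cF : continuous F by rewrite /F; cts.
  have JH : J H = 0.
    rewrite /H (tensor (fun x => v (x, t)) (fun x => u (x, s))); [|by cts..].
    by rewrite v0 mul0r.
  have JH2 : J (fun p => H p ^+ 2) = V t * U s.
    rewrite -(tensor (fun x => v (x, t) ^+ 2) (fun x => u (x, s) ^+ 2)); [|by cts..].
    by congr J; apply/funext => p; rewrite exprMn.
  have JF2 : J (fun p => F p ^+ 2) = U t * V s.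
    rewrite -(tensor (fun x => u (x, t) ^+ 2) (fun x => v (x, s) ^+ 2)); [|by cts..].
    by congr J; apply/funext => p; rewrite exprMn.
  have := mixing mI mG linv D0 qG cH cF; rewrite JH mul0r subr0 JH2 JF2.
  apply: le_trans; apply: le_trans (ler_norm _); rewrite le_eqVlt; apply/orP; left.
  apply/eqP; congr I; apply/funext => g; rewrite /A.
  rewrite -(tensor (fun x => u (x, t) * v (g * x, t)%g) (fun y => u (y, s) * v (g * y, s)%g)); [|by cts..].
  by congr J; apply/funext => p; rewrite /H /F /=; ring.
rewrite (meanZ mJ); last by cts.
rewrite (meanD mJ); [|by cts..].
rewrite (tensor V U) // (tensor U V) //.
rewrite (mean2_swap mI mG (F := fun p => u p ^+ 2)); last by cts.
rewrite (mean2_swap mI mG (F := fun p => v p ^+ 2)); last by cts.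
rewrite -/U -/V invfM le_eqVlt; apply/orP; left; apply/eqP; field.
by rewrite gt_eqF.
Qed.

Lemma mean2_flip (F : G * G -> R) : continuous F -> J (fun p => F (p.2, p.1)) = J F.
Proof. by move=> cF; rewrite [RHS](mean2_swap mI mG). Qed.

Lemma corr_bound2 (u v : G * G -> R) : continuous u -> continuous v ->
  (forall x, I (fun y => v (x, y)) = 0) ->
  I (fun g => J (fun p => u p * v (p.1, g * p.2)%g) ^+ 2) <=
    D^-1 * (J (fun p => u p ^+ 2) * J (fun p => v p ^+ 2)).
Proof.
move=> cu cv v0.
have := @corr_bound (fun p => u (p.2, p.1)) (fun p => v (p.2, p.1)) _ _ v0.
rewrite (mean2_flip (F := fun p => u p ^+ 2)); last by cts.
rewrite (mean2_flip (F := fun p => v p ^+ 2)); last by cts.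
move=> H; apply: le_trans (H _ _); [|by cts..].
rewrite le_eqVlt; apply/orP; left; apply/eqP; congr I; apply/funext => g.
congr (_ ^+ 2).
by rewrite -[LHS]mean2_flip //; cts.
Qed.

(** Inverting both g and the first variable turns right translations into left ones. *)
Lemma corr_bound_right (u v : G * G -> R) : continuous u -> continuous v ->
  (forall y, I (fun x => v (x, y)) = 0) ->
  I (fun g => J (fun p => u p * v (p.1 * g, p.2)%g) ^+ 2) <=
    D^-1 * (J (fun p => u p ^+ 2) * J (fun p => v p ^+ 2)).
Proof.
move=> cu cv v0.
have Jinv (F : G * G -> R) : continuous F -> J (fun p => F (p.1^-1, p.2)%g) = J F.
  move=> cF.
  by rewrite /mean2 /= (mean_inv mI mG linv (f := fun x => I (fun y => F (x, y)))) //; cts.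
have := @corr_bound (fun p => u (p.1^-1, p.2)%g) (fun p => v (p.1^-1, p.2)%g) _ _ _.
rewrite (Jinv (fun p => u p ^+ 2)); last by cts.
rewrite (Jinv (fun p => v p ^+ 2)); last by cts.
move=> H; apply: le_trans (H _ _ _); [|by cts..|]; last first.
  by move=> y; rewrite (mean_inv mI mG linv (f := fun x => v (x, y))) //; cts.
rewrite -(mean_inv mI mG linv); last by cts.
rewrite le_eqVlt; apply/orP; left; apply/eqP; congr I; apply/funext => g.
congr (_ ^+ 2); rewrite -[LHS]Jinv; last by cts.
by congr J; apply/funext => p; rewrite /= invgM.
Qed.

Lemma sq_le1 (a : R) : `|a| <= 1 -> a ^+ 2 <= 1.
Proof. by move=> /sqr_le_norm; rewrite expr1n. Qed.

Lemma norm_mean_le1 (f : G -> R) : continuous f -> (forall x, `|f x| <= 1) -> `|I f| <= 1.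
Proof. exact: (mean_norm_le mI). Qed.

(** Decompose h = c + a'(y) + r(x,y), where a' has mean zero and r has mean zero in x. The cross
    terms vanish, so [al] minus c^2 is the sum of the autocorrelations [b1] of a' and [b2] of r.
    Each has squared norm at most 1/D by [corr_bound_right], and the square of the sum costs a
    factor 2 on both. *)
Lemma autocorr_variance (h : G * G -> R) : continuous h -> (forall p, `|h p| <= 1) ->
  let al q := J (fun p => h p * h (p.1 * q.1, p.2 * q.2)%g) in
  J al = J h ^+ 2 /\ J (fun q => (al q - J h ^+ 2) ^+ 2) <= 4 / D.
Proof.
move=> ch h1 al; have cal : continuous al by rewrite /al; cts.
split.
  rewrite /al mean2_mean2_exchange; last by cts.
  rewrite expr2 -(meanZr mJ) //; congr J; apply/funext => p.
  rewrite (meanZ mJ); last by cts.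
  by rewrite (mean2_linv mI linv).
pose c := J h.
pose a y := I (fun x => h (x, y)).
have ca : continuous a by rewrite /a; cts.
have a1 y : `|a y| <= 1 by apply: norm_mean_le1 => //; cts.
have Ia : I a = c by rewrite /c (mean2_swap mI mG).
pose r (p : G * G) := h p - a p.2.
have cr : continuous r by rewrite /r; cts.
have r0 y : I (fun x => r (x, y)) = 0.
  by rewrite /r /= (meanB mI); [rewrite (mean_cst mI) subrr|cts..].
pose a' y := a y - c.
have ca' : continuous a' by rewrite /a'; cts.
have a'0 : I a' = 0 by rewrite /a' (meanB mI) ?(mean_cst mI) ?Ia ?subrr //; cts.
pose b1 t := I (fun y => a' y * a' (y * t)%g).
pose b2 (q : G * G) := J (fun p => r p * r (p.1 * q.1, p.2 * q.2)%g).
have cb1 : continuous b1 by rewrite /b1; cts.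
have cb2 : continuous b2 by rewrite /b2; cts.
have E q : al q - J h ^+ 2 = b1 q.2 + b2 q.
  suff -> : al q = (c ^+ 2 + b1 q.2) + b2 q by rewrite -/c; ring.
  have -> : c ^+ 2 + b1 q.2 = I (fun y => a y * a (y * q.2)%g).
    rewrite (_ : (fun y => a y * a (y * q.2)%g) = (fun y => (c ^+ 2 + a' y * a' (y * q.2)%g)
        + (c * a' y + c * a' (y * q.2)%g))); last by apply/funext => y; rewrite /a'; ring.
    rewrite (meanD mI); [|by cts..]; rewrite (meanD mI); [|by cts..].
    rewrite (meanD mI); [|by cts..]; rewrite (mean_cst mI) -/(b1 _).
    rewrite (meanZ mI) // (meanZ mI); last by cts.
    by rewrite (rinv mI mG linv) // a'0 !mulr0 !addr0.
  rewrite /al (mean2_swap mI mG) /=; last by cts.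
  rewrite /b2 (mean2_swap mI mG) /=; last by cts.
  rewrite -(meanD mI); [|by cts..]; congr I; apply/funext => y.
  rewrite (_ : (fun x => h (x, y) * _) = (fun x => (a y * a (y * q.2)%g + r (x, y) * r (x * q.1, y * q.2)%g)
     + (a y * r (x * q.1, y * q.2)%g + r (x, y) * a (y * q.2)%g))); last first.
    by apply/funext => x; rewrite /r /=; ring.
  rewrite (meanD mI); [|by cts..]; rewrite (meanD mI); [|by cts..].
  rewrite (meanD mI); [|by cts..]; rewrite (mean_cst mI) (meanZ mI); last by cts.
  rewrite (rinv mI mG linv q.1 (f := fun x => r (x, y * q.2)%g)); last by cts.
  rewrite (meanZr mI); last by cts.
  by rewrite !r0 mulr0 mul0r !addr0.
have JR : J (fun p => r p ^+ 2) <= 1.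
  rewrite (mean2_swap mI mG); last by cts.
  apply: (mean_le_cst mI); first by cts.
  move=> y; apply: (@le_trans _ _ (I (fun x => h (x, y) ^+ 2))); last first.
    by apply: (mean_le_cst mI) => [|x]; [cts|exact: sq_le1].
  rewrite (_ : (fun x => h (x, y) ^+ 2) = (fun x => r (x, y) ^+ 2 + (2 * a y * r (x, y) + a y ^+ 2))).
    rewrite (meanD mI); [|by cts..]; rewrite (meanD mI); [|by cts..].
    rewrite (meanZ mI); [|by cts]; rewrite (mean_cst mI) r0 mulr0 add0r.
    by rewrite lerDl sqr_ge0.
  by apply/funext => x; rewrite /r /=; ring.
have IA : I (fun y => a' y ^+ 2) <= 1.
  apply: (@le_trans _ _ (I (fun y => a y ^+ 2))); last first.
    by apply: (mean_le_cst mI) => [|x]; [cts|exact: sq_le1].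
  rewrite (_ : (fun y => a y ^+ 2) = (fun x => a' x ^+ 2 + (2 * c * a' x + c ^+ 2))).
    rewrite (meanD mI); [|by cts..]; rewrite (meanD mI); [|by cts..].
    rewrite (meanZ mI); [|by cts]; rewrite (mean_cst mI) a'0 mulr0 add0r.
    by rewrite lerDl sqr_ge0.
  by apply/funext => x; rewrite /a'; ring.
have D1 : 0 <= D^-1 by rewrite invr_ge0 ltW.
have B1 : I (fun t => b1 t ^+ 2) <= D^-1.
  have ca'1 : continuous (fun p : G * G => a' p.1) by cts.
  have cstI (f : G -> R) : I (fun x => I (fun=> f x)) = I f.
    by congr I; apply/funext => x; rewrite (mean_cst mI).
  have H := corr_bound_right ca'1 ca'1 (fun=> a'0).
  apply: (@le_trans _ _ (D^-1 * (I (fun y => a' y ^+ 2) * I (fun y => a' y ^+ 2)))).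
    rewrite /mean2 /= cstI in H; apply: le_trans H.
    rewrite le_eqVlt; apply/orP; left; apply/eqP; congr I; apply/funext => g.
    by rewrite cstI.
  rewrite -[leRHS]mulr1 ler_wpM2l // -[leRHS]mulr1.
  by apply: ler_pM => //; exact: (mean_sq_ge0 mI).
have B2 : J (fun q => b2 q ^+ 2) <= D^-1.
  rewrite (mean2_swap mI mG); last by cts.
  apply: (mean_le_cst mI); first by cts.
  move=> t.
  (* With the shift [t] of the second variable frozen inside [v], which stays centered in x, only
     the right translation of the first variable remains. *)
  pose v (p : G * G) := r (p.1, p.2 * t)%g.
  have cv : continuous v by rewrite /v; cts.
  have := corr_bound_right cr cv (fun y => r0 (y * t)%g).
  move=> H; apply: le_trans H _; rewrite -[leRHS]mulr1 ler_wpM2l // -[leRHS]mulr1.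
  apply: ler_pM => //; try by apply: (mean_sq_ge0 mJ).
  rewrite (_ : (fun p => v p ^+ 2) = (fun p => r (p.1 * 1, p.2 * t)%g ^+ 2)); last first.
    by apply/funext => p; rewrite mulg1.
  by rewrite (mean2_rinv mI mG linv 1%g t (F := fun p => r p ^+ 2)) //; cts.
apply: (@le_trans _ _ (J (fun q => 2 * b1 q.2 ^+ 2 + 2 * b2 q ^+ 2))).
  apply: (le_mean mJ); [by cts|by cts|move=> q]; rewrite E.
  by have := sqr_ge0 (b1 q.2 - b2 q); rewrite !expr2; lra.
rewrite (meanD mJ); [|by cts..].
rewrite (meanZ mJ); last by cts.
rewrite (meanZ mJ); last by cts.
rewrite {1}/mean2 /= (mean_cst mI); lra.
Qed.

End corners.

(** * The average number of corners *)

Section corner_average.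
Variables (R : realType) (G : topologicalGroupType) (I : (G -> R) -> R).
Hypothesis mI : mean I.
Hypothesis mG : metrizable R G.
Hypothesis linv : forall g (f : G -> R), continuous f ->
  I (fun x => f (g * x)%g) = I f.
Variable D : R.
Hypothesis D0 : 0 < D.
Hypothesis qG : quasirandom D G.
Local Notation J := (mean2 I).
Let mJ := mean2_mean mI.

Lemma norm_mul_le1 (a b : R) : `|a| <= 1 -> `|b| <= 1 -> `|a * b| <= 1.
Proof. by move=> a1 b1; rewrite normrM; apply: mulr_ile1. Qed.

(** Write the square as a mean over p and a right shift q. Right shifts commute with left
    multiplication by g, so for fixed q [mixing] applies to h(p) h(pq) and f(p) f(pq) and costs 1/D.
    What remains is the mean of the product of the autocorrelations of [h] and [f], which by
    [autocorr_variance] exceeds the product of their means by at most 4/D. *)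
Lemma twisted_corr (h f : G * G -> R) : continuous h -> continuous f ->
  (forall p, `|h p| <= 1) -> (forall p, `|f p| <= 1) ->
  I (fun g => J (fun p => h (g * p.1, p.2)%g * f (p.1, g * p.2)%g) ^+ 2) <=
    (J h * J f) ^+ 2 + 5 / D.
Proof.
move=> ch cf h1 f1.
pose alh q := J (fun p => h p * h (p.1 * q.1, p.2 * q.2)%g).
pose alf q := J (fun p => f p * f (p.1 * q.1, p.2 * q.2)%g).
have [Jalh Valh] := autocorr_variance mI mG linv D0 qG ch h1.
have [Jalf Valf] := autocorr_variance mI mG linv D0 qG cf f1.
rewrite -/alh -/alf in Jalh Valh Jalf Valf.
have calh : continuous alh by rewrite /alh; cts.
have calf : continuous alf by rewrite /alf; cts.
pose Psi g p := h (g * p.1, p.2)%g * f (p.1, g * p.2)%g.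
have cPsi : continuous (fun q : G * (G * G) => Psi q.1 q.2) by rewrite /Psi; cts.
have cPsig g : continuous (Psi g) by rewrite /Psi; cts.
have sqE g : J (Psi g) ^+ 2 =
    J (fun q => J (fun p => Psi g p * Psi g (p.1 * q.1, p.2 * q.2)%g)).
  rewrite (mean2_mean2_exchange mI mG); last by cts.
  rewrite expr2 -(meanZr mJ) //; congr J; apply/funext => p.
  rewrite (meanZ mJ); last by cts.
  by rewrite (mean2_linv mI linv).
under eq_fun do rewrite sqE.
rewrite (mean2_exchange mI mG); last by cts.
apply: (@le_trans _ _ (J (fun q => alh q * alf q + D^-1))).
  apply: (le_mean mJ); [by cts|by cts|move=> q].
  pose H p := h p * h (p.1 * q.1, p.2 * q.2)%g.
  pose F p := f p * f (p.1 * q.1, p.2 * q.2)%g.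
  have cH : continuous H by rewrite /H; cts.
  have cF : continuous F by rewrite /F; cts.
  have JH2 : J (fun p => H p ^+ 2) <= 1.
    apply: (mean_le_cst mJ); first by cts.
    by move=> p; apply: sq_le1; apply: norm_mul_le1.
  have JF2 : J (fun p => F p ^+ 2) <= 1.
    apply: (mean_le_cst mJ); first by cts.
    by move=> p; apply: sq_le1; apply: norm_mul_le1.
  have := mixing mI mG linv D0 qG cH cF.
  have -> : I (fun g => J (fun p => H (g * p.1, p.2)%g * F (p.1, g * p.2)%g)) =
      I (fun g => J (fun p => Psi g p * Psi g (p.1 * q.1, p.2 * q.2)%g)).
    congr I; apply/funext => g; congr J; apply/funext => p.
    by rewrite /H /F /Psi /= !mulgA; ring.
  have D1 : 0 <= (2 * D)^-1 by rewrite invr_ge0 mulr_ge0 // ltW.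
  have D2 : (2 * D)^-1 * (1 + 1) = D^-1 by field; rewrite gt_eqF.
  have := ler_wpM2l D1 (lerD JH2 JF2); rewrite D2 -/(alh q) -/(alf q) ler_norml.
  lra.
rewrite (meanD mJ); [|by cts..]; rewrite (mean_cst mJ).
suff : J (fun q => alh q * alf q) <= (J h * J f) ^+ 2 + 4 / D by lra.
(* The product of the deviations of [alh] and [alf] from their means is at most half the sum of the
   squares. *)
apply: (@le_trans _ _ (J (fun q => (J h ^+ 2 * alf q + J f ^+ 2 * alh q) + (- (J h * J f) ^+ 2
   + 2^-1 * ((alh q - J h ^+ 2) ^+ 2 + (alf q - J f ^+ 2) ^+ 2))))).
  apply: (le_mean mJ); [by cts|by cts|move=> q].
  have := sqr_ge0 ((alh q - J h ^+ 2) - (alf q - J f ^+ 2)).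
  rewrite exprMn; move: (alh q) (alf q) (J h ^+ 2) (J f ^+ 2) => a b c d.
  by rewrite !expr2; lra.
rewrite (meanD mJ); [|by cts..]; rewrite (meanD mJ); [|by cts..].
rewrite (meanD mJ); [|by cts..]; rewrite (mean_cst mJ).
rewrite (meanZ mJ) // (meanZ mJ) // (meanZ mJ); last by cts.
rewrite (meanD mJ); [|by cts..].
by rewrite exprMn Jalh Jalf; lra.
Qed.

(** * Corners weighted by a continuous function with values in [0,1] *)

Section unit_interval.
Variable f : G * G -> R.
Hypothesis cf : continuous f.
Hypothesis f0 : forall p, 0 <= f p.
Hypothesis f1 : forall p, f p <= 1.

Definition fiber1 y := I (fun x => f (x, y)).
Definition fiber2 x := I (fun y => f (x, y)).
Local Notation a := fiber1.
Local Notation b := fiber2.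

Lemma ct_fiber1 : continuous a. Proof. by rewrite /fiber1; cts. Qed.
Lemma ct_fiber2 : continuous b. Proof. by rewrite /fiber2; cts. Qed.
Let ca := ct_fiber1.
Let cb := ct_fiber2.

Lemma fiber1_01 y : 0 <= a y <= 1.
Proof.
by apply/andP; split; [apply: (mean_ge_cst mI)|apply: (mean_le_cst mI)]; rewrite //; cts.
Qed.

Lemma fiber2_01 x : 0 <= b x <= 1.
Proof.
by apply/andP; split; [apply: (mean_ge_cst mI)|apply: (mean_le_cst mI)]; rewrite //; cts.
Qed.

Let nf p : `|f p| <= 1. Proof. by rewrite ger0_norm. Qed.

Let h (p : G * G) := f p - a p.2.
Let ch : continuous h. Proof. by rewrite /h; cts. Qed.
Let nh p : `|h p| <= 1.
Proof.
have := fiber1_01 p.2; have := f0 p; have := f1 p.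
by rewrite ler_norml /h => h1 h2 /andP[h3 h4]; apply/andP; split; lra.
Qed.
Let h0 y : I (fun x => h (x, y)) = 0.
Proof. by rewrite /h /= (meanB mI); [rewrite (mean_cst mI) subrr|cts..]. Qed.

Let Psi g p := h (g * p.1, p.2)%g * f (p.1, g * p.2)%g.
Let S g := J (fun p => f p * Psi g p).
Let cPsi : continuous (fun q : G * (G * G) => Psi q.1 q.2).
Proof. by rewrite /Psi; cts. Qed.
Let cPsig g : continuous (Psi g). Proof. by rewrite /Psi; cts. Qed.
Let cS : continuous S. Proof. by rewrite /S; cts. Qed.

Let JD (u : G * G -> R) : continuous u -> (forall p, `|u p| <= 1) ->
  0 <= J (fun p => u p ^+ 2) <= 1.
Proof.
move=> cu u1; rewrite (mean_sq_ge0 mJ) //=.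
by apply: (mean_le_cst mJ) => [|p]; [cts|exact: sq_le1].
Qed.

(** Let X be the mean of S^2. Cauchy-Schwarz removes [f], giving X^2 <= J(Y^2); a second use removes
    S(g) S(k), giving J(Y^2)^2 <= X^2 Wtot. Hence X^2 <= Wtot, the mean square of the correlations
    of Psi_g with Psi_k. Replacing k by kg turns these into the quantities of [twisted_corr] for
    [hk] and [fk]. *)
Lemma error_term_bound : I (fun g => S g ^+ 2) ^+ 2 <= 6 / D.
Proof.
have D1 : 0 <= D^-1 by rewrite invr_ge0 ltW.
pose W g k := J (fun p => Psi g p * Psi k p).
have cW : continuous (fun q => W q.1 q.2) by rewrite /W; cts.
have cWg g : continuous (W g) by rewrite /W; cts.
pose Wtot := I (fun g => I (fun k => W g k ^+ 2)).
pose X := I (fun g => S g ^+ 2).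
have X0 : 0 <= X by exact: (mean_sq_ge0 mI).
pose Y p := I (fun g => S g * Psi g p).
have cY : continuous Y by rewrite /Y; cts.
have XE : X = J (fun p => f p * Y p).
  transitivity (I (fun g => J (fun p => f p * (S g * Psi g p)))).
    congr I; apply/funext => g; rewrite expr2 {2}/S -(meanZ mJ); last by cts.
    by congr J; apply/funext => p; ring.
  rewrite (mean2_exchange mI mG); last by cts.
  by congr J; apply/funext => p; rewrite (meanZ mI) //; cts.
have YE : J (fun p => Y p ^+ 2) = J (fun q => (S q.1 * S q.2) * W q.1 q.2).
  transitivity (J (fun p => J (fun q => (S q.1 * S q.2) * (Psi q.1 p * Psi q.2 p)))).
    congr J; apply/funext => p; rewrite expr2 {1}/Y -(meanZr mI); last by cts.
    congr I; apply/funext => g; rewrite /Y -(meanZ mI); last by cts.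
    by congr I; apply/funext => k; ring.
  rewrite (mean2_mean2_exchange mI mG); last by cts.
  by congr J; apply/funext => q; rewrite (meanZ mJ) //; cts.
have XY : X ^+ 2 <= J (fun p => Y p ^+ 2).
  rewrite {1}XE; apply: le_trans (mean_CS mJ cf cY) _.
  have /andP[_ h2] := JD cf nf.
  by rewrite -[leRHS]mul1r; apply: ler_wpM2r => //; exact: (mean_sq_ge0 mJ).
have YW : J (fun p => Y p ^+ 2) ^+ 2 <= X ^+ 2 * Wtot.
  rewrite YE; apply: le_trans (mean_CS mJ (f := fun q => S q.1 * S q.2) _ cW) _; first by cts.
  rewrite le_eqVlt; apply/orP; left; apply/eqP; congr (_ * _).
  rewrite expr2 {1}/X -(meanZr mI); last by cts.
  congr I; apply/funext => g; rewrite /X -(meanZ mI); last by cts.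
  by congr I; apply/funext => k; rewrite exprMn.
have Wle : Wtot <= 6 / D.
  have -> : Wtot = I (fun k => I (fun g => W g (k * g)%g ^+ 2)).
    rewrite (mean_swap mI mG); last by cts.
    congr I; apply/funext => g.
    by rewrite (rinv mI mG linv g (f := fun k => W g k ^+ 2)) //; cts.
  pose hk k p := h p * h (k * p.1, p.2)%g.
  pose fk k p := f p * f (p.1, k * p.2)%g.
  have chk k : continuous (hk k) by rewrite /hk; cts.
  have chk2 : continuous (fun q : G * (G * G) => hk q.1 q.2) by rewrite /hk; cts.
  have cfk k : continuous (fk k) by rewrite /fk; cts.
  have nhk k p : `|hk k p| <= 1 by exact: norm_mul_le1.
  have nfk k p : `|fk k p| <= 1 by exact: norm_mul_le1.
  (* 5/D comes from [twisted_corr]. The mean over k of the square of [J (hk k)] is at most 1/D by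
     [corr_bound], as [h] is centered in x. *)
  apply: (@le_trans _ _ (I (fun k => J (hk k) ^+ 2 + 5 / D))).
    apply: (le_mean mI); [by cts|by cts|move=> k].
    have := twisted_corr (chk k) (cfk k) (nhk k) (nfk k).
    have -> : I (fun g => J (fun p => hk k (g * p.1, p.2)%g * fk k (p.1, g * p.2)%g) ^+ 2) =
        I (fun g => W g (k * g)%g ^+ 2).
      congr I; apply/funext => g; congr (_ ^+ 2); congr J; apply/funext => p.
      by rewrite /hk /fk /Psi /= !mulgA; ring.
    move=> H; apply: le_trans H _; rewrite lerD2r exprMn -[leRHS]mulr1.
    apply: ler_wpM2l; first exact: sqr_ge0.
    by apply: sq_le1; exact: (mean_norm_le mJ).
  rewrite (meanD mI); [|by cts..]; rewrite (mean_cst mI).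
  have := corr_bound mI mG linv D0 qG ch ch h0.
  have /andP[p0 p1] := JD ch nh.
  have : J (fun p => h p ^+ 2) * J (fun p => h p ^+ 2) <= 1 by exact: mulr_ile1.
  move=> /(ler_wpM2l D1); rewrite mulr1 /hk; lra.
have W0 : 0 <= Wtot.
  by apply: (mean_ge0 mI) => [|g]; [cts|apply: (mean_sq_ge0 mI); cts].
apply: le_trans _ Wle; rewrite -/X.
have [->|Xn] := eqVneq X 0; first by rewrite expr0n.
have X2 : 0 < X ^+ 2 by rewrite exprn_gt0 // lt0r Xn.
rewrite -(ler_pM2l X2); apply: le_trans YW; rewrite [leRHS]expr2.
by apply: ler_pM => //; exact: sqr_ge0.
Qed.

Definition corner_count g := J (fun p => f p * (f (g * p.1, p.2)%g * f (p.1, g * p.2)%g)).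
Definition corner_limit := J (fun p => f p * (a p.2 * b p.1)).

Lemma ct_corner_count : continuous corner_count.
Proof. by rewrite /corner_count; cts. Qed.

(** The difference splits by f(gx,y) f(x,gy) - a(y) b(x) = h(gx,y) f(x,gy) + a(y) (f(x,gy) - b(x)).
    The first term is [S], handled by [error_term_bound]; the second is a correlation bounded by
    [corr_bound2]. *)
Lemma corner_count_L2 : 1 <= D ->
  I (fun g => (corner_count g - corner_limit) ^+ 2) <= 7 / Num.sqrt D.
Proof.
move=> D1.
pose u p := f p * a p.2.
pose v p := f p - b p.1.
have cu : continuous u by rewrite /u; cts.
have cv : continuous v by rewrite /v; cts.
pose S1 g := J (fun p => u p * v (p.1, g * p.2)%g).
have cS1 : continuous S1 by rewrite /S1; cts.
have E g : corner_count g - corner_limit = S g + S1 g.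
  rewrite /corner_count /corner_limit -(meanB mJ); [|by cts..].
  rewrite -(meanD mJ); [|by cts..].
  by congr J; apply/funext => p; rewrite /Psi /h /u /v /=; ring.
have nu p : `|u p| <= 1.
  apply: norm_mul_le1 => //; have /andP[a0 a1] := fiber1_01 p.2.
  by rewrite ger0_norm.
have nv p : `|v p| <= 1.
  have := fiber2_01 p.1; have := f0 p; have := f1 p.
  by rewrite ler_norml /v => h1 h2 /andP[h3 h4]; apply/andP; split; lra.
have v0 x : I (fun y => v (x, y)) = 0.
  by rewrite /v /= (meanB mI); [rewrite (mean_cst mI) subrr|cts..].
have B1 : I (fun g => S1 g ^+ 2) <= D^-1.
  apply: le_trans (corr_bound2 mI mG linv D0 qG cu cv v0) _.
  have D1' : 0 <= D^-1 by rewrite invr_ge0 ltW.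
  rewrite -[leRHS]mulr1; apply: ler_wpM2l => //.
  by have /andP[? ?] := JD cu nu; have /andP[? ?] := JD cv nv; apply: mulr_ile1.
have B2 := error_term_bound.
pose s := Num.sqrt D.
have sD : s ^+ 2 = D by rewrite sqr_sqrtr // ltW.
have s1 : 1 <= s by rewrite -sqrtr1 /s ler_sqrt // ltW.
have s0 : 0 < s by lra.
have X0 : 0 <= I (fun g => S g ^+ 2) by exact: (mean_sq_ge0 mI).
(* 6 is at most (5/2)^2. Together with [B4] the total is 2 (5/2) + 2 = 7. *)
have B3 : I (fun g => S g ^+ 2) <= 5 / 2 / s.
  have r0 : 0 <= 5 / 2 / s by rewrite divr_ge0 ?divr_ge0 // ltW.
  rewrite -(@ler_pXn2r _ 2) ?nnegrE //.
  apply: le_trans B2 _; rewrite -sD !expr_div_n.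
  by rewrite ler_wpM2r ?invr_ge0 ?sqr_ge0 //; lra.
have B4 : I (fun g => S1 g ^+ 2) <= 1 / s.
  apply: le_trans B1 _; rewrite -sD div1r lef_pV2 ?posrE ?exprn_gt0 // expr2.
  by rewrite ler_pMr.
apply: (@le_trans _ _ (I (fun g => 2 * S g ^+ 2 + 2 * S1 g ^+ 2))).
  apply: (le_mean mI); [|by cts|move=> g].
    by rewrite (_ : (fun g => _) = (fun g => (S g + S1 g) ^+ 2)); [cts|apply/funext => g; rewrite E].
  by rewrite E; have := sqr_ge0 (S g - S1 g); rewrite !expr2; lra.
rewrite (meanD mI); [|by cts..].
rewrite (meanZ mI); last by cts.
rewrite (meanZ mI); last by cts.
by rewrite -/s; move: B3 B4; lra.
Qed.

Lemma corner_count_L1 : 1 <= D ->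
  I (fun g => `|corner_count g - corner_limit|) ^+ 2 <= 7 / Num.sqrt D.
Proof.
move=> D1; apply: le_trans (corner_count_L2 D1).
have cc := ct_corner_count.
have cN : continuous (fun g => `|corner_count g - corner_limit|) by cts.
have := mean_CS mI cN (@ct_cst _ _ (1 : R)).
rewrite (_ : (fun x : G => 1 ^+ 2) = (fun=> 1)); last by apply/funext => x; rewrite expr1n.
rewrite (mean_cst mI) mulr1.
rewrite (_ : (fun x => _ * 1) = (fun g => `|corner_count g - corner_limit|)); last first.
  by apply/funext => x; rewrite mulr1.
rewrite (_ : (fun x => `| _ | ^+ 2) = (fun g => (corner_count g - corner_limit) ^+ 2)) //.
by apply/funext => x; rewrite real_normK ?num_real.
Qed.

(** By AM-GM, a b >= 3 t^2 - t^3/a - t^3/b with t = J f. Against [f] the right side has mean at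
    least 3 t^3 - t^3 - t^3, since the means of f/a and f/b are at most 1. *)
Lemma corner_limit_ge : J f ^+ 3 <= corner_limit.
Proof.
pose t := J f.
have t0 : 0 <= t by exact: (mean_ge0 mJ).
have t1 : t <= 1 by exact: (mean_le_cst mJ).
rewrite -/t; move: t0; rewrite le_eqVlt => /orP[/eqP <-|t0].
  rewrite expr0n /=; apply: (mean_ge0 mJ) => [|p]; first by cts.
  by have /andP[? _] := fiber1_01 p.2; have /andP[? _] := fiber2_01 p.1; rewrite !mulr_ge0.
rewrite -subr_le0; apply: (@le0_small _ _ 3) => // e e0 e1.
(* The fibre averages may vanish; adding [e] makes them invertible and changes the mean by at most
   [3 * e]. *)
pose A y := a y + e. pose B x := b x + e.
have A0 y : 0 < A y by have /andP[? _] := fiber1_01 y; rewrite /A; lra.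
have B0 x : 0 < B x by have /andP[? _] := fiber2_01 x; rewrite /B; lra.
have cA : continuous A by rewrite /A; cts.
have cB : continuous B by rewrite /B; cts.
pose iA y := (A y)^-1. pose iB x := (B x)^-1.
have ciA : continuous iA by apply: ct_inv => // y; rewrite gt_eqF.
have ciB : continuous iB by apply: ct_inv => // y; rewrite gt_eqF.
have JA : J (fun p => f p * iA p.2) <= 1.
  rewrite (mean2_swap mI mG) /=; last by cts.
  apply: (mean_le_cst mI); first by cts.
  move=> y; rewrite (meanZr mI); last by cts.
  by rewrite /iA ler_pdivrMr // mul1r -/(a y) /A lerDl ltW.
have JB : J (fun p => f p * iB p.1) <= 1.
  apply: (mean_le_cst mI); first by cts.
  move=> x /=; rewrite (meanZr mI); last by cts.
  by rewrite /iB ler_pdivrMr // mul1r -/(b x) /B lerDl ltW.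
have amgm p : f p * (3 * t ^+ 2 - t ^+ 3 * iA p.2 - t ^+ 3 * iB p.1) <= f p * (A p.2 * B p.1).
  apply: ler_wpM2l => //.
  rewrite /iA /iB; have := A0 p.2; have := B0 p.1; move: (A p.2) (B p.1) => x y y0 x0.
  rewrite -subr_ge0.
  have -> : x * y - (3 * t ^+ 2 - t ^+ 3 * x^-1 - t ^+ 3 * y^-1) =
     (x ^+ 2 * y ^+ 2 - 3 * t ^+ 2 * (x * y) + t ^+ 3 * (x + y)) / (x * y).
    by field; rewrite !gt_eqF.
  apply: divr_ge0; last by rewrite mulr_ge0 // ltW.
  have xy : 2 * Num.sqrt (x * y) <= x + y.
    have x0' := ltW x0; have y0' := ltW y0.
    rewrite -(@ler_pXn2r _ 2) ?nnegrE ?mulr_ge0 ?sqrtr_ge0 ?addr_ge0 //.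
    rewrite exprMn sqr_sqrtr ?mulr_ge0 //.
    by have := sqr_ge0 (x - y); rewrite !expr2; lra.
  (* As x + y >= 2w, the claim reduces to w^4 - 3 t^2 w^2 + 2 t^3 w >= 0, and the left side is w (w
     - t)^2 (w + 2t). *)
  pose w := Num.sqrt (x * y).
  have w0 : 0 <= w by exact: sqrtr_ge0.
  have wE : w ^+ 2 = x * y by rewrite sqr_sqrtr // mulr_ge0 // ltW.
  have := ler_wpM2l (exprn_ge0 3 (ltW t0)) xy; rewrite -/w => h1.
  have : 0 <= w ^+ 2 ^+ 2 - 3 * t ^+ 2 * w ^+ 2 + t ^+ 3 * (2 * w).
    have -> : w ^+ 2 ^+ 2 - 3 * t ^+ 2 * w ^+ 2 + t ^+ 3 * (2 * w) =
      w * ((w - t) ^+ 2 * (w + 2 * t)) by ring.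
    apply: mulr_ge0 => //; apply: mulr_ge0; first exact: sqr_ge0.
    by lra.
  by rewrite wE exprMn; lra.
have low : t ^+ 3 <= J (fun p => f p * (A p.2 * B p.1)).
  apply: (@le_trans _ _ (J (fun p => 3 * t ^+ 2 * f p +
     (- t ^+ 3 * (f p * iA p.2) + - t ^+ 3 * (f p * iB p.1))))).
    rewrite (meanD mJ); [|by cts..]; rewrite (meanD mJ); [|by cts..].
    rewrite (meanZ mJ) // -/t (meanZ mJ); last by cts.
    rewrite (meanZ mJ); last by cts.
    have t3 : 0 <= t ^+ 3 by rewrite exprn_ge0 // ltW.
    have := ler_wpM2l t3 JA; have := ler_wpM2l t3 JB.
    by rewrite !(exprSr t 2); lra.
  apply: (le_mean mJ); [by cts|by cts|move=> p].
  by apply: le_trans (amgm p); rewrite le_eqVlt; apply/orP; left; apply/eqP; ring.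
have : J (fun p => f p * (A p.2 * B p.1)) <= corner_limit + 3 * e.
  rewrite -(mean_cst mJ (3 * e)) /corner_limit -(meanD mJ); [|by cts..].
  apply: (le_mean mJ); [by cts|by cts|move=> p].
  have /andP[a0 a1] := fiber1_01 p.2; have /andP[b0 b1] := fiber2_01 p.1.
  have fp0 := f0 p; have fp1 := f1 p.
  rewrite /A /B; move: (f p) (a p.2) (b p.1) fp0 fp1 a0 a1 b0 b1 => z x y z0 z1 x0 x1 y0 y1.
  have -> : z * ((x + e) * (y + e)) = z * (x * y) + e * (z * (x + y + e)) by ring.
  rewrite lerD2l mulrC; apply: ler_wpM2r; first exact: ltW.
  have : z * (x + y + e) <= 1 * (x + y + e) by apply: ler_wpM2r => //; lra.
  lra.
lra.
Qed.

End unit_interval.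
End corner_average.

(** * Integrals of bounded Borel functions *)

Section borel_measure.
Variables (R : realType) (T : ptopologicalType).

Lemma cts_measurable (U : ptopologicalType) (f : T -> U) : continuous f ->
  measurable_fun [set: borel T] (f : borel T -> borel U).
Proof.
move=> cf; apply: (@measurability _ _ (borel T) (borel U) setT f (@open U : set (set (borel U)))) => // _ [B oB <-].
by rewrite setTI; apply: sub_sigma_algebra; exact: open_comp.
Qed.

Lemma cts_measurable_real (f : T -> R) : continuous f ->
  measurable_fun [set: borel T] (f : borel T -> R).
Proof.
move=> cf; apply: (measurability (@RGenOpens.G R)).
  exact: RGenOpens.measurableE.
move=> _ [_ [a [b ->] <-]]; rewrite setTI; apply: sub_sigma_algebra.
by apply: open_comp => //; exact: interval_open.
Qed.

Variable mu : probability (borel T) R.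

Definition bounded_meas (f : T -> R) :=
  measurable_fun [set: borel T] (f : borel T -> R) /\ exists C, forall x, `|f x| <= C.

Lemma bounded_meas_integrable f : bounded_meas f ->
  mu.-integrable [set: borel T] (EFin \o f).
Proof.
move=> [mf [C fC]]; apply: measurable_bounded_integrable => //.
  by apply: le_lt_trans (probability_le1 mu measurableT) _; exact: ltry.
exists C; split; first exact: num_real.
by move=> M CM x _; apply: le_trans (fC x) (ltW CM).
Qed.

Lemma bounded_measD f h : bounded_meas f -> bounded_meas h -> bounded_meas (fun x => f x + h x).
Proof.
move=> [mf [C fC]] [mh [B hB]]; split; first exact: measurable_funD.
by exists (C + B) => x; apply: le_trans (ler_normD _ _) (lerD _ _).
Qed.

Lemma bounded_measM f h : bounded_meas f -> bounded_meas h -> bounded_meas (fun x => f x * h x).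
Proof.
move=> [mf [C fC]] [mh [B hB]]; split; first exact: measurable_funM.
by exists (C * B) => x; rewrite normrM; apply: ler_pM.
Qed.

Lemma bounded_measN f : bounded_meas f -> bounded_meas (fun x => - f x).
Proof.
move=> [mf [C fC]]; split; first exact: measurableT_comp.
by exists C => x; rewrite normrN.
Qed.

Lemma bounded_meas_norm f : bounded_meas f -> bounded_meas (fun x => `|f x|).
Proof.
move=> [mf [C fC]]; split; first exact: measurableT_comp.
by exists C => x; rewrite normr_id.
Qed.

Lemma bounded_meas_indic (E : set (borel T)) : measurable E ->
  bounded_meas (\1_E : T -> R).
Proof.
move=> mE; split; first exact: measurable_indic.
by exists 1 => x; rewrite indicE; case: (_ \in _); rewrite ?normr1 ?normr0.
Qed.

Lemma bounded_meas_cts f : compact [set: T] -> continuous f -> bounded_meas f.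
Proof.
move=> cT cf; split; first exact: cts_measurable_real.
by have [C _ fC] := cts_bounded cT cf; exists C.
Qed.

Local Notation K := (Rintegral mu [set: borel T]).

Lemma bmeas_meanD f h : bounded_meas f -> bounded_meas h ->
  K (fun x => f x + h x) = K f + K h.
Proof. by move=> bf bh; apply: RintegralD => //; exact: bounded_meas_integrable. Qed.

Lemma bmeas_meanB f h : bounded_meas f -> bounded_meas h ->
  K (fun x => f x - h x) = K f - K h.
Proof. by move=> bf bh; apply: RintegralB => //; exact: bounded_meas_integrable. Qed.

Lemma bmeas_le f h : bounded_meas f -> bounded_meas h -> (forall x, f x <= h x) -> K f <= K h.
Proof. by move=> bf bh fh; apply: le_Rintegral => //; exact: bounded_meas_integrable. Qed.

Lemma bmeas_norm f : bounded_meas f -> `|K f| <= K (fun x => `|f x|).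
Proof. by move=> bf; apply: le_normr_Rintegral => //; exact: bounded_meas_integrable. Qed.

Lemma bmeas_indic (E : set (borel T)) : measurable E -> K \1_E = fine (mu E).
Proof. by move=> mE; rewrite /Rintegral integral_indic // setIT. Qed.

Lemma probability_fineK (E : set (borel T)) : measurable E -> (fine (mu E))%:E = mu E.
Proof. by move=> mE; rewrite fineK // fin_num_measure. Qed.

Lemma Rintegral_mean : compact [set: T] -> @mean R T K.
Proof.
move=> cT; split => //.
- by move=> f h cf ch; apply: bmeas_meanD; exact: bounded_meas_cts.
- move=> c f cf; apply: RintegralZl => //; apply: bounded_meas_integrable.
  exact: bounded_meas_cts.
- by move=> f cf f0; apply: Rintegral_ge0.
- rewrite Rintegral_cst // mul1r; transitivity (fine (1%E : \bar R)) => //.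
  by congr fine; exact: probability_setT.
Qed.

Lemma continuity_from_below (F : (set (borel T))^nat) (e : R) :
  (forall n, measurable (F n)) -> (forall n, F n `<=` F n.+1) -> 0 < e ->
  exists n, K (\1_(\bigcup_n F n)) - K (\1_(F n)) < e.
Proof.
move=> mF incF e0.
have mU : measurable (\bigcup_n F n) by exact: bigcup_measurable.
have homoF : {homo F : n m / (n <= m)%N >-> (n <= m)%O}.
  move=> n m nm; apply/subsetPset; rewrite -(subnK nm).
  elim: (m - n)%N => [|k IH]; first by rewrite add0n.
  by apply: subset_trans IH _; rewrite addSn; exact: incF.
have := @nondecreasing_cvg_mu _ _ _ mu F mF mU homoF.
rewrite -[X in _ --> X -> _](probability_fineK mU) => /fine_cvgP[_ /cvgrPdist_lt /(_ e e0) [N _ /(_ N (leqnn N))]].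
rewrite /= ltr_norml => /andP[_ h]; exists N.
by rewrite !bmeas_indic.
Qed.

End borel_measure.

(** * Approximation of Borel indicators by continuous functions *)

Section indicator_approximation.
Variable R : realType.

Lemma metrized_prod (T U : topologicalType) : 
  metrized R T -> metrized R U -> metrized R (T * U)%type.
Proof.
move=> [d [d0 dC dD dn]] [d' [d'0 d'C d'D d'n]].
have dge0 x y : 0 <= d x y by have := dD x y x; rewrite d0 (dC y x); lra.
have d'ge0 x y : 0 <= d' x y by have := d'D x y x; rewrite d'0 (d'C y x); lra.
exists (fun p q => d p.1 q.1 + d' p.2 q.2); split.
- by move=> p; rewrite d0 d'0 addr0.
- by move=> p q; rewrite dC d'C.
- by move=> p q r; have := dD p.1 q.1 r.1; have := d'D p.2 q.2 r.2; lra.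
move=> p A; split.
  move=> [[B1 B2] /= [/dn[e1 e10 h1] /d'n[e2 e20 h2]] BA].
  exists (Num.min e1 e2); first by rewrite lt_min e10.
  move=> q; rewrite lt_min => /andP[q1 q2]; apply: BA; split => /=.
    by apply: h1; apply: le_lt_trans q1; rewrite lerDl.
  by apply: h2; apply: le_lt_trans q2; rewrite lerDr.
move=> [e e0 eA].
exists ([set x | d p.1 x < e / 2], [set y | d' p.2 y < e / 2]) => /=.
  by split; [apply/dn|apply/d'n]; exists (e / 2); rewrite ?divr_gt0.
by move=> q [/= q1 q2]; apply: eA; lra.
Qed.

Variable T : ptopologicalType.
Hypothesis cT : compact [set: T].
Hypothesis mT : metrized R T.
Variable mu : probability (borel T) R.
Local Notation K := (Rintegral mu [set: borel T]).

(** [rho] is the distance to the complement of [U], or the constant 1 when the complement is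
    empty. *)
Lemma open_exhaustion (U : set T) : open U -> exists rho : T -> R,
  [/\ continuous rho, forall x, 0 <= rho x, forall x, U x -> 0 < rho x
    & forall x, ~ U x -> rho x = 0].
Proof.
move=> oU; have [[c0 Uc0]|Uall] := pselect (exists c, ~ U c); last first.
  exists (fun=> 1); split => // [|x nUx]; first exact: ct_cst.
  by exfalso; apply: Uall; exists x.
have [d [d0 dC dD dn]] := mT.
have dge0 x y : 0 <= d x y by have := dD x y x; rewrite d0 (dC y x); lra.
pose S x := [set d x c | c in ~` U].
have S0 x : S x !=set0 by exists (d x c0), c0.
have lbS x : has_lbound (S x) by exists 0 => _ [c _ <-].
pose rho x := inf (S x).
have rho_le x c : ~ U c -> rho x <= d x c by move=> Uc; apply: ge_inf => //; exists c.
have lip x y : rho x - d x y <= rho y.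
  apply: lb_le_inf => // _ [c Uc <-].
  by have := rho_le x c Uc; have := dD x y c; lra.
have rho0 x : 0 <= rho x by apply: lb_le_inf => // _ [c _ <-].
exists rho; split => //.
- move=> x; apply/cvgrPdist_lt => e e0; apply/dn; exists e => // y xy.
  apply: le_lt_trans xy; rewrite ler_norml.
  by have := lip x y; have := lip y x; rewrite (dC y x) => h1 h2; apply/andP; split; lra.
- move=> x Ux; have /dn[e e0 eU] : nbhs x U by exact: open_nbhs_nbhs.
  apply: lt_le_trans e0 _; apply: lb_le_inf => // _ [c Uc <-].
  by rewrite leNgt; apply/negP => /eU.
- by move=> x Ux; apply/eqP; rewrite eq_le rho0 andbT -(d0 x) rho_le.
Qed.

Definition approximable (E : set (borel T)) := measurable E /\
  forall e, 0 < e -> exists f : T -> R, [/\ continuous f, forall x, 0 <= f x,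
    forall x, f x <= 1 & K (fun x => `|f x - \1_E x|) <= e].

Let bi (E : set (borel T)) : measurable E -> bounded_meas (\1_E : T -> R).
Proof. exact: bounded_meas_indic. Qed.

Let bdist (f : T -> R) (E : set (borel T)) : continuous f -> measurable E ->
  bounded_meas (fun x => `|f x - \1_E x|).
Proof.
move=> cf mE; apply: bounded_meas_norm; apply: bounded_measD.
  exact: bounded_meas_cts.
exact/bounded_measN/bi.
Qed.

Lemma indic_val (E : set T) x : \1_E x = 0 :> R \/ \1_E x = 1 :> R.
Proof. by rewrite indicE; case: (_ \in _); [right|left]. Qed.

(** The expression s + t - s t takes indicators to the indicator of the union, preserves [0,1], and
    is 1-Lipschitz in each variable there, so the errors add. *)
Lemma approximable_setU (E F : set (borel T)) : approximable E -> approximable F ->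
  approximable (E `|` F).
Proof.
move=> [mE aE] [mF aF]; split; first exact: measurableU.
move=> e e0; have e2 : 0 < e / 2 by rewrite divr_gt0.
have [f [cf f0 f1 fE]] := aE _ e2.
have [h [ch h0 h1 hF]] := aF _ e2.
exists (fun x => f x + h x - f x * h x); split.
- by cts.
- by move=> x; have := f0 x; have := f1 x; have := h0 x; have := h1 x; nra.
- by move=> x; have := f0 x; have := f1 x; have := h0 x; have := h1 x; nra.
rewrite (splitr e); apply: le_trans (lerD fE hF).
rewrite -bmeas_meanD; [|exact: bdist..].
apply: bmeas_le.
- by apply: bdist; [cts|exact: measurableU].
- by apply: bounded_measD; exact: bdist.
move=> x; have -> : \1_(E `|` F) x = \1_E x + \1_F x - \1_E x * \1_F x :> R.
  rewrite !indicE in_setU; case: (x \in E); case: (x \in F) => /=; ring.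
have := f0 x; have := f1 x; have := h0 x; have := h1 x.
move: (f x) (h x) => a b b1 b0 a1 a0.
have -> (s t : R) : a + b - a * b - (s + t - s * t) = (a - s) * (1 - b) + (b - t) * (1 - s).
  by ring.
apply: le_trans (ler_normD _ _) _; rewrite !normrM.
apply: lerD; rewrite -[leRHS]mulr1; apply: ler_wpM2l => //.
  by rewrite ger0_norm; lra.
by case: (indic_val E x) => ->; rewrite ?subr0 ?subrr ?normr1 ?normr0.
Qed.

(** The approximable sets contain the open sets and form a sigma-algebra: complements use [1 - f],
    and countable unions are limits in measure of finite unions. *)
Lemma indicator_approximation (E : set (borel T)) : measurable E -> approximable E.
Proof.
have open_approx U : open U -> approximable U.
  move=> oU; have mU : measurable (U : set (borel T)) by exact: sub_sigma_algebra.
  split => // e e0.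
  have [rho [crho rho0 rhoU rhoN]] := open_exhaustion oU.
  pose F n : set (borel T) := [set x | n.+1%:R^-1 < rho x].
  have mF n : measurable (F n).
    apply: sub_sigma_algebra.
    have -> : F n = rho @^-1` [set y | n.+1%:R^-1 < y] by [].
    by apply: open_comp => //; exact: open_gt.
  have UF : \bigcup_n F n = U.
    apply/seteqP; split => x.
      move=> [n _ h]; apply: contrapT => /rhoN r0; move: h; rewrite /F /= r0.
      by rewrite ltNge invr_ge0 ler0n.
    move=> /rhoU r0; exists (Num.truncn (rho x)^-1) => //=.
    by rewrite /F /= invf_plt ?posrE // truncnS_gt.
  have incF n : F n `<=` F n.+1.
    by move=> x; apply: le_lt_trans; rewrite lef_pV2 ?posrE // ler_nat.
  have [n hn] := continuity_from_below mu mF incF e0; rewrite UF in hn.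
  pose z x := n.+1%:R * rho x.
  have z0 x : 0 <= z x by rewrite mulr_ge0.
  (* This is the minimum of 1 and [z x]: it is 1 on [F n] and 0 outside [U]. *)
  pose f x := 2^-1 * (1 + z x - `|1 - z x|).
  have cf : continuous f by rewrite /f /z; cts.
  have fle x : f x <= 1 by have := ler_norm (-(1 - z x)); rewrite normrN /f; lra.
  have fge x : 0 <= f x.
    have : `|1 - z x| <= 1 + z x by rewrite ler_norml; have := z0 x; lra.
    by rewrite /f; lra.
  exists f; split => //.
  rewrite -bmeas_meanB in hn; [|exact: bi..].
  apply/ltW; apply: le_lt_trans hn; apply: bmeas_le.
  - exact: bdist.
  - by apply: bounded_measD; [exact: bi|exact/bounded_measN/bi].
  move=> x; have [Ux|nUx] := pselect (U x); last first.
    have -> : f x = 0 by rewrite /f /z rhoN // mulr0 subr0 addr0 normr1; lra.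
    rewrite !indicE !memNset //=; last by rewrite /F /= rhoN // ltNge invr_ge0 ler0n.
    by rewrite subr0 normr0.
  rewrite [\1_U x]indicE mem_set //=.
  have [Fx|nFx] := pselect (F n x).
    have z1 : 1 < z x by rewrite /z -ltr_pdivrMl ?mulr1 //; exact: Fx.
    have -> : f x = 1 by rewrite /f ltr0_norm; lra.
    by rewrite indicE mem_set // subrr normr0.
  rewrite indicE memNset // subr0 distrC ger0_norm; have := fge x; have := fle x; lra.
suff : <<s (@open T) >> `<=` approximable by apply.
apply: smallest_sub => //; split.
- split; first exact: measurable0.
  move=> e e0; exists (fun=> 0); split; [exact: ct_cst|by []|by move=> x; exact: ler01|].
  rewrite (_ : (fun x => _) = (fun=> 0)); last first.
    by apply/funext => x; rewrite indicE memNset // subrr normr0.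
  by rewrite Rintegral_cst // mul0r ltW.
- move=> F [mF aF]; rewrite setTD; split; first exact: measurableC.
  move=> e e0; have [f [cf f0 f1 fE]] := aF e e0.
  exists (fun x => 1 - f x); split; [by cts|by move=> x; rewrite subr_ge0|by move=> x; rewrite lerBlDr lerDl|].
  apply: le_trans fE; rewrite le_eqVlt; apply/orP; left; apply/eqP; congr Rintegral.
  apply/funext => x; rewrite !indicE in_setC.
  by rewrite -normrN; congr `| _ |; case: (x \in F) => /=; ring.
move=> A aA; pose B n : set (borel T) := \big[setU/set0]_(i < n.+1) A i.
have aB n : approximable (B n).
  rewrite /B; move: n.+1; elim=> [|k IH].
    rewrite big_ord0; split; first exact: measurable0.
    move=> e e0; exists (fun=> 0); split; [exact: ct_cst|by []|by move=> x; exact: ler01|].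
    rewrite (_ : (fun x => _) = (fun=> 0)); last first.
      by apply/funext => x; rewrite indicE memNset // subrr normr0.
    by rewrite Rintegral_cst // mul0r ltW.
  by rewrite big_ord_recr; exact: approximable_setU.
have mB n : measurable (B n) by have [] := aB n.
have mU : measurable (\bigcup_n B n) by exact: bigcup_measurable.
have incB n : B n `<=` B n.+1 by rewrite {2}/B big_ord_recr; exact: subsetUl.
rewrite -bigcup_bigsetU_bigcup -/B; split => // e e0.
have e2 : 0 < e / 2 by rewrite divr_gt0.
have [n hn] := continuity_from_below mu mB incB e2.
have [_ /(_ _ e2)[f [cf f0 f1 fB]]] := aB n.
exists f; split => //; rewrite (splitr e).
rewrite -bmeas_meanB in hn; [|exact: bi..].
apply: le_trans (lerD fB (ltW hn)).
have bd : bounded_meas (fun x => \1_(\bigcup_n B n) x - \1_(B n) x : R).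
  by apply: bounded_measD; [exact: bi|exact/bounded_measN/bi].
rewrite -bmeas_meanD //; last exact: bdist.
apply: bmeas_le; [exact: bdist|by apply: bounded_measD => //; exact: bdist|move=> x].
have : 0 <= \1_(\bigcup_n B n) x - \1_(B n) x :> R.
  rewrite !indicE; have [Bx|nBx] := pselect (B n x).
    by rewrite !mem_set ?subrr //; exists n.
  by rewrite (memNset nBx) subr0.
move: (f x) (\1_(\bigcup_n B n) x) (\1_(B n) x) => a u b h.
have -> : a - u = (a - b) - (u - b) by ring.
by apply: le_trans (ler_normB _ _) _; rewrite (ger0_norm h).
Qed.

End indicator_approximation.

(** * Invariance of the Haar integral *)

Section haar_integral.
Variables (R : realType) (G : topologicalGroupType) (mu : probability (borel G) R).
Hypothesis hmu : is_haar mu.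
Local Notation K := (Rintegral mu [set: borel G]).

Lemma ct_lmul (g : G) : continuous (fun x : G => (g * x)%g).
Proof. by cts. Qed.

Lemma bounded_meas_lmul g (w : G -> R) : bounded_meas w -> bounded_meas (fun x => w (g * x)%g).
Proof.
move=> [mw [C wC]]; split; last by exists C => x.
exact: (measurableT_comp mw (cts_measurable (@ct_lmul g))).
Qed.

Lemma haar_linv g (w : G -> R) : bounded_meas w -> K (fun x => w (g * x)%g) = K w.
Proof.
move=> bw; have mphi := cts_measurable (@ct_lmul g).
have [mw _] := bw.
rewrite /Rintegral; congr fine.
have := @integral_pushforward _ _ _ _ _ _ mphi mu setT (EFin \o w).
rewrite preimage_setT => H; rewrite -H //; first last.
- exact: (bounded_meas_integrable mu (bounded_meas_lmul g bw)).
- exact/measurable_EFinP.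
apply: eq_measure_integral => A mA _; rewrite /= /pushforward.
rewrite -(hmu g^-1%g mA); congr (mu _); apply/seteqP; split => x /=.
  by move=> Ax; exists (g * x)%g => //; rewrite mulKg.
by move=> [y Ay <-]; rewrite mulVKg.
Qed.

End haar_integral.

(** * The Haar measure of the product group and the set of good g *)

Section product_haar.
Variables (R : realType) (G : topologicalGroupType).
Local Notation GG := ((G * G)%type : topologicalGroupType).
Variables (mG : probability (borel G) R) (mGG : probability (borel GG) R).
Hypothesis cG : compact [set: G].
Hypothesis metG : metrizable R G.
Hypothesis hG : is_haar mG.
Hypothesis hGG : is_haar mGG.

Local Notation I := (Rintegral mG [set: borel G]).
Local Notation K := (Rintegral mGG [set: borel GG]).
Local Notation J := (@mean2 R G I).
Local Notation bmGG := (@bounded_meas R GG).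

Let mI : @mean R G I := Rintegral_mean mG cG.
Let linv g (f : G -> R) : continuous f -> I (fun x => f (g * x)%g) = I f.
Proof. by move=> cf; apply: haar_linv => //; exact: bounded_meas_cts. Qed.
Let mJ : @mean R GG J := mean2_mean mI.
Let cGG : compact [set: G * G] := mean_compact mJ.
Let mK : @mean R GG K := @Rintegral_mean R GG mGG cGG.

Lemma haar_prod_linv a b (w : G * G -> R) : bmGG w ->
  K (fun p => w (a * p.1, b * p.2)%g) = K w.
Proof. by move=> bw; rewrite -[RHS](haar_linv hGG (a, b) bw). Qed.

(** Uniqueness of invariant means. Average [K F] over all left translates by q with respect to [J];
    after exchanging the means, the inner one is [J] of a right translate of [F], which is [J F]. *)
Lemma haar_prodE (F : G * G -> R) : continuous F -> K F = J F.
Proof.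
move=> cF.
transitivity (J (fun q => K (fun p => F (q.1 * p.1, q.2 * p.2)%g))).
  rewrite -[LHS](mean_cst mJ); congr (@mean2 R G I); apply/funext => q.
  by rewrite haar_prod_linv //; exact: bounded_meas_cts.
transitivity (K (fun p => J (fun q => F (q.1 * p.1, q.2 * p.2)%g))).
  transitivity (I (fun x => K (fun p => I (fun y => F (x * p.1, y * p.2)%g)))).
    congr (I _); apply/funext => x.
    by apply: (mean_exchange cG metG mI mK (F := fun y p => F (x * p.1, y * p.2)%g)); cts.
  by apply: (mean_exchange cG metG mI mK (F := fun x p => I (fun y => F (x * p.1, y * p.2)%g))); cts.
rewrite -[RHS](mean_cst mK); congr (K _); apply/funext => p.
by rewrite (mean2_rinv mI metG linv).
Qed.

Lemma bounded_meas_prod_lmul a b (w : G * G -> R) : bmGG w ->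
  bmGG (fun p : G * G => w (a * p.1, b * p.2)%g).
Proof. exact: (bounded_meas_lmul (a, b)). Qed.

Variable E : set (borel GG).
Hypothesis mE : measurable E.

Definition corners (g : G) : set (borel GG) :=
  [set p : G * G | [/\ E (p.1, p.2), E ((g * p.1)%g, p.2) & E (p.1, (g * p.2)%g)]].

(** The factors 1 present the second and third conditions as preimages of [E] under left
    translations of the product group. *)
Lemma cornersE g : corners g = E `&` ((fun p : G * G => ((g * p.1)%g, (1 * p.2)%g)) @^-1` E `&`
  (fun p : G * G => ((1 * p.1)%g, (g * p.2)%g)) @^-1` E).
Proof.
apply/seteqP; split => -[x y]; rewrite /corners /= !mul1g.
  by move=> [h1 h2 h3].
by move=> [h1 [h2 h3]].
Qed.

Lemma measurable_corners g : measurable (corners g).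
Proof.
have mshift a b : measurable ((fun p : G * G => ((a * p.1)%g, (b * p.2)%g)) @^-1` E
    : set (borel GG)).
  rewrite -[X in measurable X]setTI.
  exact: (cts_measurable (@ct_lmul GG (a, b)) measurableT mE).
rewrite cornersE; apply: measurableI => //.
exact: measurableI.
Qed.

Lemma corners_indic g p : \1_(corners g) p =
  \1_E p * (\1_E (g * p.1, 1 * p.2)%g * \1_E (1 * p.1, g * p.2)%g) :> R.
Proof. by rewrite cornersE !indicI. Qed.

(** The three factors are replaced by indicators one at a time; by translation invariance each
    replacement costs at most [e], uniformly in [g]. *)
Lemma corners_approx (f : G * G -> R) (e : R) g : continuous f ->
  (forall p, 0 <= f p) -> (forall p, f p <= 1) ->
  K (fun p => `|f p - \1_E p|) <= e ->
  `|@corner_count R G I f g - fine (mGG (corners g))| <= 3 * e.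
Proof.
move=> cf f0 f1 fE.
have bf : bmGG f by exact: bounded_meas_cts.
have bE : bmGG (\1_E : G * G -> R) by exact: bounded_meas_indic.
pose w p := `|f p - \1_E p|.
have bw : bmGG w.
  by apply: bounded_meas_norm; apply: bounded_measD => //; exact: bounded_measN.
have bS : bmGG (\1_(corners g) : G * G -> R).
  by apply: bounded_meas_indic; exact: measurable_corners.
pose c p := f p * (f (g * p.1, 1 * p.2)%g * f (1 * p.1, g * p.2)%g).
have bc : bmGG c.
  apply: bounded_measM => //; apply: bounded_measM; exact: bounded_meas_prod_lmul.
have cc : continuous (fun p : G * G => f p * (f (g * p.1, p.2)%g * f (p.1, g * p.2)%g)) by cts.
have -> : @corner_count R G I f g = K c.
  rewrite /corner_count -haar_prodE //; congr (K _); apply/funext => p.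
  by rewrite /c !mul1g.
rewrite -(bmeas_indic mGG (measurable_corners g)) -bmeas_meanB //.
have bd : bmGG (fun p => c p - \1_(corners g) p).
  by apply: bounded_measD => //; exact: bounded_measN.
apply: le_trans (bmeas_norm mGG bd) _.
have b1 := bounded_meas_prod_lmul g 1 bw.
have b2 := bounded_meas_prod_lmul 1 g bw.
apply: (@le_trans _ _ (K (fun p => w p + (w (g * p.1, 1 * p.2)%g + w (1 * p.1, g * p.2)%g)))).
  apply: bmeas_le; first exact: bounded_meas_norm.
    by apply: bounded_measD => //; exact: bounded_measD.
  move=> p; rewrite corners_indic /c /w.
  have : forall q : G * G, 0 <= (\1_E q : R) <= 1.
    by move=> q; rewrite indicE; case: (_ \in _); rewrite ?lexx ?ler01.
  move: (p) (g * p.1, 1 * p.2)%g (1 * p.1, g * p.2)%g => x y z h.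
  have /andP[s0 s1] := h x; have /andP[t0 t1] := h y; have /andP[u0 u1] := h z.
  move: (f x) (f y) (f z) (\1_E x : R) (\1_E y : R) (\1_E z : R) (f0 x) (f1 x) (f0 y) (f1 y)
    (f0 z) (f1 z) s0 s1 t0 t1 u0 u1 => a b d s t u a0 a1 b0 b1' d0 d1 s0 s1 t0 t1 u0 u1.
  have -> : a * (b * d) - s * (t * u) =
      (a - s) * (b * d) + ((b - t) * (s * d) + (d - u) * (s * t)) by ring.
  have small (v k : R) : 0 <= k -> k <= 1 -> `|v * k| <= `|v|.
    by move=> k0 k1; rewrite normrM (ger0_norm k0) ler_piMr.
  apply: le_trans (ler_normD _ _) (lerD _ (le_trans (ler_normD _ _) (lerD _ _)));
    by apply: small; [exact: mulr_ge0|exact: mulr_ile1].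
rewrite bmeas_meanD //; last exact: bounded_measD.
rewrite bmeas_meanD // !haar_prod_linv //.
by move: fE; rewrite -/w; lra.
Qed.

(** By [corners_approx] the function is a uniform limit of the continuous functions [corner_count].
    Measurability of the set of good g rests on this. *)
Lemma ct_corners : continuous (fun g => fine (mGG (corners g))).
Proof.
move=> g0; apply/cvgrPdist_lt => e e0.
have e9 : 0 < e / 9 by rewrite divr_gt0.
have mt := metrized_prod (metrizable_nbhs metG) (metrizable_nbhs metG).
have [_ /(_ _ e9)[f [cf f0 f1 fE]]] := @indicator_approximation R GG cGG mt mGG E mE.
have cc := ct_corner_count mI cf.
have := cc g0 => /cvgrPdist_lt /(_ _ e9).
apply: filterS => g.
have := corners_approx g0 cf f0 f1 fE; have := corners_approx g cf f0 f1 fE.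
by rewrite !ler_norml !ltr_norml; lra.
Qed.

Variable D : R.
Hypothesis D1 : 1 <= D.
Hypothesis qG : quasirandom D G.

Let delta := fine (mGG E).

(** Markov's inequality for the deviation [dev], whose mean is bounded by [corner_count_L1]. *)
Lemma good_set_measure (eps : R) : 0 < eps ->
  (1 - Num.sqrt (7 / Num.sqrt D) / (4 / 5 * eps) <=
    fine (mG [set g : G | delta ^+ 3 - eps <= fine (mGG (corners g))])).
Proof.
move=> e0.
have D0 : 0 < D := lt_le_trans ltr01 D1.
pose A : set (borel G) := [set g : G | delta ^+ 3 - eps <= fine (mGG (corners g))].
have mA : measurable A.
  have /= := cts_measurable_real ct_corners measurableT.
  move=> /(_ `[delta ^+ 3 - eps, +oo[%classic (measurable_itv _)); rewrite setTI.
  by congr measurable; apply/seteqP; split => g /=; rewrite in_itv /= andbT.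
have delta01 : 0 <= delta <= 1.
  by rewrite fine_ge0 // -lee_fin probability_fineK // probability_le1.
(* Approximating the three factors costs 3 eps/30, and so does the passage from (J f)^3 to delta^3.
   Outside [A] the deviation is therefore at least eps - 2 eps/10 = 4/5 eps. *)
have e30 : 0 < eps / 30 by rewrite divr_gt0.
have mt := metrized_prod (metrizable_nbhs metG) (metrizable_nbhs metG).
have [_ /(_ _ e30)[f [cf f0 f1 fE]]] := @indicator_approximation R GG cGG mt mGG E mE.
have bf : bmGG f by exact: bounded_meas_cts.
have bE : bmGG (\1_E : G * G -> R) by exact: bounded_meas_indic.
have Jf : `|J f - delta| <= eps / 30.
  rewrite -haar_prodE // /delta -(bmeas_indic mGG mE) -bmeas_meanB //.
  apply: le_trans (bmeas_norm mGG _) fE.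
  by apply: bounded_measD => //; exact: bounded_measN.
have Jf01 : 0 <= J f <= 1.
  by rewrite (mean_ge0 mJ) //=; exact: (mean_le_cst mJ).
have lim : delta ^+ 3 - eps / 10 <= @corner_limit R G I f.
  apply: le_trans (corner_limit_ge mI metG cf f0 f1).
  move: Jf; rewrite ler_norml => /andP[h1 h2].
  have /andP[d0 d1] := delta01; have /andP[j0 j1] := Jf01.
  move: (J f) delta h1 h2 d0 d1 j0 j1 => j d h1 h2 d0 d1 j0 j1.
  have -> : j ^+ 3 = d ^+ 3 - (d - j) * (d ^+ 2 + d * j + j ^+ 2) by ring.
  have s0 : 0 <= d ^+ 2 + d * j + j ^+ 2 by rewrite !addr_ge0 ?mulr_ge0 ?sqr_ge0.
  have s3 : d ^+ 2 + d * j + j ^+ 2 <= 3.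
    have := mulr_ile1 d0 d0 d1 d1; have := mulr_ile1 d0 j0 d1 j1.
    by have := mulr_ile1 j0 j0 j1 j1; rewrite !expr2; lra.
  have dj : d - j <= eps / 30 by lra.
  have := ler_wpM2r s0 dj; have := ler_wpM2l (ltW e30) s3; lra.
have cc := ct_corner_count mI  cf.
have L1 := corner_count_L1 mI metG linv D0 qG cf f0 f1 D1.
pose dev g := `|@corner_count R G I f g - @corner_limit R G I f|.
have cdev : continuous dev by rewrite /dev; cts.
have bdev : bounded_meas dev by exact: bounded_meas_cts.
have bA : bounded_meas (\1_A : G -> R) by exact: bounded_meas_indic.
have cst1 : bounded_meas (fun _ : G => 1 : R) by apply: bounded_meas_cts => //; exact: ct_cst.
have markov : 4 / 5 * eps * (1 - fine (mG A)) <= I dev.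
  have cst45 : bounded_meas (fun _ : G => 4 / 5 * eps : R).
    by apply: bounded_meas_cts => //; exact: ct_cst.
  have b1A : bounded_meas (fun g : G => 1 - \1_A g : R).
    by apply: bounded_measD => //; exact: bounded_measN.
  have -> : 4 / 5 * eps * (1 - fine (mG A)) = I (fun g => 4 / 5 * eps * (1 - \1_A g)).
    rewrite (RintegralZl _ measurableT (bounded_meas_integrable mG b1A)).
    rewrite bmeas_meanB // bmeas_indic //; congr (_ * (_ - _)).
    by rewrite (mean1 mI).
  apply: bmeas_le => //; first exact: bounded_measM.
  move=> g; rewrite indicE; have [Ag|nAg] := pselect (A g).
    by rewrite mem_set // subrr mulr0 normr_ge0.
  rewrite memNset // subr0 mulr1.
  have {nAg} : fine (mGG (corners g)) < delta ^+ 3 - eps.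
    by rewrite ltNge; apply/negP.
  have := corners_approx g cf f0 f1 fE.
  rewrite ler_norml /dev => /andP[_ h1] h2.
  rewrite -normrN; apply: le_trans (ler_norm _); lra.
have Idev : I dev <= Num.sqrt (7 / Num.sqrt D).
  have I0 : 0 <= I dev by apply: (mean_ge0 mI) => // g; exact: normr_ge0.
  rewrite -(ger0_norm I0) -sqrtr_sqr ler_sqrt; first exact: L1.
  by apply: divr_ge0 => //; exact: sqrtr_ge0.
have e45 : 0 < 4 / 5 * eps by lra.
rewrite lerBlDr addrC -lerBlDr ler_pdivlMr // mulrC.
exact: le_trans markov Idev.
Qed.

End product_haar.

(** * Conclusion: extreme parameters and the stated constant *)

Theorem theoremB (R : realType) (eps D : R) (G : topologicalGroupType)
    (mG : probability (borel G) R) (mGG : probability (borel (G * G)%type) R)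
    (E : set (borel (G * G)%type)) :
  0 < eps -> 0 < D ->
  compact [set: G] -> metrizable R G -> quasirandom D G ->
  is_haar mG -> is_haar mGG ->
  measurable E ->
  let delta : R := fine (mGG E) in
  let A : set G :=
    [set g : G |
      ((delta ^+ 3 - eps)%:E <=
        mGG [set p : G * G |
              [/\ E (p.1, p.2), E ((g * p.1)%g, p.2)
                & E (p.1, (g * p.2)%g)]])%E] in
  ((1 - 2 * Num.sqrt 3 * D `^ (- (1 / 4)) / eps)%:E <= mG A)%E.
Proof.
move=> e0 D0 cG metG qG hG hGG mE; cbv zeta.
pose GG : topologicalGroupType := (G * G)%type.
pose nu : probability (borel GG) R := mGG.
have mE' : measurable (E : set (borel GG)) by [].
have hnu : is_haar nu by [].
set delta := fine (mGG E); set A : set G := [set g : G | _].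
have AE : A = [set g : G | delta ^+ 3 - eps <= fine (nu (corners E g))].
  have fK g := @probability_fineK R GG nu _ (measurable_corners mE' g).
  by apply/seteqP; split => g; rewrite /A /= -lee_fin fK.
have mA : measurable (A : set (borel G)).
  rewrite AE; have /= := cts_measurable_real (ct_corners cG metG hG hnu mE') measurableT.
  move=> /(_ `[delta ^+ 3 - eps, +oo[%classic (measurable_itv _)); rewrite setTI.
  by congr measurable; apply/seteqP; split => g /=; rewrite in_itv /= andbT.
pose s := Num.sqrt (Num.sqrt D).
have s0 : 0 < s by rewrite !sqrtr_gt0.
have s2 : s ^+ 2 = Num.sqrt D by rewrite sqr_sqrtr // sqrtr_ge0.
have Dpow : D `^ (- (1 / 4)) = s^-1.
  rewrite powRN; congr (_^-1).
  have -> : 1 / 4 = 2^-1 * 2^-1 :> R by field.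
  by rewrite powRrM !powR12_sqrt // ?sqrtr_ge0 // ltW.
have s3 : 1 < Num.sqrt 3 :> R by rewrite -[ltLHS]sqrtr1 ltr_sqrt //; lra.
rewrite Dpow.
(* For eps >= 1 the threshold delta^3 - eps is at most 0, so [A] is the whole group. *)
have [eps1|eps1] := leP 1 eps.
  have -> : A = setT.
    apply/seteqP; split => // g _; rewrite AE /=.
    have d1 : delta <= 1 by rewrite -lee_fin (@probability_fineK R GG nu) // probability_le1.
    have d0 : 0 <= delta by exact: fine_ge0.
    apply: (@le_trans _ _ 0); last exact: fine_ge0.
    have : delta ^+ 3 <= 1 by exact: exprn_ile1.
    lra.
  rewrite [leRHS](_ : _ = 1%E); last exact: probability_setT.
  rewrite lee_fin lerBlDr lerDl; apply: divr_ge0; last exact: ltW.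
  apply: mulr_ge0; last by rewrite invr_ge0 ltW.
  by apply: mulr_ge0 => //; exact: sqrtr_ge0.
(* For D < 1 and eps < 1 the claimed lower bound is negative, because [eps] and [s] are at most 1
   and 2 sqrt 3 > 1. *)
have [D1|D1] := leP 1 D; last first.
  apply: (@le_trans _ _ 0%E); last exact: measure_ge0.
  have s1 : s <= 1.
    rewrite -sqrtr1 ler_sqrt // -[leRHS]sqrtr1 ler_sqrt //; exact: ltW.
  rewrite lee_fin subr_le0 ler_pdivlMr // mul1r ler_pdivlMr //.
  have : eps * s <= 1 * 1 by apply: ler_pM => //; exact: ltW.
  lra.
rewrite -(probability_fineK mG mA) lee_fin AE.
apply: le_trans (good_set_measure cG metG hG hnu mE' D1 qG e0).
rewrite lerD2l lerN2 -s2.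
(* With the denominator 4/5 eps in common, the comparison becomes 7 <= (8/5)^2 3 = 192/25 after
   squaring. *)
have -> : 2 * Num.sqrt 3 / s / eps = (8 / 5 * Num.sqrt 3 / s) / (4 / 5 * eps) :> R.
  by field; rewrite !gt_eqF.
rewrite ler_wpM2r ?invr_ge0 //; first by lra.
have r0 : 0 <= 8 / 5 * Num.sqrt 3 / s :> R.
  by rewrite divr_ge0 ?mulr_ge0 ?divr_ge0 ?sqrtr_ge0 // ltW.
rewrite -[leRHS](ger0_norm r0) -sqrtr_sqr ler_sqrt ?exprn_ge0 //.
have -> : (8 / 5 * Num.sqrt 3 / s) ^+ 2 = 192 / 25 / s ^+ 2 :> R.
  rewrite expr_div_n exprMn [Num.sqrt 3 ^+ 2]sqr_sqrtr //.
  by field; rewrite gt_eqF.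
apply: ler_wpM2r; first by rewrite invr_ge0 exprn_ge0 // ltW.
by lra.
Qed.
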